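(* Let $L=L(\ell,U,V)$ and $\tilde L=L(\tilde\ell,\tilde U,\tilde V)$ be two matrix quadratic pencils of the form described in the context (with the same $m$), with coefficients $Q_0,Q_1,h_0,h_1,H_0,H_1$ and $\tilde Q_0,\tilde Q_1,\tilde h_0,\tilde h_1,\tilde H_0,\tilde H_1$ respectively, and let $M(\rho)$ and $\tilde M(\rho)$ be their Weyl matrices. If $M(\rho)=\tilde M(\rho)$ (identically in $\rho$), then $L=\tilde L$, that is, $Q_s(x)=\tilde Q_s(x)$ (for almost all $x\in(0,\pi)$), $h_s=\tilde h_s$ and $H_s=\tilde H_s$ for $s=0,1$. Hence the Weyl matrix determines the coefficients of the pencil uniquely.
   Context: Fix $m\ge 1$ and let $I$ be the $m\times m$ unit matrix. The pencil $L=L(\ell,U,V)$ is the boundary value problem on $(0,\pi)$ with spectral parameter $\rho\in\mathbb{C}$ $$\ell Y:=Y''+(\rho^2 I+2i\rho Q_1(x)+Q_0(x))Y=0,\quad x\in(0,\pi),$$ $$U(Y):=Y'(0)+(i\rho h_1+h_0)Y(0)=0,\qquad V(Y):=Y'(\pi)+(i\rho H_1+H_0)Y(\pi)=0,$$ where $Y$ is a column vector of length $m$, $Q_s(x)$ ($s=0,1$) are $m\times m$ complex matrix functions with entries in $W_1^s[0,\pi]$ (so the entries of $Q_1$ are absolutely continuous on $[0,\pi]$ with integrable derivative, and the entries of $Q_0$ are integrable), and $h_s,H_s$ ($s=0,1$) are complex $m\times m$ matrices. No selfadjointness is assumed. It is assumed throughout (for every pencil considered) that $\det(I\pm h_1)\ne0$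 and $\det(I\pm H_1)\neq 0$ (for both choices of sign). The expressions $\ell,U,V$ are applied to $m\times m$ matrix functions in the same way. The Weyl solution $\Phi(x,\rho)$ of $L$ is the $m\times m$ matrix solution of $\ell\Phi=0$ satisfying $U(\Phi)=I$, $V(\Phi)=0$. The Weyl matrix of $L$ is $M(\rho):=\Phi(0,\rho)$; its entries are meromorphic in $\rho$. *)

(* Defs.v *)
From HB Require Import structures.
From mathcomp Require Import all_boot all_order all_algebra.
From mathcomp Require Import complex.
From mathcomp Require Import all_classical all_reals all_analysis.

Set Implicit Arguments.
Unset Strict Implicit.
Unset Printing Implicit Defensive.

Import Order.TTheory GRing.Theory Num.Theory.
Import numFieldNormedType.Exports.

Local Open Scope classical_set_scope.
Local Open Scope ring_scope.
Local Open Scope complex_scope.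

Definition cintegrable (R : realType) (D : set R) (f : R -> R[i]) : Prop :=
  lebesgue_measure.-integrable D (EFin \o (fun x => complex.Re (f x))) /\
  lebesgue_measure.-integrable D (EFin \o (fun x => complex.Im (f x))).

Definition cintegral (R : realType) (D : set R) (f : R -> R[i]) : R[i] :=
  Rintegral lebesgue_measure D (fun x => complex.Re (f x)) +i*
  Rintegral lebesgue_measure D (fun x => complex.Im (f x)).

(* Functions are total on R, but only their values on [0, pi] matter. *)

Definition mx_integrable (R : realType) (m p : nat) (F : R -> 'M[R[i]]_(m, p))
    : Prop :=
  forall i j, cintegrable `[0, pi] (fun x => F x i j).

(* F is absolutely continuous on [0, pi] with integrable derivative F':
   absolute continuity is taken as "F is the indefinite integral of an
   integrable function".  When F' is itself absolutely continuous it is the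
   classical derivative of F at every point of [0, pi], one-sided at 0 and pi;
   in particular F' 0 and F' pi are then determined by F. *)
Definition AC_with_derivative (R : realType) (m p : nat)
    (F F' : R -> 'M[R[i]]_(m, p)) : Prop :=
  mx_integrable F' /\
  forall x, x \in `[0, pi] ->
    forall i j, F x i j = F 0 i j + cintegral `[0, x] (fun t => F' t i j).

Definition mx_W11 (R : realType) (m p : nat) (F : R -> 'M[R[i]]_(m, p))
    : Prop :=
  exists F', AC_with_derivative F F'.

Record pencil (R : realType) (m : nat) := Pencil {
  Q0 : R -> 'M[R[i]]_m;
  Q1 : R -> 'M[R[i]]_m;
  h0 : 'M[R[i]]_m;
  h1 : 'M[R[i]]_m;
  H0 : 'M[R[i]]_m;
  H1 : 'M[R[i]]_m
}.

Definition admissible (R : realType) (m : nat) (L : pencil R m) : Prop :=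
  [/\ mx_W11 (Q1 L), mx_integrable (Q0 L),
      \det (1%:M + h1 L) != 0 /\ \det (1%:M - h1 L) != 0 &
      \det (1%:M + H1 L) != 0 /\ \det (1%:M - H1 L) != 0].

(* The expressions below take Y together with its derivatives Y', Y''.
   p = 1 gives column vectors and p = m gives square matrices. *)

Definition ell (R : realType) (m p : nat) (L : pencil R m) (rho : R[i])
    (Y Y'' : R -> 'M[R[i]]_(m, p)) (x : R) : 'M[R[i]]_(m, p) :=
  Y'' x + ((rho ^+ 2)%:M + (2%:R * 'i%C * rho) *: Q1 L x + Q0 L x) *m Y x.

Definition bcU (R : realType) (m p : nat) (L : pencil R m) (rho : R[i])
    (Y Y' : R -> 'M[R[i]]_(m, p)) : 'M[R[i]]_(m, p) :=
  Y' 0 + (('i%C * rho) *: h1 L + h0 L) *m Y 0.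

Definition bcV (R : realType) (m p : nat) (L : pencil R m) (rho : R[i])
    (Y Y' : R -> 'M[R[i]]_(m, p)) : 'M[R[i]]_(m, p) :=
  Y' pi + (('i%C * rho) *: H1 L + H0 L) *m Y pi.

(* Y and Y' are absolutely continuous and the equation holds almost
   everywhere, since Q0 is only integrable. *)
Definition solution (R : realType) (m p : nat) (L : pencil R m) (rho : R[i])
    (Y Y' : R -> 'M[R[i]]_(m, p)) : Prop :=
  exists Y'' : R -> 'M[R[i]]_(m, p),
    [/\ AC_with_derivative Y Y', AC_with_derivative Y' Y'' &
        {ae lebesgue_measure,
          forall x : R, x \in `]0, pi[ -> ell L rho Y Y'' x = 0}].

Definition weyl_solution (R : realType) (m : nat) (L : pencil R m)
    (rho : R[i]) (Phi Phi' : R -> 'M[R[i]]_m) : Prop :=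
  [/\ solution L rho Phi Phi', bcU L rho Phi Phi' = 1%:M &
      bcV L rho Phi Phi' = 0].

(* The graph of the Weyl matrix: "the Weyl solution exists at rho and its value
   at x = 0 is M".  The Weyl solution exists exactly when rho is not an
   eigenvalue of L, it is then unique, and the eigenvalues are precisely the
   poles of the Weyl matrix. *)
Definition is_weyl_matrix (R : realType) (m : nat) (L : pencil R m)
    (rho : R[i]) (M : 'M[R[i]]_m) : Prop :=
  exists Phi Phi' : R -> 'M[R[i]]_m,
    weyl_solution L rho Phi Phi' /\ Phi 0 = M.

(* Equality of meromorphic functions: equality wherever both are defined. *)
Definition same_weyl_matrix (R : realType) (m : nat) (L Lt : pencil R m)
    : Prop :=
  forall (rho : R[i]) (M Mt : 'M[R[i]]_m),
    is_weyl_matrix L rho M -> is_weyl_matrix Lt rho Mt -> M = Mt.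

(* Main.v *)
Require Import Defs.
From mathcomp Require Import all_boot all_order all_algebra all_solvable all_field.
From mathcomp Require Import complex ring lra.
From mathcomp Require Import all_classical all_reals all_analysis.
From mathcomp Require Import measurable_realfun.

(* With r the primitive of Q0 vanishing at 0, the pair u = Y, v = Y' + r Y solves a first-order
   system whose coefficients are continuous in x and polynomial in rho.  Let P(x, rho) be the
   matrix sending the solutions of the second system to those of the first one with the same
   initial value and the same datum U at 0; it is a locally uniform limit of polynomials in rho.
   For |Im rho| large the space of solutions splits into Weyl solutions, decaying like
   exp(-|Im rho| x), and solutions with U = 0, growing like exp(|Im rho| x); equality of the Weyl
   matrices means that P respects this splitting, so P is bounded in the norm |v| + |rho| |u|.
   In the strip where |Im rho| is bounded the same bound is just Gronwall's inequality.  Hence the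
   upper right block of P is O(1/rho) and vanishes by Liouville's theorem, and the differential
   equation of P then forces P = 1 and equality of all the coefficients. *)
Set Implicit Arguments.
Unset Strict Implicit.
Unset Printing Implicit Defensive.

Import Order.TTheory GRing.Theory Num.Theory.
Import numFieldNormedType.Exports.
Import ComplexField.Normc.
Local Open Scope classical_set_scope.
Local Open Scope ring_scope.

(** * Exponential dichotomy of real energies *)

(** Since [Q0] is only integrable, the second derivative of [Y] exists only almost everywhere; in
    the equation for [v] the term [Q0 Y] cancels and only the continuous [r] remains, so the
    analytic core works with classical derivatives, and absolute continuity returns only in the
    dictionary with the pencil. No asymptotic formulas are used: the energies [|v + i rho u|^2] and
    [|v - i rho u|^2] suffice, because [2 i rho Q1 u] is [Q1] times the difference of the two modes
    and so perturbs their rates by bounded amounts only. For [Im rho] large, invertibility of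
    [I + h1] gives a solution with [U = 0] a definite share of the growing mode at 0, and
    invertibility of [I - H1] gives a solution with [V = 0] a definite share of the decaying mode at
    [pi]; the other two determinants serve the lower half-plane. [P] is defined by its own
    differential equation rather than through Weyl solutions, so it is entire in [rho] at once. The
    Weyl matrices are compared only for [|Im rho|] large, where both exist, and no meromorphic
    function has to be handled. *)

Section RealCalculus.
Variable R : realType.
Implicit Types (f g : R -> R) (a b c x y l : R).

Lemma is_derive_continuous f x d : is_derive x 1 f d -> {for x, continuous f}.
Proof. by move=> [+ _] => /derivable1_diffP/differentiable_continuous. Qed.

Lemma is_derive_within f f' a b :
  (forall x, a <= x <= b -> is_derive x 1 f (f' x)) ->
  {within `[a, b], continuous f}.
Proof.
move=> df; apply: derivable_within_continuous => x; rewrite in_itv /= => xab.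
by case: (df x xab).
Qed.

Lemma is_derive_ndecr f f' a b : a <= b ->
  (forall x, a <= x <= b -> is_derive x 1 f (f' x)) ->
  (forall x, a <= x <= b -> 0 <= f' x) -> f a <= f b.
Proof.
move=> ab df f'0.
have [x||x xab] := @MVT_segment R f f' a b ab.
- by rewrite in_itv /= => /andP[/ltW ax /ltW xb]; apply: df; rewrite ax.
- exact: is_derive_within df.
move: xab; rewrite in_itv /= => /f'0 fx0 E.
by rewrite -subr_ge0 E mulr_ge0 // subr_ge0.
Qed.

Lemma is_derive_le f f' g g' a b : a <= b ->
  (forall x, a <= x <= b -> is_derive x 1 f (f' x)) ->
  (forall x, a <= x <= b -> is_derive x 1 g (g' x)) ->
  (forall x, a <= x <= b -> f' x <= g' x) -> f b - f a <= g b - g a.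
Proof.
move=> ab df dg fg.
suff : g a - f a <= g b - f b by lra.
apply: (@is_derive_ndecr (fun t => g t - f t) (fun t => g' t - f' t)) => // x xab.
  by have := df x xab; have := dg x xab => ? ?; apply: is_deriveB.
by rewrite subr_ge0 fg.
Qed.

Lemma is_derive_expMl k x : is_derive x 1 (fun t : R => expR (k * t)) (k * expR (k * x)).
Proof.
have H : is_derive x 1 ( *%R k : R -> R) (k * 1).
  exact: (@is_deriveZ _ _ _ id k x 1 1).
have := @is_derive1_comp R expR ( *%R k) x _ _ (is_derive_expR (k * x)) H.
by move=> H'; apply: is_derive_eq; rewrite mulr1 mulrC.
Qed.

(** Gronwall's inequality, from monotonicity of [- expR (- a * t) * f t]. *)
Lemma is_derive_le_exp f f' a x : 0 <= x ->
  (forall t, 0 <= t <= x -> is_derive t 1 f (f' t)) ->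
  (forall t, 0 <= t <= x -> f' t <= a * f t) -> f x <= expR (a * x) * f 0.
Proof.
move=> x0 df fa.
pose g := (fun t => - (expR (- a * t))) * f.
have H : g 0 <= g x.
  apply: (@is_derive_ndecr _ (fun t => expR (- a * t) * (a * f t - f' t))) => // t tx.
    have := df t tx; have := is_derive_expMl (- a) t => ? ?.
    have E : is_derive t 1 (fun t => - (expR (- a * t))) (- (- a * expR (- a * t))).
      exact: is_deriveN.
    apply: is_derive_eq; rewrite /GRing.scale /=; ring.
  by rewrite mulr_ge0 ?expR_ge0 // subr_ge0 fa.
move: H; rewrite /g !fctE mulr0 expR0 mulNr mul1r mulNr lerN2 => H.
rewrite -(@ler_pM2l _ (expR (- a * x))) ?expR_gt0 //.
by rewrite mulrA -expRD mulNr addNr expR0 mul1r -mulNr.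
Qed.

Lemma is_derive_ge_exp f f' a x : 0 <= x ->
  (forall t, 0 <= t <= x -> is_derive t 1 f (f' t)) ->
  (forall t, 0 <= t <= x -> a * f t <= f' t) -> expR (a * x) * f 0 <= f x.
Proof.
move=> x0 df fa; rewrite -lerN2 -mulrN.
apply: (@is_derive_le_exp (fun t => - f t) (fun t => - f' t)) => // t tx.
  by have := df t tx => ?; apply: is_deriveN.
by rewrite mulrN lerN2 fa.
Qed.

Lemma is_deriveMl k f x d : is_derive x 1 f d -> is_derive x 1 (fun t => k * f t) (k * d).
Proof. by move=> df; exact: (@is_deriveZ R R R f k x 1 d). Qed.

Lemma is_derive_reflect f d l x :
  is_derive (l - x) 1 f d -> is_derive x 1 (fun t => f (l - t)) (- d).
Proof.
move=> df.
have H : is_derive x 1 (fun t : R => l - t) (- 1).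
  have := @is_deriveB _ _ _ (cst l) id x 1 0 1 => H; apply: is_derive_eq.
  by rewrite sub0r.
have := @is_derive1_comp R f (fun t => l - t) x _ _ df H.
by move=> H'; apply: is_derive_eq; rewrite mulrN1.
Qed.

(* E1 is the energy of the decaying mode and E2 that of the growing one. *)
Definition dichotomy (l c tau : R) (E1 E2 E1' E2' : R -> R) : Prop :=
  forall x, 0 <= x <= l ->
  [/\ is_derive x 1 E1 (E1' x), is_derive x 1 E2 (E2' x),
      0 <= E1 x /\ 0 <= E2 x,
      `|E1' x + 2 * tau * E1 x| <= c * (E1 x + E2 x) &
      `|E2' x - 2 * tau * E2 x| <= c * (E1 x + E2 x)].

(** Running the interval backwards exchanges growth and decay, so a statement about the growing mode
    also covers the decaying one, started from the right end. *)
Lemma dichotomy_reflect l c tau E1 E2 E1' E2' :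
  dichotomy l c tau E1 E2 E1' E2' ->
  dichotomy l c tau (fun x => E2 (l - x)) (fun x => E1 (l - x))
    (fun x => - E2' (l - x)) (fun x => - E1' (l - x)).
Proof.
move=> D x /andP[x0 xl].
have [|d1 d2 [p1 p2] e1 e2] := D (l - x).
  by rewrite subr_ge0 xl lerBlDr lerDl.
split => //; first exact: is_derive_reflect; first exact: is_derive_reflect.
  by rewrite -normrN opprD opprK (addrC (E2 _)).
by rewrite -normrN opprB opprK addrC (addrC (E2 _)).
Qed.

(** Adding the two differential inequalities costs the rate [2 * |tau|]. This is harmless where
    [tau] stays bounded, and for any [tau] it still shows that zero data propagate. *)
Lemma dichotomy_total l c tau E1 E2 E1' E2' x : 0 <= x <= l ->
  dichotomy l c tau E1 E2 E1' E2' ->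
  E1 x + E2 x <= expR ((2 * `|tau| + 2 * c) * x) * (E1 0 + E2 0).
Proof.
move=> /andP[x0 xl] D.
apply: (@is_derive_le_exp (E1 + E2) (fun t => E1' t + E2' t)) => // t /andP[t0 tx].
  by have [|? ? _ _ _] := D t; [rewrite t0 (le_trans tx)|exact: is_deriveD].
have [|_ _ [p1 p2]] := D t; first by rewrite t0 (le_trans tx).
rewrite !ler_norml !fctE => /andP[_ e1] /andP[_ e2].
have : - tau * E1 t <= `|tau| * E1 t by rewrite ler_wpM2r // -normrN ler_norm.
have : tau * E2 t <= `|tau| * E2 t by rewrite ler_wpM2r // ler_norm.
lra.
Qed.

Lemma dichotomy_total_rev l c tau E1 E2 E1' E2' x : 0 <= x <= l ->
  dichotomy l c tau E1 E2 E1' E2' ->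
  E1 0 + E2 0 <= expR ((2 * `|tau| + 2 * c) * x) * (E1 x + E2 x).
Proof.
move=> /andP[x0 xl] D.
have D' : dichotomy x c tau E1 E2 E1' E2'.
  by move=> t /andP[t0 tx]; apply: D; rewrite t0 (le_trans tx).
have := @dichotomy_total _ _ _ _ _ _ _ x _ (dichotomy_reflect D').
by rewrite x0 lexx subrr subr0 addrC [X in _ -> _ <= _ * X]addrC; apply.
Qed.

(** For [tau] large, [k * E2 - E1] is nondecreasing, so the cone [E1 <= k * E2] is invariant. Inside
    it both errors are at most [c' * E2] with [c' = c * (1 + k)]: hence [E2] grows at rate [2 * tau]
    up to [c'], while [E1] decays apart from a forcing by [E2] that is small compared with
    [tau * E2]. After a distance [d] the initial [E1] is forgotten and the cone has narrowed to
    opening [e]. *)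
Lemma growing_cone l c k e d : 0 <= c -> 0 < k -> 0 < e -> 0 < d -> 0 <= l ->
  exists T K, 0 < K /\ forall tau E1 E2 E1' E2', T <= tau ->
  dichotomy l c tau E1 E2 E1' E2' -> E1 0 <= k * E2 0 ->
  forall x, 0 <= x <= l ->
  [/\ expR (2 * tau * x) * E2 0 <= K * E2 x,
      E2 x <= K * expR (2 * tau * x) * E2 0,
      E1 x <= k * E2 x & (d <= x -> E1 x <= e * E2 x)].
Proof.
move=> c0 k0 e0 d0 l0.
pose c' := c * (1 + k).
have c'0 : 0 <= c' by rewrite mulr_ge0 // addr_ge0 // ltW.
(* the last term makes e^(-2 tau d) k <= e / 2 *)
pose T := c' + c' / k + (1 + e) * c' / e + k / (e * d).
(* The constant absorbs the uncertainty [c'] in the growth rate over the whole interval. *)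
exists T, (expR (c' * l)); split; first exact: expR_gt0.
move=> tau E1 E2 E1' E2' Ttau D E120.
have ck0 : 0 <= c' / k by rewrite divr_ge0 // ltW.
have ce0 : 0 <= (1 + e) * c' / e.
  by rewrite divr_ge0 // ?mulr_ge0 // ?addr_ge0 // ltW.
have kd0 : 0 <= k / (e * d) by rewrite divr_ge0 // ?mulr_ge0 // ltW.
have t1 : c' <= tau by apply: le_trans Ttau; rewrite /T; lra.
have tau0 : 0 <= tau by apply: le_trans t1.
have t2 : c' <= tau * k by rewrite -ler_pdivrMr //; apply: le_trans Ttau; rewrite /T; lra.
have t3 : (1 + e) * c' <= tau * e.
  by rewrite -ler_pdivrMr //; apply: le_trans Ttau; rewrite /T; lra.
have t4 : k <= tau * (e * d).
  by rewrite -ler_pdivrMr ?mulr_gt0 //; apply: le_trans Ttau; rewrite /T; lra.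
have cone x : 0 <= x <= l -> E1 x <= k * E2 x.
  move=> /andP[x0 xl].
  have : k * E2 0 - E1 0 <= k * E2 x - E1 x.
    apply: (@is_derive_ndecr (fun t => k * E2 t - E1 t) (fun t => k * E2' t - E1' t) 0 x) => // t /andP[t0 tx].
      have [|d1 d2 _ _ _] := D t; first by rewrite t0 (le_trans tx).
      by have := is_deriveMl k d2 => ?; apply: is_deriveB.
    have [|_ _ [p1 p2]] := D t; first by rewrite t0 (le_trans tx).
    rewrite !ler_norml => /andP[_ e1] /andP[e2 _].
    have : k * (- (c * (E1 t + E2 t))) <= k * (E2' t - 2 * tau * E2 t).
      by rewrite ler_pM2l.
    have : c' * E1 t <= tau * E1 t by rewrite ler_wpM2r.
    have : c' * E2 t <= tau * k * E2 t by rewrite ler_wpM2r.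
    have : 0 <= tau * E1 t by rewrite mulr_ge0.
    have : 0 <= tau * k * E2 t by rewrite !mulr_ge0 // ltW.
    rewrite /c'; lra.
  lra.
have E2bnd x : 0 <= x <= l -> `|E2' x - 2 * tau * E2 x| <= c' * E2 x.
  move=> xl; have [_ _ [p1 p2] _ e2] := D x xl.
  apply: le_trans e2 _; rewrite /c' -mulrA ler_wpM2l // mulrDl mul1r addrC lerD2l.
  exact: cone.
have E1bnd x : 0 <= x <= l -> `|E1' x + 2 * tau * E1 x| <= c' * E2 x.
  move=> xl; have [_ _ [p1 p2] e1 _] := D x xl.
  apply: le_trans e1 _; rewrite /c' -mulrA ler_wpM2l // mulrDl mul1r addrC lerD2l.
  exact: cone.
move=> x /andP[x0 xl].
have sub t : 0 <= t <= x -> 0 <= t <= l by move=> /andP[-> /le_trans]; apply.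
have lo : expR ((2 * tau - c') * x) * E2 0 <= E2 x.
  apply: (@is_derive_ge_exp _ E2') => // t /sub tl; first by have [] := D t tl.
  by have := E2bnd t tl; rewrite ler_norml => /andP[]; lra.
have hi : E2 x <= expR ((2 * tau + c') * x) * E2 0.
  apply: (@is_derive_le_exp _ E2') => // t /sub tl; first by have [] := D t tl.
  by have := E2bnd t tl; rewrite ler_norml => /andP[]; lra.
have [|_ _ [_ E200] _ _] := D 0; first by rewrite lexx.
have [|_ _ [p1 p2] _ _] := D x; first by rewrite x0.
have ex : expR (c' * x) <= expR (c' * l) by rewrite ler_expR ler_wpM2l.
split.
- apply: (@le_trans _ _ (expR (c' * x) * E2 x)); last by rewrite ler_wpM2r.
  rewrite -(ler_pM2l (expR_gt0 (c' * x))) in lo; apply: le_trans lo.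
  by rewrite mulrA -expRD -mulrDl addrC subrK.
- apply: le_trans hi _; rewrite ler_wpM2r // mulrDl expRD [leLHS]mulrC.
  by rewrite ler_wpM2r ?expR_ge0.
- by apply: cone; rewrite x0.
move=> dx.
(* Subtracting [e / 2 * E2] outweighs the forcing of [E1], so that the difference decays at the full
   rate [2 * tau]. *)
have H : E1 x - e / 2 * E2 x <= expR (- (2 * tau) * x) * (E1 0 - e / 2 * E2 0).
  apply: (@is_derive_le_exp (fun t => E1 t - e / 2 * E2 t) (fun t => E1' t - e / 2 * E2' t)) => // t /sub tl.
    by have [d1 /(is_deriveMl (e / 2)) d2 _ _ _] := D t tl; apply: is_deriveB.
  have [_ _ [q1 q2] _ _] := D t tl.
  have := E2bnd t tl; have := E1bnd t tl.
  rewrite !ler_norml => /andP[_ h1] /andP[h2 _].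
  have : e * (- (c' * E2 t)) <= e * (E2' t - 2 * tau * E2 t) by rewrite ler_pM2l.
  have : ((1 + e) * c') * E2 t <= tau * e * E2 t by rewrite ler_wpM2r.
  have : 0 <= c' * E2 t by rewrite mulr_ge0.
  have : 0 <= e * (c' * E2 t) by apply: mulr_ge0; [exact: ltW|exact: mulr_ge0].
  have : 0 <= tau * e * E2 t by apply: mulr_ge0 => //; apply: mulr_ge0 => //; exact: ltW.
  lra.
have E2mono : E2 0 <= E2 x.
  apply: le_trans lo; rewrite ler_peMl // leNgt expR_lt1 -leNgt.
  by apply: mulr_ge0 => //; rewrite subr_ge0; lra.
have : expR (- (2 * tau) * x) * (E1 0 - e / 2 * E2 0) <= expR (- (2 * tau) * x) * (k * E2 x).
  rewrite ler_wpM2l ?expR_ge0 //.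
  have : 0 <= e * E2 0 by rewrite mulr_ge0 // ltW.
  have : k * E2 0 <= k * E2 x by rewrite ler_pM2l.
  lra.
have : expR (- (2 * tau) * x) * k <= e / 2.
  rewrite mulNr expRN ler_pdivrMl ?expR_gt0 //.
  apply: (@le_trans _ _ ((2 * tau * x) * (e / 2))); last first.
    by apply: ler_wpM2r; [lra|apply: le_trans (expR_ge1Dx _); lra].
  apply: le_trans t4 _.
  have : 0 <= tau * e by rewrite mulr_ge0 // ltW.
  move=> te; have : tau * e * d <= tau * e * x by rewrite ler_wpM2l.
  by lra.
rewrite mulrA => h /(le_trans H).
have : expR (- (2 * tau) * x) * k * E2 x <= e / 2 * E2 x by rewrite ler_wpM2r.
lra.
Qed.

End RealCalculus.

(** * Liouville's theorem for limits of polynomials *)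

Section ComplexModulus.
Variable R : realType.
Local Notation C := R[i].
Implicit Types z w : C.

Lemma normc_ge0 z : 0 <= normc z.
Proof. by case: z => a b; exact: sqrtr_ge0. Qed.

Lemma normcX z n : normc (z ^+ n) = normc z ^+ n.
Proof.
elim: n => [|n IH]; first by rewrite !expr0 normc1.
by rewrite !exprS normcM IH.
Qed.

Lemma normc_real (x : R) : normc x%:C%C = `|x|.
Proof. by rewrite /normc /= expr0n /= addr0 sqrtr_sqr. Qed.

Lemma le_normc_sum (I : Type) (s : seq I) (P : pred I) (F : I -> C) :
  normc (\sum_(i <- s | P i) F i) <= \sum_(i <- s | P i) normc (F i).
Proof.
elim/big_rec2: _ => [|i x y _ xy]; first by rewrite normc0.
by apply: le_trans (le_normcD _ _) _; rewrite lerD2l.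
Qed.

(** ['X^N - 1] splits and is separable in characteristic 0, so it has [N] distinct roots, and a
    group of [N] roots of unity of that exponent contains a primitive one. *)
Lemma exists_primitive_root N : (0 < N)%N -> exists w : C, N.-primitive_root w.
Proof.
move=> N0; pose q : {poly C} := 'X^N - 1.
have [s] := closed_field_poly_normal q.
rewrite (monicP _) ?monicXnsubC // scale1r => qE.
have us : uniq s by rewrite -separable_prod_XsubC -qE separable_Xn_sub_1 ?pnatr_eq0 -?lt0n.
have ss : (N <= size s)%N by rewrite -ltnS -(size_prod_XsubC s id) -qE size_XnsubC.
have rs : all N.-unity_root s by apply/allP => z; rewrite -root_prod_XsubC -qE.
by have /hasP[w _ wP] := has_prim_root N0 rs us ss; exists w.
Qed.

Lemma sum_expr_eq0 (F : fieldType) (q : F) N :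
  q != 1 -> q ^+ N = 1 -> \sum_(k < N) q ^+ k = 0.
Proof.
move=> q1 qN; have /eqP := subrX1 q N; rewrite qN subrr eq_sym mulf_eq0 subr_eq0.
by rewrite (negPf q1) => /eqP.
Qed.

(* Discrete Fourier inversion over the N-th roots of unity, N > deg p. *)
Lemma normc_coef_le (p : {poly C}) (r K : R) n : 0 < r ->
  (forall z, normc z = r -> normc p.[z] <= K) -> normc p`_n * r ^+ n <= K.
Proof.
move=> r0 pK; pose N := (size p + n.+1)%N.
have N0 : (0 < N)%N by rewrite /N addnS.
have nN : (n < N)%N by rewrite /N leq_addl.
have [w wP] := exists_primitive_root N0.
have w1 : normc w = 1.
  have /eqP : normc w ^+ N = 1 by rewrite -normcX (prim_expr_order wP) normc1.
  by rewrite pexprn_eq1 ?normc_ge0 // => /orP[/eqP E|/eqP //]; rewrite E in N0.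
have w0 : w != 0.
  by apply: contraTneq (ltr01 : (0 : R) < 1) => E; rewrite -w1 E normc0 ltxx.
(* The coefficient of index [j] is multiplied by a geometric sum of ratio [w ^+ j / w ^+ n], which
   vanishes unless [j = n] since both indices are below [N]. *)
have key : \sum_(k < N) p.[r%:C%C * w ^+ k] / w ^+ k ^+ n = (p`_n * r%:C%C ^+ n) *+ N.
  under eq_bigr => k _ do rewrite (@horner_coef_wide _ N) ?leq_addr // mulr_suml.
  rewrite exchange_big /= (bigD1 (Ordinal nN)) //= [X in _ + X]big1 ?addr0; last first.
    move=> j jn.
    under eq_bigr => k _.
      rewrite exprMn mulrA -mulrA -!exprM mulnC (mulnC k) !exprM -expr_div_n; over.
    rewrite -mulr_sumr sum_expr_eq0 ?mulr0 //; last first.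
      by rewrite expr_div_n -!exprM !(mulnC _ N) !exprM (prim_expr_order wP) !expr1n divr1.
    apply: contra jn => /eqP E; apply/eqP/val_inj => /=.
    have : w ^+ j == w ^+ n by rewrite -(divfK (expf_neq0 n w0) (w ^+ j)) E mul1r.
    by rewrite (eq_prim_root_expr wP) !modn_small // => /eqP.
  under eq_bigr => k _ do rewrite exprMn mulrA mulfK ?expf_neq0 //.
  by rewrite sumr_const card_ord.
have NR : 0 < N%:R :> R by rewrite ltr0n.
rewrite -(ler_pM2r NR) !mulr_natr -[r](gtr0_norm r0) -normc_real -normcX -normcM -normcMn -key.
apply: le_trans (le_normc_sum _ _ _) _.
rewrite -[K *+ N](_ : \sum_(k < N) K = _); last by rewrite sumr_const card_ord.
apply: ler_sum => k _; rewrite normcM normcV !normcX w1 !expr1n invr1 mulr1 pK //.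
by rewrite normcM normcX w1 expr1n mulr1 normc_real gtr0_norm.
Qed.

(** A weak maximum principle: the coefficient bounds turn the value in the disc of half the radius
    into a geometric series of ratio 1/2, whose sum is the factor 2. *)
Lemma normc_horner_le (p : {poly C}) (r K : R) z : 0 < r ->
  (forall z, normc z = r -> normc p.[z] <= K) -> normc z * 2 <= r ->
  normc p.[z] <= 2 * K.
Proof.
move=> r0 pK zr.
have K0 : 0 <= K.
  by apply: le_trans (pK r%:C%C _); rewrite ?normc_ge0 // normc_real gtr0_norm.
rewrite horner_coef; apply: le_trans (le_normc_sum _ _ _) _.
apply: (@le_trans _ _ (\sum_(i < size p) K * 2^-1 ^+ i)).
  apply: ler_sum => i _; rewrite normcM normcX.
  apply: (@le_trans _ _ (normc p`_i * (r / 2) ^+ i)).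
    rewrite ler_wpM2l ?normc_ge0 // lerXn2r ?nnegrE ?normc_ge0 ?divr_ge0 ?(ltW r0) //.
    by rewrite ler_pdivlMr.
  by rewrite exprMn mulrA ler_wpM2r ?exprn_ge0 ?invr_ge0 // normc_coef_le.
rewrite -mulr_sumr mulrC ler_wpM2r //.
have := subrX1 (2^-1 : R) (size p); set S := \sum_(i < _) _.
have : 0 <= (2^-1 : R) ^+ size p by rewrite exprn_ge0 ?invr_ge0.
lra.
Qed.

(* Locally uniform limits of polynomials, a stand-in for entire functions. *)
Definition poly_approx (f : C -> C) : Prop :=
  forall r e : R, 0 < e ->
  exists p : {poly C}, forall z, normc z <= r -> normc (f z - p.[z]) <= e.

(** Liouville's theorem for functions that are O(1/z). On a circle of radius at least [|K| / e] the
    function is at most [e] and its approximating polynomial at most [2 * e]; hence the polynomial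
    is at most [4 * e] at [z] and the function at most [5 * e], which explains [e' / 5]. *)
Lemma poly_approx_eq0 f (r0 K : R) : poly_approx f ->
  (forall z, r0 <= normc z -> normc z * normc (f z) <= K) -> forall z, f z = 0.
Proof.
move=> fp fK z; apply: eq0_normc; apply/eqP; rewrite eq_le normc_ge0 andbT.
apply/ler_addgt0Pr => e' e'0; rewrite add0r; pose e := e' / 5.
have e0 : 0 < e by rewrite divr_gt0.
pose r := `|r0| + normc z * 2 + `|K| / e + 1.
have Ke : 0 <= `|K| / e by rewrite divr_ge0 // ltW.
have := normc_ge0 z; have := normr_ge0 r0; have := ler_norm r0 => a1 a2 a3.
have r1 : 0 < r by rewrite /r; lra.
have r2 : r0 <= r by rewrite /r; lra.
have r3 : normc z * 2 <= r by rewrite /r; lra.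
have [p pf] := fp r e e0.
have pr w : normc w = r -> normc p.[w] <= 2 * e.
  move=> wr; rewrite -[p.[w]](subKr (f w)).
  apply: le_trans (le_normcD _ _) _; rewrite normcN mulr_natl mulr2n.
  apply: lerD; last by apply: pf; rewrite wr.
  rewrite -(ler_pM2l r1) -{1}wr; apply: le_trans (fK w _) _; first by rewrite wr.
  apply: le_trans (ler_norm K) _; rewrite -ler_pdivrMr // /r; lra.
have := normc_horner_le r1 pr r3.
have : normc (f z - p.[z]) <= e by apply: pf; rewrite /r in r3 *; lra.
have := le_normcD (f z - p.[z]) p.[z]; rewrite subrK /e; lra.
Qed.
End ComplexModulus.

(** * Complex-valued functions of a real variable *)

Section ComplexCalculus.
Variable R : realType.
Local Notation C := R[i].
Local Notation Re := (@complex.Re R).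
Local Notation Im := (@complex.Im R).
Implicit Types (z w : C) (f g : R -> C) (x b k l : R).

Lemma cReD z w : Re (z + w) = Re z + Re w. Proof. by case: z; case: w. Qed.
Lemma cImD z w : Im (z + w) = Im z + Im w. Proof. by case: z; case: w. Qed.
Lemma cReN z : Re (- z) = - Re z. Proof. by case: z. Qed.
Lemma cImN z : Im (- z) = - Im z. Proof. by case: z. Qed.
Lemma cReB z w : Re (z - w) = Re z - Re w. Proof. by rewrite cReD cReN. Qed.
Lemma cImB z w : Im (z - w) = Im z - Im w. Proof. by rewrite cImD cImN. Qed.
Lemma cReM z w : Re (z * w) = Re z * Re w - Im z * Im w.
Proof. by case: z; case: w. Qed.
Lemma cImM z w : Im (z * w) = Re z * Im w + Im z * Re w.
Proof. by case: z => a b; case: w => c d /=; rewrite addrC [b * c]mulrC addrC [c * b]mulrC. Qed.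

Lemma complexP z w : Re z = Re w -> Im z = Im w -> z = w.
Proof. by case: z => a b; case: w => c d /= -> ->. Qed.

Lemma normc_sqrE z : normc z ^+ 2 = Re z ^+ 2 + Im z ^+ 2.
Proof. by case: z => a b /=; rewrite sqr_sqrtr // addr_ge0 ?sqr_ge0. Qed.

Lemma normr_Re_le z : `|Re z| <= normc z.
Proof. by case: z => a b /=; rewrite -sqrtr_sqr ler_sqrt ?addr_ge0 ?sqr_ge0 // lerDl sqr_ge0. Qed.
Lemma normr_Im_le z : `|Im z| <= normc z.
Proof. by case: z => a b /=; rewrite -sqrtr_sqr ler_sqrt ?addr_ge0 ?sqr_ge0 // lerDr sqr_ge0. Qed.
Lemma normc_le_ReIm z : normc z <= `|Re z| + `|Im z|.
Proof.
rewrite -(@ler_pXn2r _ 2) ?nnegrE ?normc_ge0 ?addr_ge0 //.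
rewrite normc_sqrE sqrrD !real_normK ?num_real // lerD2r lerDl.
by rewrite mulrn_wge0 // mulr_ge0.
Qed.

Definition ccontinuous f : Prop :=
  continuous (fun t => Re (f t)) /\ continuous (fun t => Im (f t)).

Lemma ccontinuous_cst z : ccontinuous (fun=> z).
Proof. by split=> x; exact: cvg_cst. Qed.

Lemma ccontinuousD f g : ccontinuous f -> ccontinuous g -> ccontinuous (fun t => f t + g t).
Proof.
move=> [f1 f2] [g1 g2]; split=> x.
  by under [X in continuous_at _ X]eq_fun do rewrite cReD; apply: cvgD; [exact: f1|exact: g1].
by under [X in continuous_at _ X]eq_fun do rewrite cImD; apply: cvgD; [exact: f2|exact: g2].
Qed.

Lemma ccontinuousM f g : ccontinuous f -> ccontinuous g -> ccontinuous (fun t => f t * g t).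
Proof.
move=> [f1 f2] [g1 g2]; split=> x.
  under [X in continuous_at _ X]eq_fun do rewrite cReM.
  by apply: cvgB; apply: cvgM; [exact: f1|exact: g1|exact: f2|exact: g2].
under [X in continuous_at _ X]eq_fun do rewrite cImM.
by apply: cvgD; apply: cvgM; [exact: f1|exact: g2|exact: f2|exact: g1].
Qed.

Lemma ccontinuous_sum (I : Type) (s : seq I) (P : pred I) (F : I -> R -> C) :
  (forall i, ccontinuous (F i)) -> ccontinuous (fun t => \sum_(i <- s | P i) F i t).
Proof.
move=> cF; elim: s => [|i s IH].
  by under [X in ccontinuous X]eq_fun do rewrite big_nil; exact: ccontinuous_cst.
under [X in ccontinuous X]eq_fun do rewrite big_cons.
by case: (P i) => //; exact: ccontinuousD.
Qed.

Lemma ccontinuous_comp f (h : R -> R) :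
  continuous h -> ccontinuous f -> ccontinuous (fun t => f (h t)).
Proof.
move=> ch [f1 f2]; split=> x.
  by apply: (@continuous_comp _ _ _ h (fun t => Re (f t))); [exact: ch|exact: f1].
by apply: (@continuous_comp _ _ _ h (fun t => Im (f t))); [exact: ch|exact: f2].
Qed.

Lemma ccontinuous_bounded f b : ccontinuous f ->
  exists M, forall x, 0 <= x <= b -> normc (f x) <= M.
Proof.
have real_case (h : R -> R) : continuous h ->
    exists M, forall x, 0 <= x <= b -> `|h x| <= M.
  move=> ch; have [b0|b0] := leP 0 b; last first.
    by exists 0 => x /andP[x0 /(le_trans x0)]; rewrite leNgt b0.
  have cnh : {within `[0, b], continuous (fun t => `|h t|)}.
    apply: continuous_subspaceT => x.
    by apply: (@continuous_comp _ _ _ h (fun t => `|t|)); [exact: ch|exact: norm_continuous].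
  have [c _ cP] := EVT_max b0 cnh; exists `|h c| => x xb; apply: cP.
  by rewrite in_itv.
move=> [/real_case[M1 h1] /real_case[M2 h2]]; exists (M1 + M2) => x xb.
by apply: le_trans (normc_le_ReIm _) _; apply: lerD; [exact: h1|exact: h2].
Qed.

Lemma ccontinuous_uniform_limit f :
  (forall e : R, 0 < e -> exists2 g, ccontinuous g & forall x, normc (f x - g x) <= e) ->
  ccontinuous f.
Proof.
have real_case (h : R -> R) :
    (forall e : R, 0 < e -> exists2 g, continuous g & forall x, `|h x - g x| <= e) ->
    continuous h.
  move=> H x; apply/cvgrPdist_le => e e0.
  have [|g cg hg] := H (e / 3); first by rewrite divr_gt0.
  have /cvgrPdist_le := cg x => /(_ (e / 3)) H'.
  near=> t.
  have := hg x; have := hg t.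
  have : `|g x - g t| <= e / 3 by near: t; apply: H'; rewrite divr_gt0.
  rewrite !ler_norml => /andP[? ?] /andP[? ?] /andP[? ?].
  by apply/andP; split; lra.
move=> H; split; apply: real_case => e /H[g [g1 g2] fg].
  exists (fun t => Re (g t)) => // x; rewrite -cReB.
  exact: le_trans (normr_Re_le _) (fg x).
exists (fun t => Im (g t)) => // x; rewrite -cImB.
exact: le_trans (normr_Im_le _) (fg x).
Unshelve. all: by end_near.
Qed.

Definition is_cderive x f d : Prop :=
  is_derive x 1 (fun t => Re (f t)) (Re d) /\ is_derive x 1 (fun t => Im (f t)) (Im d).

Lemma is_cderive_cst x z : is_cderive x (fun=> z) 0.
Proof. by split; exact: is_derive_cst. Qed.

Lemma is_cderiveD x f g df dg :
  is_cderive x f df -> is_cderive x g dg -> is_cderive x (fun t => f t + g t) (df + dg).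
Proof.
move=> [f1 f2] [g1 g2]; split.
  by under [X in is_derive _ _ X]eq_fun do rewrite cReD; rewrite cReD; exact: is_deriveD.
by under [X in is_derive _ _ X]eq_fun do rewrite cImD; rewrite cImD; exact: is_deriveD.
Qed.

Lemma is_cderiveN x f df : is_cderive x f df -> is_cderive x (fun t => - f t) (- df).
Proof.
move=> [f1 f2]; split.
  by under [X in is_derive _ _ X]eq_fun do rewrite cReN; rewrite cReN; exact: is_deriveN.
by under [X in is_derive _ _ X]eq_fun do rewrite cImN; rewrite cImN; exact: is_deriveN.
Qed.

Lemma is_cderiveB x f g df dg :
  is_cderive x f df -> is_cderive x g dg -> is_cderive x (fun t => f t - g t) (df - dg).
Proof. by move=> h /is_cderiveN; exact: is_cderiveD. Qed.

Lemma is_cderiveM x f g df dg : is_cderive x f df -> is_cderive x g dg ->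
  is_cderive x (fun t => f t * g t) (df * g x + f x * dg).
Proof.
move=> [f1 f2] [g1 g2]; split.
  under [X in is_derive _ _ X]eq_fun do rewrite cReM.
  apply: (@is_derive_eq _ _ _ _ _ _ _ _ (is_deriveB (is_deriveM f1 g1) (is_deriveM f2 g2))).
  by rewrite cReD !cReM /GRing.scale /=; ring.
under [X in is_derive _ _ X]eq_fun do rewrite cImM.
apply: (@is_derive_eq _ _ _ _ _ _ _ _ (is_deriveD (is_deriveM f1 g2) (is_deriveM f2 g1))).
by rewrite cImD !cImM /GRing.scale /=; ring.
Qed.

Lemma is_cderive_sum x (I : Type) (s : seq I) (P : pred I) (F : I -> R -> C) (dF : I -> C) :
  (forall i, is_cderive x (F i) (dF i)) ->
  is_cderive x (fun t => \sum_(i <- s | P i) F i t) (\sum_(i <- s | P i) dF i).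
Proof.
move=> cF; elim: s => [|i s IH].
  by rewrite big_nil; under [X in is_cderive _ X]eq_fun do rewrite big_nil; exact: is_cderive_cst.
rewrite big_cons; under [X in is_cderive _ X]eq_fun do rewrite big_cons.
by case: (P i) => //; exact: is_cderiveD.
Qed.

Lemma is_cderive_unique x f d1 d2 : is_cderive x f d1 -> is_cderive x f d2 -> d1 = d2.
Proof.
move=> [a1 a2] [b1 b2]; apply: complexP.
  by rewrite -(@derive_val _ _ _ _ _ _ _ a1) -(@derive_val _ _ _ _ _ _ _ b1).
by rewrite -(@derive_val _ _ _ _ _ _ _ a2) -(@derive_val _ _ _ _ _ _ _ b2).
Qed.

(** Integration against the weight [expR (l * t)] gains the factor [1 / l]. Choosing [l] large makes
    Picard iteration contract on the whole interval at once. The factor 2 comes from treating real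
    and imaginary parts separately. *)
Lemma is_cderive_exp_bound f f' b k l : 0 <= b -> 0 < l ->
  (forall t, 0 <= t <= b -> is_cderive t f (f' t)) ->
  (forall t, 0 <= t <= b -> normc (f' t) <= k * expR (l * t)) ->
  normc (f b - f 0) <= 2 * (k / l) * expR (l * b).
Proof.
move=> b0 l0 df bf.
have k0 : 0 <= k.
  have := bf 0; rewrite lexx b0 mulr0 expR0 mulr1 => /(_ isT).
  exact: le_trans (normc_ge0 _).
have kl : 0 <= k / l by rewrite divr_ge0 // ltW.
pose g (t : R) : R := k / l * expR (l * t).
have dg (t : R) : is_derive t 1 g (k * expR (l * t)).
  have := is_deriveMl (k / l) (is_derive_expMl l t) => H; apply: is_derive_eq.
  by rewrite mulrA divfK // gt_eqF.
have real_case (h h' : R -> R) : (forall t, 0 <= t <= b -> is_derive t 1 h (h' t)) ->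
    (forall t, 0 <= t <= b -> `|h' t| <= k * expR (l * t)) ->
    `|h b - h 0| <= k / l * expR (l * b).
  move=> dh bh.
  have g0 : 0 <= g 0 by rewrite mulr_ge0 ?expR_ge0.
  have h1 : h b - h 0 <= g b - g 0.
    apply: (@is_derive_le _ h h' g (fun t => k * expR (l * t))) => // t tb.
    exact: le_trans (ler_norm _) (bh t tb).
  have h2 : - h b - - h 0 <= g b - g 0.
    apply: (@is_derive_le _ (fun t => - h t) (fun t => - h' t) g (fun t => k * expR (l * t))) => // t tb.
      by have := dh t tb => ?; exact: is_deriveN.
    by apply: le_trans (ler_norm _) _; rewrite normrN; exact: bh.
  by rewrite ler_norml -/(g b); apply/andP; split; lra.
apply: le_trans (normc_le_ReIm _) _; rewrite -mulrA mulr_natl mulr2n cReB cImB.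
apply: lerD.
  apply: (@real_case (fun t => Re (f t)) (fun t => Re (f' t))) => t tb; first by case: (df t tb).
  exact: le_trans (normr_Re_le _) (bf t tb).
apply: (@real_case (fun t => Im (f t)) (fun t => Im (f' t))) => t tb; first by case: (df t tb).
exact: le_trans (normr_Im_le _) (bf t tb).
Qed.

Lemma is_cderive_eq_fun f g f' x : 0 <= x ->
  (forall t, 0 <= t <= x -> is_cderive t f (f' t)) ->
  (forall t, 0 <= t <= x -> is_cderive t g (f' t)) -> f 0 = g 0 -> f x = g x.
Proof.
move=> x0 df dg fg0.
have : normc ((f x - g x) - (f 0 - g 0)) <= 2 * (0 / 1) * expR (1 * x).
  apply: (@is_cderive_exp_bound (fun t => f t - g t) (fun t => f' t - f' t)) => // t tx.
    by apply: is_cderiveB; [exact: df|exact: dg].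
  by rewrite subrr normc0 mul0r.
rewrite fg0 subrr subr0 mul0r mulr0 mul0r => h.
by apply/eqP; rewrite -subr_eq0; apply/eqP/eq0_normc/le_anti; rewrite h normc_ge0.
Qed.

(* The base point -1 makes the primitive two-sided differentiable at 0. *)
Definition rprimitive (f : R -> R) x : R :=
  Rintegral lebesgue_measure `[-1, x] f - Rintegral lebesgue_measure `[-1, 0] f.

Lemma rprimitive0 (f : R -> R) : rprimitive f 0 = 0.
Proof. by rewrite /rprimitive subrr. Qed.

Lemma is_derive_rprimitive (f : R -> R) x :
  continuous f -> -1 < x -> is_derive x 1 (rprimitive f) (f x).
Proof.
move=> cf x1.
have x2 : x < x + 1 by rewrite ltrDl.
have intf : lebesgue_measure.-integrable `[-1, x + 1] (EFin \o f).
  apply: continuous_compact_integrable; first exact: segment_compact.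
  exact: continuous_subspaceT.
have [d1 d2] := continuous_FTC1_closed x2 intf x1 (cf x).
have H : is_derive x 1 (fun y => \int[lebesgue_measure]_(t in `[(-1)%R, y]) f t)%R (f x).
  exact: (DeriveDef d1 (etrans (esym (derive1E _ _)) d2)).
apply: (@is_derive_eq _ _ _ _ _ _ _ _ (is_deriveB H (is_derive_cst _ _ _))).
by rewrite subr0.
Qed.

Definition cprimitive f x : C :=
  Complex (rprimitive (fun t => Re (f t)) x) (rprimitive (fun t => Im (f t)) x).

Lemma cprimitive0 f : cprimitive f 0 = 0.
Proof. by rewrite /cprimitive !rprimitive0. Qed.

Lemma is_cderive_cprimitive f x : ccontinuous f -> -1 < x -> is_cderive x (cprimitive f) (f x).
Proof. by move=> [f1 f2] x1; split; exact: is_derive_rprimitive. Qed.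

Lemma is_cderive_ccontinuous_at f d x : is_cderive x f d ->
  {for x, continuous (fun t => Re (f t))} /\ {for x, continuous (fun t => Im (f t))}.
Proof. by move=> [/is_derive_continuous ? /is_derive_continuous]. Qed.

(** Retraction of the line onto [[0, b]]: composition with it turns a function controlled only on
    the interval into one that is continuous everywhere. *)
Definition clamp b x : R := Num.max 0 (Num.min x b).

Lemma clampE b x : 0 <= x <= b -> clamp b x = x.
Proof. by move=> /andP[x0 xb]; rewrite /clamp min_l // max_r. Qed.

Lemma clamp_in b x : 0 <= b -> 0 <= clamp b x <= b.
Proof. by move=> b0; rewrite /clamp le_max lexx /= ge_max b0 ge_min lexx orbT. Qed.

Lemma clampK b x : 0 <= b -> clamp b (clamp b x) = clamp b x.
Proof. by move=> b0; rewrite clampE // clamp_in. Qed.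

Lemma continuous_clamp b : continuous (clamp b).
Proof.
move=> x; apply: (@continuous_max _ _ (cst 0) (fun y => Num.min y b)); first exact: cvg_cst.
by apply: (@continuous_min _ _ id (cst b)); [exact: cvg_id|exact: cvg_cst].
Qed.

End ComplexCalculus.

(** * Picard iteration with a polynomial parameter *)

Section PolyFamily.
Variable R : realType.
Local Notation C := R[i].
Implicit Types (z w : C) (x b : R) (F G : R -> C -> C).

(** The degree bound is uniform in [x], so integration in [x] acts on finitely many continuous
    coefficients and the class is stable under the Picard operator. *)
Definition poly_family F : Prop := exists N (p : R -> {poly C}),
  [/\ forall x, (size (p x) <= N)%N, forall k, ccontinuous (fun x => (p x)`_k) &
      forall x z, F x z = (p x).[z]].

Lemma poly_family_cst (f : R -> C) : ccontinuous f -> poly_family (fun x _ => f x).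
Proof.
move=> cf; exists 1%N, (fun x => (f x)%:P); split=> [x|[|k]|x z].
- exact: size_polyC_leq1.
- by under [X in ccontinuous X]eq_fun do rewrite coefC /=.
- by under [X in ccontinuous X]eq_fun do rewrite coefC /=; exact: ccontinuous_cst.
- by rewrite hornerC.
Qed.

Lemma poly_family_id : poly_family (fun _ z => z).
Proof.
exists 2%N, (fun=> 'X); split=> [x|k|x z]; rewrite ?size_polyX ?hornerX //.
exact: ccontinuous_cst.
Qed.

Lemma poly_familyD F G : poly_family F -> poly_family G ->
  poly_family (fun x z => F x z + G x z).
Proof.
move=> [N [p [p1 p2 p3]]] [M [q [q1 q2 q3]]].
exists (maxn N M), (fun x => p x + q x); split=> [x|k|x z].
- by apply: leq_trans (size_polyD _ _) _; rewrite geq_max !leq_max p1 q1 orbT.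
- by under [X in ccontinuous X]eq_fun do rewrite coefD; exact: ccontinuousD.
- by rewrite hornerD p3 q3.
Qed.

Lemma poly_familyM F G : poly_family F -> poly_family G ->
  poly_family (fun x z => F x z * G x z).
Proof.
move=> [N [p [p1 p2 p3]]] [M [q [q1 q2 q3]]].
exists (N + M)%N, (fun x => p x * q x); split=> [x|k|x z].
- apply: leq_trans (size_polyMleq _ _) _; apply: leq_trans (leq_pred _) _.
  exact: leq_add.
- under [X in ccontinuous X]eq_fun do rewrite coefM; apply: ccontinuous_sum => i.
  exact: ccontinuousM.
- by rewrite hornerM p3 q3.
Qed.

Lemma poly_familyN F : poly_family F -> poly_family (fun x z => - F x z).
Proof.
move=> pF; have := poly_familyM (poly_family_cst (ccontinuous_cst (-1))) pF.
by under [X in poly_family X]eq_fun2 do rewrite mulN1r.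
Qed.

Lemma poly_family_sum (I : Type) (s : seq I) (P : pred I) (F : I -> R -> C -> C) :
  (forall i, poly_family (F i)) -> poly_family (fun x z => \sum_(i <- s | P i) F i x z).
Proof.
move=> pF; elim: s => [|i s IH].
  under [X in poly_family X]eq_fun2 do rewrite big_nil.
  exact/poly_family_cst/ccontinuous_cst.
under [X in poly_family X]eq_fun2 do rewrite big_cons.
by case: (P i) => //; exact: poly_familyD.
Qed.

Lemma poly_family_ccontinuous F z : poly_family F -> ccontinuous (fun x => F x z).
Proof.
move=> [N [p [p1 p2 p3]]].
under [X in ccontinuous X]eq_fun do rewrite p3 (@horner_coef_wide _ N) //.
apply: ccontinuous_sum => k; apply: ccontinuousM; [exact: p2|exact: ccontinuous_cst].
Qed.

Lemma poly_family_bounded F b r : poly_family F ->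
  exists M, forall x z, 0 <= x <= b -> normc z <= r -> normc (F x z) <= M.
Proof.
move=> [N [p [p1 p2 p3]]].
have /choice[M MP] : forall k, exists M, forall x, 0 <= x <= b -> normc (p x)`_k <= M.
  by move=> k; exact: ccontinuous_bounded.
exists (\sum_(k < N) M k * r ^+ k) => x z xb zr.
rewrite p3 (@horner_coef_wide _ N) //; apply: le_trans (le_normc_sum _ _ _) _.
apply: ler_sum => k _; rewrite normcM normcX ler_pM ?normc_ge0 ?exprn_ge0 ?normc_ge0 //.
  exact: MP.
by rewrite lerXn2r ?nnegrE ?normc_ge0 // (le_trans _ zr) ?normc_ge0.
Qed.

(** Integrating coefficient by coefficient gives the same derivative and the same value at 0. The
    clamp is there because the primitive is controlled only to the right of -1, whereas the
    coefficients must be continuous on the whole line. *)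
Lemma poly_family_cprimitive F b : 0 <= b -> poly_family F ->
  poly_family (fun x z => cprimitive (fun t => F t z) (clamp b x)).
Proof.
move=> b0 [N [p [p1 p2 p3]]].
have m1 t : 0 <= t -> -1 < t :> R by move=> t0; apply: lt_le_trans t0; rewrite ltrN10.
exists N, (fun x => \poly_(k < N) cprimitive (fun t => (p t)`_k) (clamp b x)).
split=> [x|k|x z]; first exact: size_poly.
  under [X in ccontinuous X]eq_fun do rewrite coef_poly.
  case: ltnP => kN; last exact: ccontinuous_cst.
  have cc (t : R) : 0 <= t -> _ := fun t0 =>
    is_cderive_ccontinuous_at (is_cderive_cprimitive (p2 k) (m1 t t0)).
  split=> x; have /andP[c0 _] := clamp_in x b0.
    have [+ _] := cc _ c0 => h.
    exact: (continuous_comp (@continuous_clamp _ b x) h).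
  have [_ +] := cc _ c0 => h.
  exact: (continuous_comp (@continuous_clamp _ b x) h).
have pF : poly_family F by exists N, p.
rewrite horner_poly; have /andP[c0 _] := clamp_in x b0.
apply: (@is_cderive_eq_fun _ (cprimitive (fun t => F t z))
  (fun y => \sum_(k < N) cprimitive (fun t => (p t)`_k) y * z ^+ k) (fun t => F t z)) => //.
- move=> t /andP[t0 _]; apply: is_cderive_cprimitive (m1 t t0).
  exact: poly_family_ccontinuous.
- move=> t /andP[t0 _]; rewrite p3 (@horner_coef_wide _ N) //.
  apply: is_cderive_sum => k.
  have := is_cderiveM (is_cderive_cprimitive (p2 k) (m1 t t0)) (is_cderive_cst t (z ^+ k)).
  by rewrite mulr0 addr0.
- rewrite cprimitive0 big1 // => k _; by rewrite cprimitive0 mul0r.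
Qed.

End PolyFamily.

(** * Limits of sequences with geometrically small increments *)

Section GeometricLimit.
Variable R : realType.

Lemma half_pow_small (e : R) (K : R) : 0 < e -> exists n, K * 2^-1 ^+ n <= e.
Proof.
move=> e0; pose n := (Num.truncn (`|K| / e)).+1; exists n.
have h : `|K| / e < n%:R by rewrite truncnS_gt.
have h2 : (n%:R : R) <= 2 ^+ n by rewrite -natrX ler_nat ltnW // ltn_expl.
rewrite exprVn ler_pdivrMr ?exprn_gt0 //; apply: le_trans (ler_norm _) _.
by rewrite mulrC -ler_pdivrMr // (le_trans (ltW h)).
Qed.

(** With [e n] the tail of the geometric series, the intervals of centre [u n] and radius [e n] are
    nested; the limit is the supremum of their left ends. *)
Lemma geometric_limit_real (u : nat -> R) (M : R) :
  (forall n, `|u n.+1 - u n| <= M * 2^-1 ^+ n) ->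
  exists l, forall n, `|u n - l| <= M * 2 * 2^-1 ^+ n.
Proof.
move=> uM; pose e n := M * 2 * 2^-1 ^+ n.
have eS n : e n = e n.+1 + M * 2^-1 ^+ n.
  by rewrite /e exprS; field.
have M0 : 0 <= M by have := uM 0%N; rewrite expr0 mulr1; exact: le_trans (normr_ge0 _).
have e0 n : 0 <= e n by rewrite !mulr_ge0 ?exprn_ge0 ?invr_ge0.
have mono1 n k : u n - e n <= u (n + k)%N - e (n + k)%N.
  elim: k => [|k IH]; first by rewrite addn0.
  apply: le_trans IH _; rewrite addnS; have := uM (n + k)%N; have := eS (n + k)%N.
  by rewrite ler_norml => ? /andP[]; lra.
have mono2 n k : u (n + k)%N + e (n + k)%N <= u n + e n.
  elim: k => [|k IH]; first by rewrite addn0.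
  apply: le_trans IH; rewrite addnS; have := uM (n + k)%N; have := eS (n + k)%N.
  by rewrite ler_norml => ? /andP[]; lra.
have le12 n m : u n - e n <= u m + e m.
  have h1 := mono1 n m; have := mono2 m n; rewrite addnC.
  by have := e0 (n + m)%N; lra.
pose A := [set u n - e n | n in setT].
have Asup : has_sup A.
  split; first by exists (u 0%N - e 0%N), 0%N.
  by exists (u 0%N + e 0%N) => _ [n _ <-].
exists (sup A) => n; rewrite -/(e n) ler_norml.
have : u n - e n <= sup A by apply: sup_upper_bound => //; exists n.
have : sup A <= u n + e n by apply: ge_sup; [exact: Asup.1|move=> _ [m _ <-]].
by move=> *; apply/andP; split; lra.
Qed.

(** The limit is quantified before [M]: later [M] depends on the radius of a disc of parameters,
    whereas one limit function has to serve for all discs. *)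
Lemma geometric_limit (u : nat -> R[i]) : exists l, forall M : R,
  (forall n, normc (u n.+1 - u n) <= M * 2^-1 ^+ n) ->
  forall n, normc (u n - l) <= M * 4 * 2^-1 ^+ n.
Proof.
have [[M0 uM0]|H] := pselect (exists M : R, forall n, normc (u n.+1 - u n) <= M * 2^-1 ^+ n);
  last by exists 0 => M uM; case: H; exists M.
have lim (M : R) : (forall n, normc (u n.+1 - u n) <= M * 2^-1 ^+ n) ->
    exists l, forall n, normc (u n - l) <= M * 4 * 2^-1 ^+ n.
  move=> uM.
  have [n|l1 h1] := @geometric_limit_real (fun n => complex.Re (u n)) M.
    by rewrite -cReB; exact: le_trans (normr_Re_le _) (uM n).
  have [n|l2 h2] := @geometric_limit_real (fun n => complex.Im (u n)) M.
    by rewrite -cImB; exact: le_trans (normr_Im_le _) (uM n).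
  exists (Complex l1 l2) => n; apply: le_trans (normc_le_ReIm _) _.
  by rewrite cReB cImB /=; have := h1 n; have := h2 n; lra.
have [l lP] := lim M0 uM0; exists l => M uM.
have [l' l'P] := lim M uM; suff -> : l = l' by [].
apply/eqP; rewrite -subr_eq0; apply/eqP/eq0_normc/le_anti; rewrite normc_ge0 andbT.
apply/ler_addgt0Pr => e e0; rewrite add0r.
have [n nP] := half_pow_small ((M0 + M) * 4) e0; apply: le_trans nP.
have -> : l - l' = (u n - l') - (u n - l) by ring.
apply: le_trans (le_normcD _ _) _; rewrite normcN.
by have := lP n; have := l'P n; lra.
Qed.

End GeometricLimit.

(** * Matrix-valued functions of a real variable *)

Section MatrixCalculus.
Variable R : realType.
Local Notation C := R[i].

Definition mx1norm n p (A : 'M[C]_(n, p)) : R := \sum_i \sum_j normc (A i j).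

Lemma mx1norm_ge0 n p (A : 'M[C]_(n, p)) : 0 <= mx1norm A.
Proof. by apply: sumr_ge0 => i _; apply: sumr_ge0 => j _; exact: normc_ge0. Qed.

Lemma normc_le_mx1norm n p (A : 'M[C]_(n, p)) i j : normc (A i j) <= mx1norm A.
Proof.
rewrite /mx1norm (bigD1 i) //= (bigD1 j) //= -addrA lerDl.
apply: addr_ge0; first by apply: sumr_ge0 => k _; exact: normc_ge0.
by apply: sumr_ge0 => k _; apply: sumr_ge0 => l _; exact: normc_ge0.
Qed.

Lemma mx1normN n p (A : 'M[C]_(n, p)) : mx1norm (- A) = mx1norm A.
Proof. by apply: eq_bigr => i _; apply: eq_bigr => j _; rewrite mxE normcN. Qed.

Lemma mx1normD n p (A B : 'M[C]_(n, p)) : mx1norm (A + B) <= mx1norm A + mx1norm B.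
Proof.
rewrite -big_split; apply: ler_sum => i _; rewrite -big_split; apply: ler_sum => j _ /=.
by rewrite mxE le_normcD.
Qed.

Lemma mx1normM n p q (A : 'M[C]_(n, p)) (B : 'M[C]_(p, q)) :
  mx1norm (A *m B) <= mx1norm A * mx1norm B.
Proof.
rewrite /mx1norm mulr_suml; apply: ler_sum => i _.
apply: (@le_trans _ _ (\sum_j \sum_k normc (A i k) * normc (B k j))).
  apply: ler_sum => j _; rewrite mxE; apply: le_trans (le_normc_sum _ _ _) _.
  by apply: ler_sum => k _; rewrite normcM.
rewrite exchange_big /= mulr_suml; apply: ler_sum => k _.
rewrite -mulr_sumr ler_wpM2l ?normc_ge0 //.
rewrite [leRHS](bigD1 k) //= lerDl.
by apply: sumr_ge0 => l _; apply: sumr_ge0 => j _; exact: normc_ge0.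
Qed.

Lemma mx1norm_le n p (A : 'M[C]_(n, p)) (k : R) :
  (forall i j, normc (A i j) <= k) -> mx1norm A <= (n * p)%:R * k.
Proof.
move=> Ak; rewrite mulr_natl mulnC mulrnA -[n in _ *+ n]card_ord -sumr_const.
apply: ler_sum => i _; rewrite -[p in _ *+ p]card_ord -sumr_const.
by apply: ler_sum => j _.
Qed.

Definition is_mderive n p (x : R) (F : R -> 'M[C]_(n, p)) (D : 'M[C]_(n, p)) : Prop :=
  forall i j, is_cderive x (fun t => F t i j) (D i j).

Lemma is_mderive_cst n p x (A : 'M[C]_(n, p)) : is_mderive x (fun=> A) 0.
Proof. by move=> i j; rewrite mxE; exact: is_cderive_cst. Qed.

Lemma is_mderiveD n p x (F G : R -> 'M[C]_(n, p)) dF dG :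
  is_mderive x F dF -> is_mderive x G dG -> is_mderive x (fun t => F t + G t) (dF + dG).
Proof.
move=> hF hG i j; rewrite mxE; under [X in is_cderive _ X]eq_fun do rewrite mxE.
exact: is_cderiveD.
Qed.

Lemma is_mderiveN n p x (F : R -> 'M[C]_(n, p)) dF :
  is_mderive x F dF -> is_mderive x (fun t => - F t) (- dF).
Proof.
move=> hF i j; rewrite mxE; under [X in is_cderive _ X]eq_fun do rewrite mxE.
exact: is_cderiveN.
Qed.

Lemma is_mderiveB n p x (F G : R -> 'M[C]_(n, p)) dF dG :
  is_mderive x F dF -> is_mderive x G dG -> is_mderive x (fun t => F t - G t) (dF - dG).
Proof. by move=> hF /is_mderiveN; exact: is_mderiveD. Qed.

Lemma is_mderiveM n p q x (F : R -> 'M[C]_(n, p)) (G : R -> 'M[C]_(p, q)) dF dG :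
  is_mderive x F dF -> is_mderive x G dG ->
  is_mderive x (fun t => F t *m G t) (dF *m G x + F x *m dG).
Proof.
move=> hF hG i j; under [X in is_cderive _ X]eq_fun do rewrite mxE.
rewrite !mxE -big_split; apply: is_cderive_sum => k; exact: is_cderiveM.
Qed.

Lemma is_mderive_unique n p x (F : R -> 'M[C]_(n, p)) d1 d2 :
  is_mderive x F d1 -> is_mderive x F d2 -> d1 = d2.
Proof. by move=> h1 h2; apply/matrixP => i j; exact: is_cderive_unique. Qed.

Lemma is_mderive_exp_bound n p (F F' : R -> 'M[C]_(n, p)) b k l : 0 <= b -> 0 < l ->
  (forall t, 0 <= t <= b -> is_mderive t F (F' t)) ->
  (forall t, 0 <= t <= b -> mx1norm (F' t) <= k * expR (l * t)) ->
  mx1norm (F b - F 0) <= (n * p)%:R * (2 * (k / l) * expR (l * b)).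
Proof.
move=> b0 l0 dF bF; apply: mx1norm_le => i j; rewrite !mxE.
apply: (@is_cderive_exp_bound _ (fun t => F t i j) (fun t => F' t i j)) => // t tb.
  exact: dF.
by apply: le_trans (bF t tb); exact: normc_le_mx1norm.
Qed.

End MatrixCalculus.

Lemma mx1norm_family (R : realType) (b : R) m q (F : R -> R[i] -> 'M[R[i]]_(m, q)) r :
  (forall i j, poly_family (fun x z => F x z i j)) ->
  exists M, forall x z, 0 <= x <= b -> normc z <= r -> mx1norm (F x z) <= M.
Proof.
move=> pF.
have /choice[M MP] : forall ij : 'I_m * 'I_q, exists M, forall x z,
    0 <= x <= b -> normc z <= r -> normc (F x z ij.1 ij.2) <= M.
  by move=> ij; exact: poly_family_bounded.
exists (\sum_i \sum_j M (i, j)) => x z xb zr; apply: ler_sum => i _; apply: ler_sum => j _.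
exact: (MP (i, j)).
Qed.

(** * Picard iteration for an additive vector field *)

Section Picard.
Variables (R : realType) (n p : nat) (b : R).
Local Notation C := R[i].
Variables (vf : R -> C -> 'M[C]_(n, p) -> 'M[C]_(n, p)) (W0 : C -> 'M[C]_(n, p)).
Variables (integrate : (R -> C -> 'M[C]_(n, p)) -> R -> C -> 'M[C]_(n, p)).
Variables (picard : nat -> R -> C -> 'M[C]_(n, p)).
Hypothesis b0 : 0 <= b.
Hypothesis vfB : forall x z W V, vf x z W - vf x z V = vf x z (W - V).
Hypothesis vf_bound : forall r, exists2 a, 0 <= a & forall x z (W : 'M[C]_(n, p)),
  0 <= x <= b -> normc z <= r -> mx1norm (vf x z W) <= a * mx1norm W.
Hypothesis vf_ccontinuous : forall (W : R -> C -> 'M[C]_(n, p)) z,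
  (forall i j, ccontinuous (fun t => W t z i j)) ->
  forall i j, ccontinuous (fun t => vf t z (W t z) i j).
Hypothesis pW0 : forall i j, poly_family (fun _ : R => fun z => W0 z i j).
Hypothesis integrate0 : forall W z, integrate W 0 z = W0 z.
Hypothesis integrate_zero : forall x z, 0 <= x -> integrate (fun _ _ => 0) x z = W0 z.
Hypothesis is_mderive_integrate : forall W x z, 0 <= x ->
  (forall i j, ccontinuous (fun t => vf t z (W t z) i j)) ->
  is_mderive x (fun t => integrate W t z) (vf x z (W x z)).
Hypothesis picard0 : picard 0 = fun _ _ => 0.
Hypothesis picardS : forall k x z, picard k.+1 x z = integrate (picard k) (clamp b x) z.
Hypothesis picard_family : forall k i j, poly_family (fun x z => picard k x z i j).

Let picard_clamp k x z : picard k (clamp b x) z = picard k x z.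
Proof. by case: k => [|k]; rewrite ?picard0 // !picardS clampK. Qed.

Let picard_ccontinuous k z i j : ccontinuous (fun t => vf t z (picard k t z) i j).
Proof. by apply: vf_ccontinuous => i' j'; exact: (poly_family_ccontinuous z (picard_family k i' j')). Qed.

Let picard_cvg r : exists M, forall k x z, normc z <= r ->
  mx1norm (picard k.+1 x z - picard k x z) <= M * 2^-1 ^+ k.
Proof.
have [a a0 aP] := vf_bound r; have [M0 M0P] := mx1norm_family b r pW0.
(* One integration multiplies the weighted bound by [2 * (n * p) * a / l]; this [l] makes that at
   most 1/2, and the added 1 keeps it positive. *)
pose l := 4 * (n * p)%:R * a + 1.
have l0 : 0 < l by rewrite ltr_pwDr // !mulr_ge0.
exists (`|M0| * expR (l * b)) => k x z zr.
have xb := clamp_in x b0; rewrite -(picard_clamp k.+1) -(picard_clamp k).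
set y := clamp b x in xb *; move: {x} y xb => x.
suff H : 0 <= x <= b ->
    mx1norm (picard k.+1 x z - picard k x z) <= `|M0| * 2^-1 ^+ k * expR (l * x).
  move=> xb; apply: le_trans (H xb) _; rewrite mulrAC ler_wpM2r ?exprn_ge0 ?invr_ge0 //.
  rewrite ler_wpM2l // ler_expR ler_pM2l //; by case/andP: xb.
elim: k x => [|k IH] x xb.
  rewrite picardS picard0 subr0 expr0 mulr1 integrate_zero; last by case/andP: (clamp_in x b0).
  apply: le_trans (M0P x z xb zr) _; apply: le_trans (ler_norm _) _.
  rewrite ler_peMr //; apply: le_trans (expR_ge1Dx _); rewrite lerDl.
  by apply: mulr_ge0; [exact: ltW|case/andP: xb].
have /andP[x0 xb'] := xb.
have -> : picard k.+2 x z - picard k.+1 x z =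
    (integrate (picard k.+1) x z - integrate (picard k) x z) -
    (integrate (picard k.+1) 0 z - integrate (picard k) 0 z).
  by rewrite !integrate0 subrr subr0 !picardS clampE.
have := @is_mderive_exp_bound _ _ _
  (fun t => integrate (picard k.+1) t z - integrate (picard k) t z)
  (fun t => vf t z (picard k.+1 t z) - vf t z (picard k t z)) x
  (a * (`|M0| * 2^-1 ^+ k)) l x0 l0.
move=> H; apply: (le_trans (H _ _)) => {H} [t /andP[t0 _]|t /andP[t0 tx]|].
- apply: is_mderiveB; apply: is_mderive_integrate => // i j;
    exact: picard_ccontinuous.
- have tb : 0 <= t <= b by rewrite t0 (le_trans tx).
  rewrite vfB; apply: le_trans (aP _ _ _ tb zr) _; rewrite -mulrA ler_wpM2l //; exact: IH.
- have q : 4 * (n * p)%:R * a / l <= 1 by rewrite ler_pdivrMr // mul1r lerDl.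
  have -> : (n * p)%:R * (2 * (a * (`|M0| * 2^-1 ^+ k) / l) * expR (l * x)) =
     4 * (n * p)%:R * a / l * (`|M0| * 2^-1 ^+ k.+1 * expR (l * x)).
    by rewrite exprS; field; rewrite gt_eqF.
  by rewrite ler_piMl // !mulr_ge0 ?expR_ge0 ?exprn_ge0 ?invr_ge0.
Qed.

Let picard_limit : exists W : R -> C -> 'M[C]_(n, p),
  (forall x z, W (clamp b x) z = W x z) /\
  forall r, exists2 M, 0 <= M & forall k x z, normc z <= r ->
    mx1norm (picard k x z - W x z) <= M * 2^-1 ^+ k.
Proof.
have /choice[l lP] : forall q : (R * C) * ('I_n * 'I_p), exists l, forall M : R,
    (forall k, normc (picard k.+1 q.1.1 q.1.2 q.2.1 q.2.2 - picard k q.1.1 q.1.2 q.2.1 q.2.2)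
       <= M * 2^-1 ^+ k) ->
    forall k, normc (picard k q.1.1 q.1.2 q.2.1 q.2.2 - l) <= M * 4 * 2^-1 ^+ k.
  by move=> q; exact: (geometric_limit (fun k => picard k q.1.1 q.1.2 q.2.1 q.2.2)).
exists (fun x z => \matrix_(i, j) l ((clamp b x, z), (i, j))); split=> [x z|r].
  by rewrite clampK.
have [M MP] := picard_cvg r.
exists (`|(n * p)%:R * (M * 4)|) => [|k x z zr]; first exact: normr_ge0.
apply: (@le_trans _ _ ((n * p)%:R * (M * 4) * 2^-1 ^+ k)); last first.
  by rewrite ler_wpM2r ?exprn_ge0 ?invr_ge0 // ler_norm.
rewrite -mulrA; apply: mx1norm_le => i j; rewrite -picard_clamp 3!mxE.
apply: (lP (clamp b x, z, (i, j))) => k' /=; apply: le_trans (MP k' (clamp b x) z zr).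
by have := normc_le_mx1norm (picard k'.+1 (clamp b x) z - picard k' (clamp b x) z) i j; rewrite !mxE.
Qed.

(** The iterates converge uniformly in [x] and in [z] on discs. The first kind of uniformity gives
    continuity of the limit and the integral equation; the second makes polynomial iterates
    approximate the solution locally uniformly in [z]. *)
Lemma picard_fixpoint : exists W : R -> C -> 'M[C]_(n, p),
  [/\ forall z, W 0 z = W0 z,
      forall x z, 0 <= x <= b ->
        is_mderive x (fun t => W t z) (vf x z (W x z)) &
      forall x, 0 <= x <= b -> forall i j, poly_approx (fun z => W x z i j)].
Proof.
have [W [Wc Wl]] := picard_limit.
have cW z i j : ccontinuous (fun x => W x z i j).
  apply: ccontinuous_uniform_limit => e e0.
  have [M M0 MP] := Wl (normc z); have [k kP] := half_pow_small M e0.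
  exists (fun x => picard k x z i j); first exact: (poly_family_ccontinuous z (picard_family k i j)).
  move=> x; apply: le_trans kP; apply: le_trans (MP k x z (lexx _)).
  by rewrite -normcN opprB; have := normc_le_mx1norm (picard k x z - W x z) i j; rewrite !mxE.
have cvfW z i j : ccontinuous (fun t => vf t z (W t z) i j).
  exact: vf_ccontinuous.
have eW x z : 0 <= x <= b -> integrate W x z = W x z.
  move=> /[dup] xb /andP[x0 xb']; apply/eqP; rewrite -subr_eq0; apply/eqP.
  suff /le_anti/esym nW0 : 0 <= mx1norm (integrate W x z - W x z) <= 0 .
    apply/matrixP => i j; rewrite [RHS]mxE; apply/eq0_normc/le_anti.
    by rewrite normc_ge0 andbT -nW0 normc_le_mx1norm.
  rewrite mx1norm_ge0; apply/ler_addgt0Pr => e e0; rewrite add0r.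
  have [M M0 MP] := Wl (normc z); have [a a0 aP] := vf_bound (normc z).
  have [k kP] := half_pow_small ((n * p)%:R * (2 * (a * M / 1) * expR (1 * x)) + M * 2^-1) e0.
  apply: le_trans kP.
  have -> : integrate W x z - W x z =
    ((integrate W x z - integrate (picard k) x z) -
     (integrate W 0 z - integrate (picard k) 0 z)) + (picard k.+1 x z - W x z).
    by rewrite !integrate0 subrr subr0 picardS clampE // addrA subrK.
  apply: le_trans (mx1normD _ _) _; rewrite mulrDl; apply: lerD; last first.
    by have := MP k.+1 x z (lexx _); rewrite exprS mulrA.
  have := @is_mderive_exp_bound _ _ _
    (fun t => integrate W t z - integrate (picard k) t z)
    (fun t => vf t z (W t z) - vf t z (picard k t z)) x (a * M * 2^-1 ^+ k) 1 x0 ltr01.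
  rewrite !divr1 => h; apply: le_trans (h _ _) _.
  - move=> t /andP[t0 _]; apply: is_mderiveB; apply: is_mderive_integrate => // i j.
  - move=> t /andP[t0 tx]; have tb : 0 <= t <= b by rewrite t0 (le_trans tx).
    rewrite vfB; apply: le_trans (aP _ _ _ tb (lexx _)) _.
    apply: (@le_trans _ _ (a * M * 2^-1 ^+ k)).
      by rewrite -mulrA ler_wpM2l // -mx1normN opprB; exact: MP.
    rewrite ler_peMr ?mulr_ge0 ?exprn_ge0 ?invr_ge0 //.
    by apply: le_trans (expR_ge1Dx _); rewrite mul1r lerDl.
  - by rewrite le_eqVlt; apply/orP; left; apply/eqP; ring.
(* [W] is frozen outside [[0, b]] and may fail to be differentiable at the ends; [integrate W]
   coincides with it on the interval and is differentiable there on both sides. *)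
exists (integrate W); split=> [z|x z xb|x xb i j].
- exact: integrate0.
- by rewrite eW //; case/andP: xb => x0 _; exact: is_mderive_integrate.
- move=> r e e0; have [M M0 MP] := Wl r; have [k kP] := half_pow_small M e0.
  have [N [q [_ _ qP]]] := picard_family k i j.
  exists (q x) => z zr; rewrite eW // -qP; apply: le_trans kP.
  apply: le_trans (MP k x z zr).
  by rewrite -normcN opprB; have := normc_le_mx1norm (picard k x z - W x z) i j; rewrite !mxE.
Qed.

End Picard.

(** * Linear matrix equations with a polynomial parameter *)

Section LinearODE.
Variables (R : realType) (n p : nat) (b : R).
Local Notation C := R[i].
Variables (A : R -> C -> 'M[C]_n) (D : R -> C -> 'M[C]_p) (W0 : C -> 'M[C]_(n, p)).
Hypothesis b0 : 0 <= b.
Hypothesis pA : forall i j, poly_family (fun x z => A x z i j).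
Hypothesis pD : forall i j, poly_family (fun x z => D x z i j).
Hypothesis pW0 : forall i j, poly_family (fun _ : R => fun z => W0 z i j).

Let vf x z (W : 'M[C]_(n, p)) := A x z *m W - W *m D x z.

Let vfB x z W V : vf x z W - vf x z V = vf x z (W - V).
Proof. by rewrite /vf mulmxBr mulmxBl !opprB addrACA [in RHS]addrACA [X in _ + X = _]addrC. Qed.

Let vf_family (W : R -> C -> 'M[C]_(n, p)) :
  (forall i j, poly_family (fun x z => W x z i j)) ->
  forall i j, poly_family (fun x z => vf x z (W x z) i j).
Proof.
move=> pW i j; under [X in poly_family X]eq_fun2 do rewrite !mxE.
apply: poly_familyD; last apply: poly_familyN; apply: poly_family_sum => k;
  exact: poly_familyM.
Qed.

Let integrate (W : R -> C -> 'M[C]_(n, p)) x z : 'M[C]_(n, p) :=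
  \matrix_(i, j) (W0 z i j + cprimitive (fun t => vf t z (W t z) i j) x).

Let integrate0 W z : integrate W 0 z = W0 z.
Proof. by apply/matrixP => i j; rewrite mxE cprimitive0 addr0. Qed.

Let is_mderive_integrate W x z : 0 <= x ->
  (forall i j, ccontinuous (fun t => vf t z (W t z) i j)) ->
  is_mderive x (fun t => integrate W t z) (vf x z (W x z)).
Proof.
move=> x0 cW i j; under [X in is_cderive _ X]eq_fun do rewrite mxE.
rewrite -[vf _ _ _ _ _]add0r; apply: is_cderiveD; first exact: is_cderive_cst.
by apply: is_cderive_cprimitive => //; apply: lt_le_trans x0; rewrite ltrN10.
Qed.

Fixpoint picard k : R -> C -> 'M[C]_(n, p) :=
  if k is k'.+1 then fun x z => integrate (picard k') (clamp b x) z else fun _ _ => 0.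


Let picard_family k i j : poly_family (fun x z => picard k x z i j).
Proof.
elim: k i j => [|k IH] i j /=; under [X in poly_family X]eq_fun2 do rewrite mxE.
  exact/poly_family_cst/ccontinuous_cst.
by apply: poly_familyD => //; apply: poly_family_cprimitive => //; exact: vf_family.
Qed.

Let vf_bound r : exists2 a, 0 <= a & forall x z (W : 'M[C]_(n, p)),
  0 <= x <= b -> normc z <= r -> mx1norm (vf x z W) <= a * mx1norm W.
Proof.
have [M1 h1] := mx1norm_family b r pA; have [M2 h2] := mx1norm_family b r pD.
exists (`|M1| + `|M2|) => [|x z W xb zr]; first exact: addr_ge0.
apply: le_trans (mx1normD _ _) _; rewrite mx1normN mulrDl.
apply: lerD; apply: le_trans (mx1normM _ _) _; last rewrite mulrC.
  by rewrite ler_wpM2r ?mx1norm_ge0 // (le_trans (h1 x z xb zr)) // ler_norm.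
by rewrite ler_wpM2r ?mx1norm_ge0 // (le_trans (h2 x z xb zr)) // ler_norm.
Qed.

Let integrate_zero x z : 0 <= x -> integrate (fun _ _ => 0) x z = W0 z.
Proof.
move=> x0; apply/matrixP => i j; rewrite mxE.
have E t : vf t z 0 i j = 0 by rewrite /vf mulmx0 mul0mx subr0 mxE.
rewrite (_ : cprimitive _ _ = 0) ?addr0 //.
under [X in cprimitive X]eq_fun do rewrite E.
rewrite (@is_cderive_eq_fun _ _ (fun=> 0) (fun=> 0) x x0) ?cprimitive0 // => t.
  move=> /andP[t0 _]; apply: is_cderive_cprimitive; first exact: ccontinuous_cst.
  by apply: lt_le_trans t0; rewrite ltrN10.
by move=> _; exact: is_cderive_cst.
Qed.

(** The two-sided right-hand side is that of a matrix intertwining two systems; taking [D = 0] gives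
    ordinary initial value problems. *)
Lemma linear_ode_solution : exists W : R -> C -> 'M[C]_(n, p),
  [/\ forall z, W 0 z = W0 z,
      forall x z, 0 <= x <= b ->
        is_mderive x (fun t => W t z) (A x z *m W x z - W x z *m D x z) &
      forall x, 0 <= x <= b -> forall i j, poly_approx (fun z => W x z i j)].
Proof.
apply: (@picard_fixpoint _ _ _ b vf W0 integrate picard b0 vfB vf_bound _ pW0 integrate0
  integrate_zero is_mderive_integrate) => // W z cW i j.
by apply: (poly_family_ccontinuous z (@vf_family (fun t _ => W t z) _ i j)) => i' j';
  exact: poly_family_cst.
Qed.

End LinearODE.

(** * Energy estimates *)

Section FrobeniusNorm.
Variable R : realType.
Local Notation C := R[i].
Local Notation Re := (@complex.Re R).
Local Notation Im := (@complex.Im R).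

(** The squared Frobenius norm. Squares are kept throughout because they are differentiable along a
    solution even where it vanishes. *)
Definition sqnorm n p (A : 'M[C]_(n, p)) : R :=
  \sum_i \sum_j (Re (A i j) ^+ 2 + Im (A i j) ^+ 2).

(** The real part of the Hermitian inner product, that is, the polarisation of [sqnorm]. *)
Definition mxdot n p (A B : 'M[C]_(n, p)) : R :=
  \sum_i \sum_j (Re (A i j) * Re (B i j) + Im (A i j) * Im (B i j)).

Lemma sqnormE n p (A : 'M[C]_(n, p)) : sqnorm A = \sum_i \sum_j normc (A i j) ^+ 2.
Proof. by apply: eq_bigr => i _; apply: eq_bigr => j _; rewrite normc_sqrE. Qed.

Lemma sqnorm_ge0 n p (A : 'M[C]_(n, p)) : 0 <= sqnorm A.
Proof. by apply: sumr_ge0 => i _; apply: sumr_ge0 => j _; rewrite addr_ge0 ?sqr_ge0. Qed.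

Lemma normc_le_sqnorm n p (A : 'M[C]_(n, p)) i j : normc (A i j) ^+ 2 <= sqnorm A.
Proof.
rewrite sqnormE (bigD1 i) //= (bigD1 j) //= -addrA lerDl.
apply: addr_ge0; first by apply: sumr_ge0 => k _; exact: sqr_ge0.
by apply: sumr_ge0 => k _; apply: sumr_ge0 => l _; exact: sqr_ge0.
Qed.

Lemma sqnorm_eq0 n p (A : 'M[C]_(n, p)) : sqnorm A <= 0 -> A = 0.
Proof.
move=> A0; apply/matrixP => i j; rewrite mxE; apply: eq0_normc.
apply/eqP; rewrite -sqrf_eq0; apply/eqP/le_anti.
by rewrite sqr_ge0 andbT (le_trans (normc_le_sqnorm A i j)).
Qed.

Lemma sqnorm0 n p : sqnorm (0 : 'M[C]_(n, p)) = 0.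
Proof.
by rewrite sqnormE big1 // => i _; rewrite big1 // => j _; rewrite mxE normc0 expr0n.
Qed.

Lemma sqnormN n p (A : 'M[C]_(n, p)) : sqnorm (- A) = sqnorm A.
Proof. by rewrite !sqnormE; apply: eq_bigr => i _; apply: eq_bigr => j _; rewrite mxE normcN. Qed.

Lemma sqnormZ n p c (A : 'M[C]_(n, p)) : sqnorm (c *: A) = normc c ^+ 2 * sqnorm A.
Proof.
rewrite !sqnormE mulr_sumr; apply: eq_bigr => i _; rewrite mulr_sumr.
by apply: eq_bigr => j _; rewrite mxE normcM exprMn.
Qed.

Lemma sqnormD n p (A B : 'M[C]_(n, p)) : sqnorm (A + B) <= 2 * sqnorm A + 2 * sqnorm B.
Proof.
rewrite !mulr_sumr -big_split; apply: ler_sum => i _ /=.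
rewrite !mulr_sumr -big_split; apply: ler_sum => j _ /=.
rewrite mxE cReD cImD.
have := sqr_ge0 (Re (A i j) - Re (B i j)); have := sqr_ge0 (Im (A i j) - Im (B i j)); nra.
Qed.

Lemma sqnormB n p (A B : 'M[C]_(n, p)) : sqnorm (A - B) <= 2 * sqnorm A + 2 * sqnorm B.
Proof. by rewrite -(sqnormN B) sqnormD. Qed.

(** Lagrange's identity: after symmetrising the double sum, the termwise difference is half of
    [(a k * b l - a l * b k) ^+ 2]. *)
Lemma CauchySchwarz_sum (I : finType) (a b : I -> R) :
  (\sum_k a k * b k) ^+ 2 <= (\sum_k a k ^+ 2) * (\sum_k b k ^+ 2).
Proof.
have E : (\sum_k a k ^+ 2) * (\sum_k b k ^+ 2) =
    \sum_k \sum_l (a k ^+ 2 * b l ^+ 2 + a l ^+ 2 * b k ^+ 2) / 2.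
  transitivity (((\sum_k a k ^+ 2) * (\sum_k b k ^+ 2) + (\sum_k a k ^+ 2) * (\sum_k b k ^+ 2)) / 2).
    by field.
  rewrite {1}mulr_suml [X in _ + X]mulrC mulr_suml -big_split /= mulr_suml.
  apply: eq_bigr => k _; rewrite !mulr_sumr -big_split /= mulr_suml.
  by apply: eq_bigr => l _; rewrite [b k ^+ 2 * _]mulrC.
rewrite E expr2 mulr_suml; apply: ler_sum => k _; rewrite mulr_sumr; apply: ler_sum => l _.
by have := sqr_ge0 (a k * b l - a l * b k); lra.
Qed.

Lemma sqnormM n p q (A : 'M[C]_(n, p)) (B : 'M[C]_(p, q)) :
  sqnorm (A *m B) <= sqnorm A * sqnorm B.
Proof.
rewrite !sqnormE mulr_suml; apply: ler_sum => i _.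
rewrite [X in _ * X]exchange_big /= mulr_sumr; apply: ler_sum => j _.
apply: le_trans (CauchySchwarz_sum _ _).
rewrite lerXn2r ?nnegrE ?normc_ge0 ?sumr_ge0 // => [k _|]; first by rewrite mulr_ge0 ?normc_ge0.
by rewrite mxE; apply: le_trans (le_normc_sum _ _ _) _; apply: ler_sum => k _; rewrite normcM.
Qed.

Lemma is_derive_sqnorm n p x (F : R -> 'M[C]_(n, p)) dF :
  is_mderive x F dF -> is_derive x 1 (fun t => sqnorm (F t)) (2 * mxdot (F x) dF).
Proof.
move=> hF.
have sumP (I : finType) (g : I -> R -> R) dg : (forall i, is_derive x 1 (g i) (dg i)) ->
    is_derive x 1 (fun t => \sum_i g i t) (\sum_i dg i).
  move=> H; elim: (index_enum I) => [|i s IH].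
    by rewrite big_nil; under [X in is_derive _ _ X]eq_fun do rewrite big_nil; exact: is_derive_cst.
  rewrite big_cons; under [X in is_derive _ _ X]eq_fun do rewrite big_cons.
  by apply: is_deriveD.
rewrite /mxdot mulr_sumr; apply: (@sumP) => i; rewrite mulr_sumr; apply: (@sumP) => j.
have [h1 h2] := hF i j.
apply: (@is_derive_eq _ _ _ _ _ _ _ _ (is_deriveD (is_deriveX 2 h1) (is_deriveX 2 h2))).
by rewrite /GRing.scale /=; ring.
Qed.

Lemma mxdotDr n p (A B D : 'M[C]_(n, p)) : mxdot A (B + D) = mxdot A B + mxdot A D.
Proof.
rewrite -big_split; apply: eq_bigr => i _; rewrite -big_split; apply: eq_bigr => j _ /=.
by rewrite mxE cReD cImD; ring.
Qed.

Lemma mxdotZ n p c (A : 'M[C]_(n, p)) : mxdot A (c *: A) = Re c * sqnorm A.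
Proof.
rewrite mulr_sumr; apply: eq_bigr => i _; rewrite mulr_sumr; apply: eq_bigr => j _.
by rewrite mxE cReM cImM; ring.
Qed.

Lemma mxdot_le n p (A B : 'M[C]_(n, p)) : `|2 * mxdot A B| <= sqnorm A + sqnorm B.
Proof.
suff H (D : 'M[C]_(n, p)) : 2 * mxdot A D <= sqnorm A + sqnorm D.
  rewrite ler_norml H andbT; have := H (- B); rewrite sqnormN.
  have -> : mxdot A (- B) = - mxdot A B; last by lra.
  rewrite -sumrN; apply: eq_bigr => i _; rewrite -sumrN; apply: eq_bigr => j _.
  by rewrite mxE cReN cImN; ring.
rewrite mulr_sumr -big_split; apply: ler_sum => i _.
rewrite mulr_sumr -big_split; apply: ler_sum => j _ /=.
have := sqr_ge0 (Re (A i j) - Re (D i j)); have := sqr_ge0 (Im (A i j) - Im (D i j)); nra.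
Qed.

Lemma sqnorm_bounded n p (F : R -> 'M[C]_(n, p)) b :
  (forall i j, ccontinuous (fun x => F x i j)) ->
  exists2 M, 0 <= M & forall x, 0 <= x <= b -> sqnorm (F x) <= M.
Proof.
move=> cF.
have /choice[M MP] : forall ij : 'I_n * 'I_p, exists M, forall x,
    0 <= x <= b -> normc (F x ij.1 ij.2) <= M.
  by move=> ij; exact: ccontinuous_bounded.
exists (\sum_i \sum_j M (i, j) ^+ 2) => [|x xb].
  by apply: sumr_ge0 => i _; apply: sumr_ge0 => j _; exact: sqr_ge0.
rewrite sqnormE; apply: ler_sum => i _; apply: ler_sum => j _.
have := MP (i, j) x xb => /= h; rewrite lerXn2r ?nnegrE ?normc_ge0 //.
exact: le_trans (normc_ge0 _) h.
Qed.

End FrobeniusNorm.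

(** * Energies of the two exponential modes *)

Section QuasiSystem.
Variables (R : realType) (m : nat).
Local Notation C := R[i].
Local Notation Re := (@complex.Re R).
Local Notation Im := (@complex.Im R).
Implicit Types (q r : R -> 'M[C]_m) (z : C).

(* [u = Y] and [v = Y' + r Y], where [q = Q1] and [r] is a primitive of [Q0]. *)
Definition qsolution p q r z (u v : R -> 'M[C]_(m, p)) : Prop :=
  forall x, 0 <= x <= pi ->
  is_mderive x u (v x - r x *m u x) /\
  is_mderive x v (r x *m v x -
    (z ^+ 2 *: u x + (2%:R * 'i%C * z) *: (q x *m u x) + r x *m (r x *m u x))).

(* For large [z] the modes [v + i z u] and [v - i z u] behave like [e^(i z x)] and [e^(- i z x)]. *)
Definition energy1 p z (u v : 'M[C]_(m, p)) := sqnorm (v + ('i%C * z) *: u).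
Definition energy2 p z (u v : 'M[C]_(m, p)) := sqnorm (v - ('i%C * z) *: u).

Lemma normc_i z : normc ('i%C * z) = normc z.
Proof. by rewrite normcM /normc expr0n expr1n add0r sqrtr1 mul1r. Qed.

Lemma is_mderiveZ n p x c (F : R -> 'M[C]_(n, p)) dF :
  is_mderive x F dF -> is_mderive x (fun t => c *: F t) (c *: dF).
Proof.
move=> hF i j; rewrite mxE; under [X in is_cderive _ X]eq_fun do rewrite mxE.
by have := is_cderiveM (is_cderive_cst x c) (hF i j); rewrite mul0r add0r.
Qed.

Lemma energy_u_le p z (u v : 'M[C]_(m, p)) :
  normc z ^+ 2 * sqnorm u * 2 <= energy1 z u v + energy2 z u v.
Proof.
have : sqnorm ((v + ('i%C * z) *: u) - (v - ('i%C * z) *: u)) =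
    4 * (normc z ^+ 2 * sqnorm u).
  rewrite opprB addrC addrA addrNK -scalerDl sqnormZ -mulr2n normcMn normc_i.
  by ring.
by have := sqnormB (v + ('i%C * z) *: u) (v - ('i%C * z) *: u); rewrite /energy1 /energy2; lra.
Qed.

Lemma energy_sum p z (u v : 'M[C]_(m, p)) :
  energy1 z u v + energy2 z u v = 2 * sqnorm v + 2 * (normc z ^+ 2 * sqnorm u).
Proof.
rewrite -normc_i -sqnormZ /energy1 /energy2; set w := _ *: u.
rewrite !mulr_sumr -!big_split; apply: eq_bigr => i _ /=.
rewrite !mulr_sumr -!big_split; apply: eq_bigr => j _ /=.
by rewrite !mxE cReD cImD cReB cImB; ring.
Qed.

(** The modes satisfy [w1' = i z w1 + (r w2 - k)] and [w2' = - i z w2 + (r w1 - k)], and the real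
    part of [i z] is [- Im z]. The remainder [k] is bounded by the energies uniformly in [z]: the
    large term [2 i z q u] equals [q (w1 - w2)], and [u] itself is controlled as soon as
    [|z| >= 1]. *)
Lemma energy_dichotomy q r :
  (forall i j, ccontinuous (fun x => q x i j)) ->
  (forall i j, ccontinuous (fun x => r x i j)) ->
  exists2 c, 0 <= c & forall z, 1 <= normc z -> forall p (u v : R -> 'M[C]_(m, p)),
  qsolution q r z u v ->
  exists E1' E2', dichotomy pi c (Im z)
    (fun x => energy1 z (u x) (v x)) (fun x => energy2 z (u x) (v x)) E1' E2'.
Proof.
move=> cq cr; have [Mq Mq0 qM] := sqnorm_bounded pi cq; have [Mr Mr0 rM] := sqnorm_bounded pi cr.
(* [Mq] and [Mr] bound squared norms. The first term pays for the coupling [r w], the other two for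
   [k]; the 1 added below comes from [mxdot_le]. *)
pose c := 2 * Mr + 8 * Mq + 2 * Mr * Mr.
have c0 : 0 <= c by rewrite /c !addr_ge0 ?mulr_ge0.
exists (1 + c) => [|z z1 p u v uv]; first exact: addr_ge0.
pose z1' x := v x + ('i%C * z) *: u x; pose z2' x := v x - ('i%C * z) *: u x.
pose k x := q x *m (z1' x - z2' x) + r x *m (r x *m u x).
have zz x : z1' x - z2' x = (2%:R * 'i%C * z) *: u x.
  by rewrite /z1' /z2' opprB addrC addrA addrNK -scalerDl -mulrA -mulr2n mulr_natl.
have zsq : z ^+ 2 = - ('i%C * z) ^+ 2 by rewrite exprMn sqr_i mulN1r opprK.
have d1 x : 0 <= x <= pi -> is_mderive x z1' (('i%C * z) *: z1' x + (r x *m z2' x - k x)).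
  move=> /uv[du dv]; have := is_mderiveD dv (is_mderiveZ ('i%C * z) du).
  congr is_mderive; rewrite /k zz /z1' /z2' -scalemxAr zsq.
  rewrite -!mulrA; move: ('i%C * z) => w; rewrite mulmxBr -scalemxAr.
  move: (r x *m v x) (r x *m (r x *m u x)) (r x *m u x) (q x *m u x) => rv rru ru qu.
  by apply/matrixP => i j; rewrite !mxE; ring.
have d2 x : 0 <= x <= pi -> is_mderive x z2' ((- ('i%C * z)) *: z2' x + (r x *m z1' x - k x)).
  move=> /uv[du dv]; have := is_mderiveB dv (is_mderiveZ ('i%C * z) du).
  congr is_mderive; rewrite /k zz /z1' /z2' -scalemxAr zsq.
  rewrite -!mulrA; move: ('i%C * z) => w; rewrite mulmxDr -scalemxAr.
  move: (r x *m v x) (r x *m (r x *m u x)) (r x *m u x) (q x *m u x) => rv rru ru qu.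
  by apply/matrixP => i j; rewrite !mxE; ring.
have kb x : 0 <= x <= pi -> 2 * sqnorm (k x) <= (8 * Mq + 2 * Mr * Mr) * (sqnorm (z1' x) + sqnorm (z2' x)).
  move=> xb.
  have h1 := sqnormD (q x *m (z1' x - z2' x)) (r x *m (r x *m u x)).
  have h2 := sqnormM (q x) (z1' x - z2' x); have h3 := sqnormB (z1' x) (z2' x).
  have h4 := sqnormM (r x) (r x *m u x); have h5 := sqnormM (r x) (u x).
  have h6 := energy_u_le z (u x) (v x); rewrite -/(energy1 _ _ _) -/(energy2 _ _ _) in h6.
  have s0 := sqnorm_ge0 (z1' x - z2' x); have s1 := sqnorm_ge0 (r x *m u x).
  have s2 := sqnorm_ge0 (u x).
  have := qM x xb; have := rM x xb => hr hq.
  have z1n : 1 <= normc z ^+ 2 by rewrite expr_ge1 ?normc_ge0.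
  have g1 : sqnorm (u x) * 2 <= sqnorm (z1' x) + sqnorm (z2' x).
    by apply: le_trans h6; rewrite ler_wpM2r // ler_peMl.
  have g2 : sqnorm (q x *m (z1' x - z2' x)) <= Mq * (2 * sqnorm (z1' x) + 2 * sqnorm (z2' x)).
    by apply: le_trans h2 _; apply: ler_pM => //; exact: sqnorm_ge0.
  have g3 : sqnorm (r x *m (r x *m u x)) <= Mr * (Mr * sqnorm (u x)).
    apply: le_trans h4 _; apply: ler_pM => //; first exact: sqnorm_ge0.
    by apply: le_trans h5 _; rewrite ler_wpM2r.
  have g4 : Mr * (Mr * (sqnorm (u x) * 2)) <= Mr * (Mr * (sqnorm (z1' x) + sqnorm (z2' x))).
    by rewrite !ler_wpM2l.
  by rewrite /k; lra.
have err w w' x : 0 <= x <= pi -> sqnorm w + sqnorm w' = sqnorm (z1' x) + sqnorm (z2' x) ->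
    `|2 * mxdot w (r x *m w' - k x)| <= (1 + c) * (sqnorm (z1' x) + sqnorm (z2' x)).
  move=> xb sE; apply: le_trans (mxdot_le _ _) _; rewrite mulrDl mul1r.
  apply: lerD; first by rewrite -sE lerDl sqnorm_ge0.
  apply: le_trans (sqnormB _ _) _; have := kb x xb.
  have : sqnorm (r x *m w') <= Mr * (sqnorm (z1' x) + sqnorm (z2' x)).
    apply: le_trans (sqnormM _ _) _; apply: ler_pM; rewrite ?sqnorm_ge0 ?rM // -sE.
    by rewrite lerDr sqnorm_ge0.
  by rewrite /c; lra.
have Ri : Re ('i%C * z) = - Im z by rewrite cReM /=; ring.
exists (fun x => 2 * mxdot (z1' x) (('i%C * z) *: z1' x + (r x *m z2' x - k x))),
       (fun x => 2 * mxdot (z2' x) ((- ('i%C * z)) *: z2' x + (r x *m z1' x - k x))).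
move=> x xb; split; first exact: is_derive_sqnorm (d1 x xb).
- exact: is_derive_sqnorm (d2 x xb).
- by rewrite !sqnorm_ge0.
- rewrite mxdotDr mxdotZ Ri.
  have -> : 2 * (- Im z * sqnorm (z1' x) + mxdot (z1' x) (r x *m z2' x - k x)) +
    2 * Im z * energy1 z (u x) (v x) = 2 * mxdot (z1' x) (r x *m z2' x - k x).
    by rewrite /energy1 -/(z1' x); ring.
  exact: err.
- rewrite mxdotDr mxdotZ cReN Ri opprK.
  have -> : 2 * (Im z * sqnorm (z2' x) + mxdot (z2' x) (r x *m z1' x - k x)) -
    2 * Im z * energy2 z (u x) (v x) = 2 * mxdot (z2' x) (r x *m z1' x - k x).
    by rewrite /energy2 -/(z2' x); ring.
  by apply: err => //; rewrite addrC.
Qed.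
End QuasiSystem.

(** * Boundary forms and the modes they control *)

Section BoundaryConditions.
Variables (R : realType) (m : nat).
Local Notation C := R[i].
Implicit Types (h : 'M[C]_m) (z : C).

Lemma invertible_sqnorm_bound h1 : \det h1 != 0 ->
  exists2 N, 0 < N & forall p (x : 'M[C]_(m, p)), sqnorm x <= N * sqnorm (h1 *m x).
Proof.
move=> d; exists (sqnorm (invmx h1) + 1) => [|p x]; first by rewrite ltr_wpDl ?sqnorm_ge0.
have hu : h1 \in unitmx by rewrite unitmxE unitfE.
rewrite -{1}(mulKmx hu x); apply: le_trans (sqnormM _ _) _.
by rewrite ler_wpM2r ?sqnorm_ge0 // lerDl.
Qed.

(** The boundary datum in the variables [u], [v]. As [Y' = v - r u], the form [V] at [pi] is
    represented with [H0 - r pi] in place of [H0]; at 0 nothing changes because [r] vanishes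
    there. *)
Definition bform p h1 h0 z (u v : 'M[C]_(m, p)) := v + (('i%C * z) *: h1 + h0) *m u.

Lemma bformB p h1 h0 z (u v u' v' : 'M[C]_(m, p)) :
  bform h1 h0 z (u - u') (v - v') = bform h1 h0 z u v - bform h1 h0 z u' v'.
Proof. by rewrite /bform mulmxBr addrACA opprD. Qed.

Lemma bformM p p' h1 h0 z (u v : 'M[C]_(m, p)) (c : 'M[C]_(p, p')) :
  bform h1 h0 z (u *m c) (v *m c) = bform h1 h0 z u v *m c.
Proof. by rewrite /bform mulmxA -mulmxDl. Qed.

Lemma energy1N p z (u v : 'M[C]_(m, p)) : energy1 (- z) u v = energy2 z u v.
Proof. by rewrite /energy1 /energy2 mulrN scaleNr. Qed.

Lemma energy2N p z (u v : 'M[C]_(m, p)) : energy2 (- z) u v = energy1 z u v.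
Proof. by rewrite /energy1 /energy2 mulrN scaleNr opprK. Qed.

(** Changing the signs of [z], [q], [h1] and [H1] together preserves the problem and exchanges the
    modes. Every estimate for the upper half-plane is carried to the lower one in this way. *)
Lemma bformN p h1 h0 z (u v : 'M[C]_(m, p)) : bform (- h1) h0 (- z) u v = bform h1 h0 z u v.
Proof. by rewrite /bform mulrN scaleNr scalerN opprK. Qed.

(** Eliminating [v] gives [v - i z u = - ((1 + h1) (i z u) + h0 u)]: invertibility of [1 + h1] makes
    this mode comparable with [|z| |u|], and the threshold on [|z|] absorbs the [h0] term. *)
Lemma bform0_energy2 h1 h0 : \det (1%:M + h1) != 0 ->
  exists T K, 0 < K /\ forall z, T <= normc z -> forall p (u v : 'M[C]_(m, p)),
  bform h1 h0 z u v = 0 ->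
  [/\ energy1 z u v <= K * (normc z ^+ 2 * sqnorm u),
      energy2 z u v <= K * (normc z ^+ 2 * sqnorm u) &
      normc z ^+ 2 * sqnorm u <= K * energy2 z u v].
Proof.
move=> /invertible_sqnorm_bound[N N0 NP].
set a := sqnorm h0; have a0 : 0 <= a := sqnorm_ge0 _.
set b := sqnorm (1%:M - h1); have b0 : 0 <= b := sqnorm_ge0 _.
set c := sqnorm (1%:M + h1); have c0 : 0 <= c := sqnorm_ge0 _.
have Na : 0 <= N * a by rewrite mulr_ge0 // ltW.
exists (1 + 4 * N * a), (2 * a + 2 * b + 2 * c + 4 * N + 1); split; first lra.
move=> z zT p u v uv.
have z1 : 1 <= normc z by apply: le_trans zT; lra.
have zz : 1 + 4 * N * a <= normc z ^+ 2 by apply: le_trans zT _; rewrite expr2 ler_peMl // normc_ge0.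
have z2 : 1 <= normc z ^+ 2 by apply: le_trans zz; lra.
set s := normc z ^+ 2 * sqnorm u.
have u0 := sqnorm_ge0 u.
have us : sqnorm u <= s by rewrite ler_peMl.
have s0 : 0 <= s by apply: le_trans us.
have hu : sqnorm (h0 *m u) <= a * sqnorm u by exact: sqnormM.
have au : a * sqnorm u <= a * s by rewrite ler_wpM2l.
have wE : sqnorm (('i%C * z) *: u) = s by rewrite sqnormZ normc_i.
have vE : v = - ((('i%C * z) *: h1 + h0) *m u) by apply/eqP; rewrite -addr_eq0; exact/eqP.
have e1 : v + ('i%C * z) *: u = (1%:M - h1) *m (('i%C * z) *: u) - h0 *m u.
  rewrite vE !mulmxDl mulNmx mul1mx -!scalemxAl -!scalemxAr; apply/matrixP => i j.
  by rewrite !mxE; ring.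
have e2 : v - ('i%C * z) *: u = - ((1%:M + h1) *m (('i%C * z) *: u) + h0 *m u).
  rewrite vE !mulmxDl mul1mx -!scalemxAl -!scalemxAr; apply/matrixP => i j.
  by rewrite !mxE; ring.
have bs : 0 <= b * s by rewrite mulr_ge0.
have cs : 0 <= c * s by rewrite mulr_ge0.
have as' : 0 <= a * s by rewrite mulr_ge0.
have Ns : 0 <= N * s by rewrite mulr_ge0 // ltW.
have E2 : 0 <= energy2 z u v := sqnorm_ge0 _.
split.
- rewrite /energy1 e1; apply: le_trans (sqnormB _ _) _.
  by have := sqnormM (1%:M - h1) (('i%C * z) *: u); rewrite wE -/b; lra.
- rewrite /energy2 e2 sqnormN; apply: le_trans (sqnormD _ _) _.
  by have := sqnormM (1%:M + h1) (('i%C * z) *: u); rewrite wE -/c; lra.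
- have h1w : sqnorm ((1%:M + h1) *m (('i%C * z) *: u)) <= 2 * energy2 z u v + 2 * sqnorm (h0 *m u).
    have -> : (1%:M + h1) *m (('i%C * z) *: u) = - (v - ('i%C * z) *: u) - h0 *m u.
      by rewrite e2 opprK addrK.
    by apply: le_trans (sqnormB _ _) _; rewrite sqnormN.
  have := NP _ (('i%C * z) *: u); rewrite wE => sN.
  have k1 : s <= N * (2 * energy2 z u v + 2 * sqnorm (h0 *m u)).
    by apply: le_trans sN _; rewrite ler_pM2l.
  have k2 : N * sqnorm (h0 *m u) <= N * (a * sqnorm u) by rewrite ler_pM2l.
  have k3 : (4 * N * a) * sqnorm u <= s.
    by rewrite /s ler_wpM2r //; lra.
  have ae : 0 <= a * energy2 z u v by rewrite mulr_ge0.
  have be : 0 <= b * energy2 z u v by rewrite mulr_ge0.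
  have ce : 0 <= c * energy2 z u v by rewrite mulr_ge0.
  by lra.
Qed.

Lemma bform0_energy1 h1 h0 : \det (1%:M - h1) != 0 ->
  exists T K, 0 < K /\ forall z, T <= normc z -> forall p (u v : 'M[C]_(m, p)),
  bform h1 h0 z u v = 0 ->
  [/\ energy1 z u v <= K * (normc z ^+ 2 * sqnorm u),
      energy2 z u v <= K * (normc z ^+ 2 * sqnorm u) &
      normc z ^+ 2 * sqnorm u <= K * energy1 z u v].
Proof.
move=> d; have [T [K [K0 H]]] := @bform0_energy2 (- h1) h0 d.
exists T, K; split=> // z zT p u v uv; have := H (- z).
by rewrite normcN => /(_ zT p u v); rewrite bformN energy1N energy2N => /(_ uv)[].
Qed.

(** With [w] the boundary datum, [(1 + h1) (v + i z u) = 2 w - (1 - h1) (v - i z u) - 2 h0 u]. When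
    the second mode is a small fraction of the first and [|z|] is large, [w] therefore measures the
    first mode. *)
Lemma bform_energy1 h1 h0 : \det (1%:M + h1) != 0 ->
  exists T K e, [/\ 0 < K, 0 < e & forall z, T <= normc z -> forall p (u v : 'M[C]_(m, p)),
  energy2 z u v <= e * energy1 z u v ->
  energy1 z u v <= K * sqnorm (bform h1 h0 z u v) /\
  sqnorm (bform h1 h0 z u v) <= K * energy1 z u v].
Proof.
move=> /invertible_sqnorm_bound[N N0 NP].
set a := sqnorm h0; have a0 : 0 <= a := sqnorm_ge0 _.
set b := sqnorm (1%:M - h1); have b0 : 0 <= b := sqnorm_ge0 _.
set c := sqnorm h1; have c0 : 0 <= c := sqnorm_ge0 _.
have Na : 0 <= N * a by rewrite mulr_ge0 // ltW.
have Nb : 0 <= N * b by rewrite mulr_ge0 // ltW.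
have eN : 0 < 1 + 16 * N * b by lra.
(* This makes the contribution [4 * N * b * energy2] at most a quarter of [energy1]. *)
pose e := (1 + 16 * N * b)^-1.
have e0 : 0 < e by rewrite invr_gt0.
have e1 : e <= 1 by rewrite invf_le1 //; lra.
have eb : 16 * N * b * e <= 1 by rewrite /e ler_pdivrMr // mul1r; lra.
exists (1 + 64 * N * a), (32 * N + 2 + 4 * c + 4 * a), e; split=> //; first lra.
move=> z zT p u v E21; set w := bform h1 h0 z u v.
have z1 : 1 <= normc z by apply: le_trans zT; lra.
have zz : 1 + 64 * N * a <= normc z ^+ 2 by apply: le_trans zT _; rewrite expr2 ler_peMl // normc_ge0.
have z2 : 1 <= normc z ^+ 2 by apply: le_trans zz; lra.
set s := normc z ^+ 2 * sqnorm u.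
have u0 := sqnorm_ge0 u.
have us : sqnorm u <= s by rewrite ler_peMl.
have s0 : 0 <= s by apply: le_trans us.
have hu : sqnorm (h0 *m u) <= a * sqnorm u by exact: sqnormM.
have au : a * sqnorm u <= a * s by rewrite ler_wpM2l.
have wE : sqnorm (('i%C * z) *: u) = s by rewrite sqnormZ normc_i.
have su := energy_u_le z u v; rewrite -/s in su.
have E1 : 0 <= energy1 z u v := sqnorm_ge0 _.
have E2 : 0 <= energy2 z u v := sqnorm_ge0 _.
have E2le : energy2 z u v <= energy1 z u v by apply: le_trans E21 _; rewrite ler_piMl.
have sE1 : s <= energy1 z u v by lra.
have b_0 := sqnorm_ge0 w.
split.
  have eq : (1%:M + h1) *m (v + ('i%C * z) *: u) =
      (w + w) - (1%:M - h1) *m (v - ('i%C * z) *: u) - (h0 *m u + h0 *m u).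
    rewrite /w /bform !mulmxDl !mul1mx !mulmxDr !mulmxN !mulNmx -!scalemxAl -!scalemxAr.
    move: (h1 *m u) (h0 *m u) (h1 *m v) => x1 x2 x3.
    by apply/matrixP => i j; rewrite !mxE; ring.
  have k0 : sqnorm ((1%:M + h1) *m (v + ('i%C * z) *: u)) <=
      16 * sqnorm w + 4 * (b * energy2 z u v) + 8 * (a * sqnorm u).
    rewrite eq; apply: le_trans (sqnormB _ _) _.
    have k1 := sqnormB (w + w) ((1%:M - h1) *m (v - ('i%C * z) *: u)).
    have k2 := sqnormD w w; have k3 := sqnormM (1%:M - h1) (v - ('i%C * z) *: u).
    have k4 := sqnormD (h0 *m u) (h0 *m u).
    by rewrite -/b -/(energy2 z u v) in k3; lra.
  have k1 := NP _ (v + ('i%C * z) *: u); rewrite -/(energy1 z u v) in k1.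
  have k2 : energy1 z u v <= N * (16 * sqnorm w + 4 * (b * energy2 z u v) + 8 * (a * sqnorm u)).
    by apply: le_trans k1 _; rewrite ler_pM2l.
  have k3 : 16 * N * b * energy2 z u v <= energy1 z u v.
    apply: (@le_trans _ _ (16 * N * b * (e * energy1 z u v))).
      by rewrite ler_wpM2l //; lra.
    by rewrite mulrA ler_piMl.
  have k4 : (64 * N * a) * sqnorm u <= s by rewrite /s ler_wpM2r //; lra.
  have cw : 0 <= c * sqnorm w by rewrite mulr_ge0.
  have aw : 0 <= a * sqnorm w by rewrite mulr_ge0.
  have Nw : 0 <= N * sqnorm w by rewrite mulr_ge0 // ltW.
  by lra.
have k1 : sqnorm w <= 2 * sqnorm v + 2 * (2 * (c * s) + 2 * (a * sqnorm u)).
  apply: le_trans (sqnormD _ _) _; rewrite lerD2l ler_pM2l // mulmxDl.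
  apply: le_trans (sqnormD _ _) _; apply: lerD; rewrite ler_pM2l //.
  by rewrite -scalemxAl scalemxAr -wE; exact: sqnormM.
have := energy_sum z u v; rewrite -/s => k2.
have cE : c * s <= c * energy1 z u v by rewrite ler_wpM2l.
have aE : a * s <= a * energy1 z u v by rewrite ler_wpM2l.
have NE : 0 <= N * energy1 z u v by rewrite mulr_ge0 // ltW.
by lra.
Qed.

End BoundaryConditions.

(** * Growing and decaying solutions in the upper half-plane *)

Section HalfPlane.
Variables (R : realType) (m : nat).
Local Notation C := R[i].
Local Notation Im := (@complex.Im R).
Implicit Types (z : C).

Lemma Im_le_normc z : Im z <= normc z.
Proof. exact: le_trans (ler_norm _) (normr_Im_le z). Qed.

Lemma energy_ge0 p z (u v : 'M[C]_(m, p)) : 0 <= energy1 z u v /\ 0 <= energy2 z u v.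
Proof. by rewrite !sqnorm_ge0. Qed.

Section Bounds.
Variables (q r : R -> 'M[C]_m) (h1 h0 H1 H0 : 'M[C]_m).
Hypothesis cq : forall i j, ccontinuous (fun x => q x i j).
Hypothesis cr : forall i j, ccontinuous (fun x => r x i j).

(** The condition [U = 0] places the initial value in the cone of opening [K1 * K1], from which
    [growing_cone] applies. The two bounds at [pi] are there to exclude solutions that also satisfy
    [V = 0]. *)
Lemma growing_bounds (x e : R) : \det (1%:M + h1) != 0 -> 0 < x <= pi -> 0 < e ->
  exists T K, 0 < K /\ forall z, T <= Im z -> forall p (u v : R -> 'M[C]_(m, p)),
  qsolution q r z u v -> bform h1 h0 z (u 0) (v 0) = 0 ->
  let s := normc z ^+ 2 * sqnorm (u 0) in
  [/\ energy1 z (u x) (v x) <= e * energy2 z (u x) (v x),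
      energy2 z (u x) (v x) <= K * (expR (2 * Im z * x) * s),
      expR (2 * Im z * x) * s <= K * energy2 z (u x) (v x),
      energy1 z (u pi) (v pi) <= e * energy2 z (u pi) (v pi) &
      s <= K * energy2 z (u pi) (v pi)].
Proof.
move=> dh /andP[x0 xpi] e0.
have [T1 [K1 [K10 bc]]] := bform0_energy2 h0 dh.
have [c c0 dich] := energy_dichotomy cq cr.
have p0 : 0 <= pi :> R by exact: pi_ge0.
have k0 : 0 < K1 * K1 by rewrite mulr_gt0.
have [T2 [K2 [K20 gr]]] := growing_cone c0 k0 e0 x0 p0.
exists (Num.max 1 (Num.max T1 T2)), (K1 * K2); split; first exact: mulr_gt0.
move=> z; rewrite !ge_max => /and3P[z1 zT1 zT2] p u v uv U0 s.
have nz := Im_le_normc z.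
have [b1 b2 b3] := bc z (le_trans zT1 nz) _ _ _ U0; rewrite -/s in b1 b2 b3.
have [E1' [E2' D]] := dich z (le_trans z1 nz) p u v uv.
have kappa : energy1 z (u 0) (v 0) <= K1 * K1 * energy2 z (u 0) (v 0).
  by apply: le_trans b1 _; rewrite -mulrA ler_pM2l.
have [|g1 g2 _ g3] := gr _ _ _ _ _ zT2 D kappa x; first by rewrite ltW.
have [|f1 _ _ f3] := gr _ _ _ _ _ zT2 D kappa pi; first by rewrite lexx pi_ge0.
have s0 : 0 <= s by rewrite mulr_ge0 ?sqr_ge0 ?sqnorm_ge0.
have [_ E20] := energy_ge0 z (u 0) (v 0).
have X0 := expR_gt0 (2 * Im z * x); have Y1 : 1 <= expR (2 * Im z * pi).
  by rewrite leNgt expR_lt1 -leNgt mulr_ge0 ?pi_ge0 // mulr_ge0 // (le_trans _ z1).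
have {}g3 := g3 (lexx x); have {}f3 := f3 xpi.
move: (expR (2 * Im z * pi)) (expR (2 * Im z * x)) X0 Y1 g1 g2 g3 f1 f3 E20 b2 b3 {b1 kappa}.
clearbody s; move: (energy2 z (u 0) (v 0)) (energy1 z (u x) (v x)) (energy2 z (u x) (v x)).
move: (energy1 z (u pi) (v pi)) (energy2 z (u pi) (v pi)).
move=> P1 P2 F2 G1 G2 Y X X0 Y1 g1 g2 g3 f1 f3 E20 b2 b3; split => //.
- apply: le_trans g2 _.
  have -> : K1 * K2 * (X * s) = K2 * X * (K1 * s) by ring.
  by rewrite ler_pM2l ?mulr_gt0.
- apply: (@le_trans _ _ (X * (K1 * F2))); first by rewrite ler_pM2l.
  by rewrite mulrCA -mulrA ler_pM2l.
- apply: le_trans b3 _; rewrite -mulrA ler_pM2l //; apply: le_trans f1.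
  by rewrite ler_peMl.
Qed.

(** Seen from [pi], a solution with [V = 0] starts in a cone around the first mode, which grows
    leftwards. Dividing the growth from [pi] to [x] by that from [pi] to 0 leaves the factor
    [expR (- (2 * Im z * x))], and [bform_energy1] translates the energy at 0 into the datum [b]. *)
Lemma decaying_bounds (x e : R) :
  \det (1%:M + h1) != 0 -> \det (1%:M - H1) != 0 -> 0 <= x < pi -> 0 < e ->
  exists T K, 0 < K /\ forall z, T <= Im z -> forall p (u v : R -> 'M[C]_(m, p)),
  qsolution q r z u v -> bform H1 H0 z (u pi) (v pi) = 0 ->
  let b := sqnorm (bform h1 h0 z (u 0) (v 0)) in
  [/\ energy2 z (u x) (v x) <= e * energy1 z (u x) (v x),
      energy1 z (u x) (v x) <= K * (expR (- (2 * Im z * x)) * b) &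
      expR (- (2 * Im z * x)) * b <= K * energy1 z (u x) (v x)].
Proof.
move=> dh dH /andP[x0 xpi] e0.
have [T1 [K1 [K10 bc]]] := bform0_energy1 H0 dH.
have [T3 [K3 [e3 [K30 e30 bc3]]]] := bform_energy1 h0 dh.
have [c c0 dich] := energy_dichotomy cq cr.
have p0 : 0 <= pi :> R by exact: pi_ge0.
have k0 : 0 < K1 * K1 by rewrite mulr_gt0.
have px0 : 0 < pi - x by rewrite subr_gt0.
(* [e] is the opening wanted at [x]; [e3] is the opening required at 0 by [bform_energy1]. *)
pose e' := Num.min e e3.
have e'0 : 0 < e' by rewrite lt_min e0.
have [T2 [K2 [K20 gr]]] := growing_cone c0 k0 e'0 px0 p0.
exists (Num.max 1 (Num.max T1 (Num.max T2 T3))), (K2 * K2 * K3).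
split; first by rewrite !mulr_gt0.
move=> z; rewrite !ge_max => /and4P[z1 zT1 zT2 zT3] p u v uv V0 b.
have nz := Im_le_normc z.
have [b1 b2 b3] := bc z (le_trans zT1 nz) _ _ _ V0.
have [E1' [E2' /dichotomy_reflect D]] := dich z (le_trans z1 nz) p u v uv.
have kappa : energy2 z (u (pi - 0)) (v (pi - 0)) <= K1 * K1 * energy1 z (u (pi - 0)) (v (pi - 0)).
  by rewrite subr0; apply: le_trans b2 _; rewrite -mulrA ler_pM2l.
have [|g1 g2 _ g3] := gr _ _ _ _ _ zT2 D kappa (pi - x).
  by rewrite (ltW px0) lerBlDr lerDl.
have [|f1 f2 _ f3] := gr _ _ _ _ _ zT2 D kappa pi; first by rewrite lexx pi_ge0.
move: g1 g2 g3 f1 f2 f3; rewrite !subr0 !subKr !subrr.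
set F1 := energy1 z (u 0) (v 0); set F2 := energy2 z (u 0) (v 0).
set G1 := energy1 z (u x) (v x); set G2 := energy2 z (u x) (v x).
set P1 := energy1 z (u pi) (v pi) => g1 g2 g3 f1 f2 f3.
have [F10 _] := energy_ge0 z (u 0) (v 0); rewrite -/F1 in F10.
have [G10 _] := energy_ge0 z (u x) (v x); rewrite -/G1 in G10.
have [P10 _] := energy_ge0 z (u pi) (v pi); rewrite -/P1 in P10.
have F21 : F2 <= e3 * F1.
  apply: le_trans (f3 _) _; first by rewrite lerBlDr lerDl.
  by apply: (ler_wpM2r F10); rewrite ge_min lexx orbT.
have [w1 w2] := bc3 z (le_trans zT3 nz) _ _ _ F21; rewrite -/b -/F1 in w1 w2.
have ex : expR (2 * Im z * (pi - x)) = expR (2 * Im z * pi) * expR (- (2 * Im z * x)).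
  by rewrite -expRD mulrBr.
rewrite {}ex in g1 g2; have {}g3 := g3 (lexx _); clear f3 kappa b2 b3.
move: (expR_gt0 (2 * Im z * pi)) (expR_gt0 (- (2 * Im z * x))) f1 f2 g1 g2.
move: (expR (2 * Im z * pi)) (expR (- (2 * Im z * x))) => X Y X0 Y0 f1 f2 g1 g2.
clearbody b F1 F2 G1 G2 P1.
split.
- by apply: le_trans g3 _; rewrite ler_wpM2r // ge_min lexx.
- apply: le_trans g2 _.
  have -> : K2 * (X * Y) * P1 = K2 * Y * (X * P1) by ring.
  have -> : K2 * K2 * K3 * (Y * b) = K2 * Y * (K2 * (K3 * b)) by ring.
  rewrite ler_pM2l ?mulr_gt0 //; apply: le_trans f1 _; rewrite ler_pM2l //.
- apply: (@le_trans _ _ (Y * (K3 * F1))); first by rewrite ler_pM2l.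
  apply: (@le_trans _ _ (Y * (K3 * (K2 * X * P1)))); first by rewrite ler_pM2l // ler_pM2l.
  have -> : Y * (K3 * (K2 * X * P1)) = K3 * K2 * (X * Y * P1) by ring.
  have -> : K2 * K2 * K3 * G1 = K3 * K2 * (K2 * G1) by ring.
  by rewrite ler_pM2l // mulr_gt0.
Qed.

(** At [pi] the condition [V = 0] forces [energy2 <= K1 * K1 * energy1], while [U = 0] forces
    [energy1 <= e * energy2]. With [e] half the inverse of [K1 * K1] only zero satisfies both. *)
Lemma large_Im_regular : \det (1%:M + h1) != 0 -> \det (1%:M - H1) != 0 ->
  exists T, forall z, T <= Im z -> forall p (u v : R -> 'M[C]_(m, p)),
  qsolution q r z u v -> bform h1 h0 z (u 0) (v 0) = 0 -> bform H1 H0 z (u pi) (v pi) = 0 ->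
  u 0 = 0.
Proof.
move=> dh dH.
have [T1 [K1 [K10 bc]]] := bform0_energy1 H0 dH.
have pi01 : 0 < (pi : R) <= pi by rewrite pi_gt0 lexx.
have e0 : 0 < (2 * (K1 * K1))^-1 by rewrite invr_gt0 !mulr_gt0.
have [T2 [K2 [K20 gr]]] := growing_bounds dh pi01 e0.
exists (Num.max 1 (Num.max T1 T2)) => z; rewrite !ge_max => /and3P[z1 zT1 zT2] p u v uv U0 V0.
have nz := Im_le_normc z.
have [b1 b2 b3] := bc z (le_trans zT1 nz) _ _ _ V0.
have [_ _ _ g1 g2] := gr z zT2 p u v uv U0.
have [_ E20] := energy_ge0 z (u pi) (v pi).
have h : energy2 z (u pi) (v pi) <= K1 * K1 * energy1 z (u pi) (v pi).
  by apply: le_trans b2 _; rewrite -mulrA ler_pM2l.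
have h2 : K1 * K1 * energy1 z (u pi) (v pi) <= energy2 z (u pi) (v pi) / 2.
  rewrite -(ler_pM2l (mulr_gt0 K10 K10)) in g1; apply: le_trans g1 _.
  rewrite le_eqVlt; apply/orP; left; apply/eqP; field.
  by rewrite gt_eqF.
have E0 : energy2 z (u pi) (v pi) <= 0 by lra.
have n1 : 1 <= normc z ^+ 2 by rewrite expr_ge1 ?normc_ge0 // (le_trans z1).
apply: sqnorm_eq0; have : normc z ^+ 2 * sqnorm (u 0) <= 0.
  by apply: le_trans g2 _; rewrite pmulr_rle0.
by rewrite pmulr_rle0 // (lt_le_trans ltr01).
Qed.

End Bounds.

Lemma qsolutionB p q r z (u v u' v' : R -> 'M[C]_(m, p)) :
  qsolution q r z u v -> qsolution q r z u' v' ->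
  qsolution q r z (fun x => u x - u' x) (fun x => v x - v' x).
Proof.
move=> H H' x xb; have [d1 d2] := H x xb; have [d1' d2'] := H' x xb.
have := is_mderiveB d1 d1'; have := is_mderiveB d2 d2' => e2 e1; split.
  by congr is_mderive: e1; rewrite mulmxBr; apply/matrixP => i j; rewrite !mxE; ring.
congr is_mderive: e2; rewrite !mulmxBr !scalerBr.
move: (r x *m v x) (r x *m v' x) (q x *m u x) (q x *m u' x) (r x *m (r x *m u x)) => a1 a2 a3 a4 a5.
by move: (r x *m (r x *m u' x)) => a6; apply/matrixP => i j; rewrite !mxE; ring.
Qed.

(** Energies of two solutions [A], [B] split into growing parts [S], [W] and decaying parts [C],
    [D]; index 2 is the growing mode. Cones of opening 1/4 are transversal: the parts of [B] cannot
    cancel, which gives [W2 + D1 <= 4 * (B1 + B2)]. On the other side [A1 + A2] is at most 5/2 times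
    [S2 + C1], and 10 is the product of the two factors. *)
Lemma cone_split_arith (k l A1 A2 B1 B2 C1 C2 D1 D2 S1 S2 W1 W2 : R) :
  0 <= k -> 0 <= l -> 0 <= W2 -> 0 <= D1 -> 0 <= S2 -> 0 <= C1 -> 0 <= B1 -> 0 <= B2 ->
  A1 <= 2 * S1 + 2 * C1 -> A2 <= 2 * S2 + 2 * C2 ->
  W2 <= 2 * B2 + 2 * D2 -> D1 <= 2 * B1 + 2 * W1 ->
  S1 <= 4^-1 * S2 -> C2 <= 4^-1 * C1 -> S2 <= k * W2 -> C1 <= l * D1 ->
  W1 <= 4^-1 * W2 -> D2 <= 4^-1 * D1 ->
  A1 + A2 <= 10 * (k + l) * (B1 + B2).
Proof.
move=> k0 l0 W20 D10 S20 C10 B10 B20 t1 t2 t3 t4 a1 c1 n1 n2 b1 d1.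
have n3 : W2 + D1 <= 4 * (B1 + B2) by lra.
have n4 : k * W2 <= k * (4 * (B1 + B2)) by rewrite ler_wpM2l //; lra.
have n5 : l * D1 <= l * (4 * (B1 + B2)) by rewrite ler_wpM2l //; lra.
by lra.
Qed.

Section Comparison.
Variables (q r : R -> 'M[C]_m) (h1 h0 H1 H0 : 'M[C]_m).
Variables (q' r' : R -> 'M[C]_m) (h1' h0' H1' H0' : 'M[C]_m).
Hypothesis cq : forall i j, ccontinuous (fun x => q x i j).
Hypothesis cr : forall i j, ccontinuous (fun x => r x i j).
Hypothesis cq' : forall i j, ccontinuous (fun x => q' x i j).
Hypothesis cr' : forall i j, ccontinuous (fun x => r' x i j).
Hypotheses (dh : \det (1%:M + h1) != 0) (dH : \det (1%:M - H1) != 0).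
Hypotheses (dh' : \det (1%:M + h1') != 0) (dH' : \det (1%:M - H1') != 0).

(* (f, g) and (f', g') are the Weyl solutions carrying the boundary datum of (u, v) and (u', v'). *)
Lemma half_plane_comparison (x : R) : 0 < x < pi ->
  exists T K, forall z, T <= Im z -> forall p (u v u' v' f g f' g' : R -> 'M[C]_(m, p)),
  qsolution q r z u v -> qsolution q' r' z u' v' ->
  qsolution q r z f g -> qsolution q' r' z f' g' ->
  bform H1 H0 z (f pi) (g pi) = 0 -> bform H1' H0' z (f' pi) (g' pi) = 0 ->
  let b := bform h1 h0 z (u 0) (v 0) in
  bform h1' h0' z (u' 0) (v' 0) = b ->
  bform h1 h0 z (f 0) (g 0) = b -> bform h1' h0' z (f' 0) (g' 0) = b ->
  u 0 = u' 0 -> f 0 = f' 0 ->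
  energy1 z (u x) (v x) + energy2 z (u x) (v x) <=
  K * (energy1 z (u' x) (v' x) + energy2 z (u' x) (v' x)).
Proof.
move=> /andP[x0 xpi].
have x1 : 0 < x <= pi by rewrite x0 ltW.
have x2 : 0 <= x < pi by rewrite xpi ltW.
have e0 : 0 < 4^-1 :> R by rewrite invr_gt0.
have [T1 [K1 [K10 gr]]] := growing_bounds h0 cq cr dh x1 e0.
have [T2 [K2 [K20 gr']]] := growing_bounds h0' cq' cr' dh' x1 e0.
have [T3 [K3 [K30 de]]] := decaying_bounds h0 H0 cq cr dh dH x2 e0.
have [T4 [K4 [K40 de']]] := decaying_bounds h0' H0' cq' cr' dh' dH' x2 e0.
exists (Num.max (Num.max T1 T2) (Num.max T3 T4)), (10 * (K1 * K2 + K3 * K4)).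
move=> z; rewrite !ge_max => /andP[/andP[zT1 zT2] /andP[zT3 zT4]].
move=> p u v u' v' f g f' g' uv uv' fg fg' V V' b U' F F' u0 f0.
(* Removing the Weyl part cancels the boundary datum, so the remainders are growing solutions. *)
have gq := qsolutionB uv fg; have gq' := qsolutionB uv' fg'.
have [|a1 a2 a3 _ _] := gr z zT1 p _ _ gq; first by rewrite bformB F subrr.
have [|b1 b2 b3 _ _] := gr' z zT2 p _ _ gq'; first by rewrite bformB F' U' subrr.
have [c1 c2 c3] := de z zT3 p _ _ fg V.
have [d1 d2 d3] := de' z zT4 p _ _ fg' V'.
(* The equality of the Weyl matrices enters here, as [f 0 = f' 0]: both growing parts have the same
   value at 0, hence the same [s], just as both decaying parts have the same datum [b]. *)
rewrite /= F' in d2 d3; rewrite /= F in c2 c3; rewrite /= -u0 -f0 in b2 b3.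
set s := normc z ^+ 2 * _ in a2 a3 b2 b3; set X := expR _ in a2 a3 b2 b3.
set Y := expR _ in c2 c3 d2 d3; set t := sqnorm b in c2 c3 d2 d3.
have split1 (u1 v1 f1 g1 : R -> 'M[C]_(m, p)) :
  energy1 z (u1 x) (v1 x) <= 2 * energy1 z (u1 x - f1 x) (v1 x - g1 x) + 2 * energy1 z (f1 x) (g1 x).
  rewrite /energy1; apply: le_trans (sqnormD _ _).
  by rewrite addrACA subrK -scalerDr subrK.
have split2 (u1 v1 f1 g1 : R -> 'M[C]_(m, p)) :
  energy2 z (u1 x) (v1 x) <= 2 * energy2 z (u1 x - f1 x) (v1 x - g1 x) + 2 * energy2 z (f1 x) (g1 x).
  rewrite /energy2; apply: le_trans (sqnormD _ _).
  by rewrite addrACA subrK -opprD -scalerDr subrK.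
have split3 (u1 v1 f1 g1 : R -> 'M[C]_(m, p)) :
  energy2 z (u1 x - f1 x) (v1 x - g1 x) <= 2 * energy2 z (u1 x) (v1 x) + 2 * energy2 z (f1 x) (g1 x).
  rewrite /energy2; apply: le_trans (sqnormB _ _).
  rewrite (_ : v1 x - g1 x - ('i%C * z) *: (u1 x - f1 x) =
    (v1 x - ('i%C * z) *: u1 x) - (g1 x - ('i%C * z) *: f1 x)) //.
  by rewrite scalerBr; apply/matrixP => i j; rewrite !mxE; ring.
have split4 (u1 v1 f1 g1 : R -> 'M[C]_(m, p)) :
  energy1 z (f1 x) (g1 x) <= 2 * energy1 z (u1 x) (v1 x) + 2 * energy1 z (u1 x - f1 x) (v1 x - g1 x).
  rewrite /energy1; apply: le_trans (sqnormB _ _).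
  rewrite (_ : g1 x + ('i%C * z) *: f1 x = (v1 x + ('i%C * z) *: u1 x) -
    (v1 x - g1 x + ('i%C * z) *: (u1 x - f1 x))) //.
  by rewrite scalerBr; apply/matrixP => i j; rewrite !mxE; ring.
have t1 := split1 u v f g; have t2 := split2 u v f g.
have t3 := split3 u' v' f' g'; have t4 := split4 u' v' f' g'.
move: t1 t2 t3 t4 a1 a2 b1 b3 c1 c2 d1 d3.
have [] := energy_ge0 z (u x) (v x); have [] := energy_ge0 z (u' x) (v' x).
have [] := energy_ge0 z (f x) (g x); have [] := energy_ge0 z (f' x) (g' x).
have [] := energy_ge0 z (u x - f x) (v x - g x); have [] := energy_ge0 z (u' x - f' x) (v' x - g' x).
move: (energy1 z (u x) (v x)) (energy2 z (u x) (v x)) => A1 A2.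
move: (energy1 z (u' x) (v' x)) (energy2 z (u' x) (v' x)) => B1 B2.
move: (energy1 z (f x) (g x)) (energy2 z (f x) (g x)) => C1 C2.
move: (energy1 z (f' x) (g' x)) (energy2 z (f' x) (g' x)) => D1 D2.
move: (energy1 z (u x - f x) (v x - g x)) (energy2 z (u x - f x) (v x - g x)) => S1 S2.
move: (energy1 z (u' x - f' x) (v' x - g' x)) (energy2 z (u' x - f' x) (v' x - g' x)) => W1 W2.
move=> W10 W20 S10 S20 D10 D20 C10 C20 B10 B20 A10 A20 t1 t2 t3 t4 a1 a2 b1 b3 c1 c2 d1 d3.
have n1 : S2 <= K1 * K2 * W2 by apply: le_trans a2 _; rewrite -mulrA ler_pM2l.
have n2 : C1 <= K3 * K4 * D1 by apply: le_trans c2 _; rewrite -mulrA ler_pM2l.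
have k1 : 0 <= K1 * K2 by rewrite ltW // mulr_gt0.
have k2 : 0 <= K3 * K4 by rewrite ltW // mulr_gt0.
exact: (cone_split_arith k1 k2 W20 D10 S20 C10 B10 B20 t1 t2 t3 t4 a1 c1 n1 n2 b1 d1).
Qed.

End Comparison.
End HalfPlane.

(** * The transfer matrix *)

Section TransferMatrix.
Variables (R : realType) (m : nat).
Local Notation C := R[i].
Local Notation Im := (@complex.Im R).
Implicit Types (z : C) (q r : R -> 'M[C]_m).

Lemma unitmx_ker0 n (A : 'M[C]_n) :
  (forall c : 'cV[C]_n, A *m c = 0 -> c = 0) -> A \in unitmx.
Proof.
move=> A0; rewrite unitmxE unitfE -det_tr; apply/det0P => -[v v0 vA].
case/eqP: v0; apply: trmx_inj; rewrite trmx0; apply: A0.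
by apply: trmx_inj; rewrite trmx_mul trmxK vA trmx0.
Qed.

Definition qcoef q r (x : R) z : 'M[C]_(m + m) :=
  block_mx (- r x) 1%:M (- ((z ^+ 2)%:M + (2%:R * 'i%C * z) *: q x + r x *m r x)) (r x).

Lemma qcoef_family q r :
  (forall i j, ccontinuous (fun x => q x i j)) ->
  (forall i j, ccontinuous (fun x => r x i j)) ->
  forall i j, poly_family (fun x z => qcoef q r x z i j).
Proof.
move=> cq cr i j; have pz := poly_family_id R.
have pr i' j' : poly_family (fun x (_ : C) => r x i' j') by exact: poly_family_cst.
have pq i' j' : poly_family (fun x (_ : C) => q x i' j') by exact: poly_family_cst.
have pc c : poly_family (fun (_ : R) (_ : C) => c).
  exact/poly_family_cst/ccontinuous_cst.
case: (split_ordP i) => i' ->; case: (split_ordP j) => j' ->;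
  under [X in poly_family X]eq_fun2 do
    rewrite ?block_mxEul ?block_mxEur ?block_mxEdl ?block_mxEdr.
- under [X in poly_family X]eq_fun2 do rewrite mxE; exact: poly_familyN.
- exact: pc.
- under [X in poly_family X]eq_fun2 do rewrite !mxE; apply: poly_familyN.
  apply: poly_familyD; last by apply: poly_family_sum => k; exact: poly_familyM.
  apply: poly_familyD; last by apply: poly_familyM => //; apply: poly_familyM.
  case: (i' == j') => /=; last by under [X in poly_family X]eq_fun2 do rewrite mulr0n.
  by under [X in poly_family X]eq_fun2 do rewrite mulr1n expr2; exact: poly_familyM.
- exact: pr.
Qed.

Lemma is_mderive_col_mx n1 n2 p x (F : R -> 'M[C]_(n1, p)) (G : R -> 'M[C]_(n2, p)) dF dG :
  is_mderive x (fun t => col_mx (F t) (G t)) (col_mx dF dG) <->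
  is_mderive x F dF /\ is_mderive x G dG.
Proof.
split=> [H|[hF hG] i j].
  split=> i j; [have := H (lshift _ i) j|have := H (rshift _ i) j];
    rewrite ?col_mxEu ?col_mxEd; congr is_cderive; apply/funext => t;
    by rewrite ?col_mxEu ?col_mxEd.
case: (split_ordP i) => k ->; rewrite ?col_mxEu ?col_mxEd;
  under [X in is_cderive _ X]eq_fun do rewrite ?col_mxEu ?col_mxEd.
  exact: hF.
exact: hG.
Qed.

Lemma qsolutionP p q r z (u v : R -> 'M[C]_(m, p)) :
  qsolution q r z u v <-> forall x, 0 <= x <= pi ->
  is_mderive x (fun t => col_mx (u t) (v t)) (qcoef q r x z *m col_mx (u x) (v x)).
Proof.
have E x : qcoef q r x z *m col_mx (u x) (v x) = col_mx (v x - r x *m u x)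
    (r x *m v x - (z ^+ 2 *: u x + (2%:R * 'i%C * z) *: (q x *m u x) + r x *m (r x *m u x))).
  rewrite mul_block_col mul1mx mulNmx addrC mulNmx [X in col_mx _ X]addrC.
  by rewrite !mulmxDl mul_scalar_mx -scalemxAl mulmxA.
by split=> H x xb; have := H x xb; rewrite E => /is_mderive_col_mx.
Qed.

Lemma qsolution_mulmx p p' q r z (u v : R -> 'M[C]_(m, p)) (c : 'M[C]_(p, p')) :
  qsolution q r z u v -> qsolution q r z (fun x => u x *m c) (fun x => v x *m c).
Proof.
move=> /qsolutionP H; apply/qsolutionP => x xb.
have := is_mderiveM (H x xb) (is_mderive_cst x c).
rewrite /= mulmx0 addr0 -mulmxA (mul_col_mx (u x)).
by under [X in is_mderive _ X]eq_fun do rewrite mul_col_mx.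
Qed.

Lemma qsolution_exists p q r z (u0 v0 : 'M[C]_(m, p)) :
  (forall i j, ccontinuous (fun x => q x i j)) ->
  (forall i j, ccontinuous (fun x => r x i j)) ->
  exists u v, [/\ qsolution q r z u v, u 0 = u0 & v 0 = v0].
Proof.
move=> cq cr.
have [||||W [W0 dW _]] := @linear_ode_solution R (m + m) p pi (qcoef q r)
  (fun _ _ => 0) (fun=> col_mx u0 v0).
- exact: pi_ge0.
- exact: qcoef_family.
- move=> i j; exact/poly_family_cst/ccontinuous_cst.
- move=> i j; exact/poly_family_cst/ccontinuous_cst.
exists (fun x => usubmx (W x z)), (fun x => dsubmx (W x z)).
rewrite W0 col_mxKu col_mxKd; split=> //; apply/qsolutionP => x xb.
rewrite vsubmxK; have := dW x z xb; rewrite mulmx0 subr0; congr is_mderive.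
by apply/funext => t; rewrite vsubmxK.
Qed.

Lemma qsolutionN p q r z (u v : R -> 'M[C]_(m, p)) :
  qsolution q r z u v <-> qsolution (fun x => - q x) r (- z) u v.
Proof.
by split=> H x xb; have := H x xb; rewrite mulrN scaleNr mulNmx scalerN opprK sqrrN.
Qed.

Definition energy p z (u v : 'M[C]_(m, p)) := energy1 z u v + energy2 z u v.

Lemma energyN p z (u v : 'M[C]_(m, p)) : energy (- z) u v = energy z u v.
Proof. by rewrite /energy energy1N energy2N addrC. Qed.

Lemma energyE p z (u v : 'M[C]_(m, p)) :
  energy z u v = 2 * sqnorm v + 2 * (normc z ^+ 2 * sqnorm u).
Proof. exact: energy_sum. Qed.

Lemma energy_eq0 p z (u v : 'M[C]_(m, p)) : 1 <= normc z -> energy z u v <= 0 -> u = 0 /\ v = 0.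
Proof.
move=> z1; rewrite energyE => e0.
have n1 : 1 <= normc z ^+ 2 by rewrite expr_ge1 ?normc_ge0.
have u0 := sqnorm_ge0 u; have v0 := sqnorm_ge0 v.
have us : sqnorm u <= normc z ^+ 2 * sqnorm u by rewrite ler_peMl.
by split; apply: sqnorm_eq0; lra.
Qed.

(** The rate depends on [z] only through [Im z], so the constants are uniform on strips. The
    backward inequality also yields uniqueness: a solution vanishing at one point vanishes at 0. *)
Lemma energy_transport q r :
  (forall i j, ccontinuous (fun x => q x i j)) ->
  (forall i j, ccontinuous (fun x => r x i j)) ->
  exists c, forall z, 1 <= normc z -> forall p (u v : R -> 'M[C]_(m, p)),
  qsolution q r z u v -> forall x, 0 <= x <= pi ->
  energy z (u x) (v x) <= expR ((2 * `|Im z| + 2 * c) * x) * energy z (u 0) (v 0) /\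
  energy z (u 0) (v 0) <= expR ((2 * `|Im z| + 2 * c) * x) * energy z (u x) (v x).
Proof.
move=> cq cr; have [c c0 dich] := energy_dichotomy cq cr.
exists c => z z1 p u v uv x xb; have [E1' [E2' D]] := dich z z1 p u v uv.
by split; [exact: dichotomy_total D|exact: dichotomy_total_rev D].
Qed.

(** With [u] satisfying [U = 0] and [s] satisfying [U = 1], the Weyl solution is [s] minus [u] times
    a constant matrix; the equation for that matrix is solvable because [V u] has trivial kernel by
    [large_Im_regular]. *)
Lemma weyl_exists q r (h1 h0 H1 H0 : 'M[C]_m) :
  (forall i j, ccontinuous (fun x => q x i j)) ->
  (forall i j, ccontinuous (fun x => r x i j)) ->
  \det (1%:M + h1) != 0 -> \det (1%:M - H1) != 0 ->
  exists T, forall z, T <= Im z -> exists f g : R -> 'M[C]_m,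
  [/\ qsolution q r z f g, bform h1 h0 z (f 0) (g 0) = 1%:M & bform H1 H0 z (f pi) (g pi) = 0].
Proof.
move=> cq cr dh dH; have [T TP] := large_Im_regular h0 H0 cq cr dh dH.
exists T => z zT.
have [u [v [uv u0 v0]]] :=
  qsolution_exists z (1%:M : 'M[C]_m) (- (('i%C * z) *: h1 + h0)) cq cr.
have [s [t [st s0 t0]]] := qsolution_exists z (0 : 'M[C]_m) 1%:M cq cr.
have U0 : bform h1 h0 z (u 0) (v 0) = 0 by rewrite /bform u0 v0 mulmx1 addNr.
pose V := bform H1 H0 z (u pi) (v pi).
have Vu : V \in unitmx.
  apply: unitmx_ker0 => c Vc.
  have := TP z zT _ _ _ (qsolution_mulmx c uv); rewrite !bformM U0 mul0mx Vc u0 mul1mx.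
  exact.
exists (fun x => s x - u x *m (invmx V *m bform H1 H0 z (s pi) (t pi))),
       (fun x => t x - v x *m (invmx V *m bform H1 H0 z (s pi) (t pi))).
split.
- exact: (qsolutionB st (qsolution_mulmx _ uv)).
- by rewrite bformB bformM U0 mul0mx subr0 /bform s0 t0 mulmx0 addr0.
- by rewrite bformB bformM -/V mulKVmx // subrr.
Qed.

End TransferMatrix.

Section Auxiliary.
Variables (R : realType) (m : nat).
Local Notation C := R[i].

Lemma expR_strip_le (T w a x b : R) : 0 <= x <= b -> `|w| <= T ->
  expR ((2 * `|w| + 2 * a) * x) <= expR ((2 * T + 2 * `|a|) * b).
Proof.
move=> /andP[x0 xb] wT; have := ler_norm a => an; have w0 := normr_ge0 w.
rewrite ler_expR; apply: (@le_trans _ _ ((2 * T + 2 * `|a|) * x)).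
  by apply: ler_wpM2r => //; lra.
by apply: ler_wpM2l => //; have := normr_ge0 a; lra.
Qed.

(** The difference of [v] and [v'] is of order [|z| |u|], which the weight in the energy controls
    uniformly in [z]. *)
Lemma energy_same_bform p (h1 h0 h1' h0' : 'M[C]_m) z (u v v' : 'M[C]_(m, p)) :
  1 <= normc z -> bform h1 h0 z u v = bform h1' h0' z u v' ->
  energy z u v <= (2 + 4 * sqnorm (h1 - h1') + 4 * sqnorm (h0 - h0')) * energy z u v'.
Proof.
move=> z1 b0; set D1 := sqnorm (h1 - h1'); set D0 := sqnorm (h0 - h0').
have D10 : 0 <= D1 := sqnorm_ge0 _; have D00 : 0 <= D0 := sqnorm_ge0 _.
have vE : v = v' - (('i%C * z) *: (h1 - h1') + (h0 - h0')) *m u.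
  move: b0; rewrite /bform => /eqP; rewrite -subr_eq => /eqP <-.
  by rewrite scalerBr !mulmxDl !mulNmx; apply/matrixP => i j; rewrite !mxE; ring.
rewrite !energyE vE; set s := normc z ^+ 2 * _.
have su : sqnorm u <= s.
  by rewrite /s; apply: ler_peMl; [exact: sqnorm_ge0|rewrite expr_ge1 ?normc_ge0].
have v0 := sqnorm_ge0 v'; have uu0 := sqnorm_ge0 u.
have n1 := sqnormB v' ((('i%C * z) *: (h1 - h1') + (h0 - h0')) *m u).
have n2 : sqnorm ((('i%C * z) *: (h1 - h1') + (h0 - h0')) *m u) <=
    2 * (D1 * s) + 2 * (D0 * sqnorm u).
  rewrite mulmxDl; apply: le_trans (sqnormD _ _) _.
  apply: lerD; rewrite ler_pM2l //; last exact: sqnormM.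
  by rewrite -scalemxAl scalemxAr; apply: le_trans (sqnormM _ _) _; rewrite sqnormZ normc_i.
have n3 : D0 * sqnorm u <= D0 * s by rewrite ler_wpM2l.
have n4 : 0 <= D0 * sqnorm v' by rewrite mulr_ge0.
have n5 : 0 <= D1 * sqnorm v' by rewrite mulr_ge0.
by lra.
Qed.

Lemma continuous_zero_closure (h : R -> R) a b : 0 < b -> 0 <= a <= b ->
  {for a, continuous h} -> (forall x, 0 < x < b -> h x = 0) -> h a = 0.
Proof.
move=> b0 /andP[a0 ab] ch h0; apply/eqP/negP => /negP ha.
have ha0 : 0 < `|h a| by rewrite normr_gt0.
have /cvgrPdist_lt/(_ _ ha0)/nbhs_ballP[d /= d0 dP] := ch.
pose k := Num.min (d / 2) (b / 4).
have k0 : 0 < k by rewrite lt_min !divr_gt0.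
have kd : k < d by rewrite /k gt_min; apply/orP; left; lra.
have kb : k <= b / 4 by rewrite /k ge_min lexx orbT.
have [t tb at_] : exists2 t, 0 < t < b & `|a - t| < d.
  have [ah|ah] := ltP a (b / 2).
    by exists (a + k); [apply/andP; split; lra|rewrite opprD addrA subrr sub0r normrN gtr0_norm].
  by exists (a - k); [apply/andP; split; lra|rewrite opprB addrCA subrr addr0 gtr0_norm].
by have := dP t at_; rewrite (h0 t tb) subr0 ltxx.
Qed.

Lemma mx_zero_closure n p (F : R -> 'M[C]_(n, p)) a b : 0 < b -> 0 <= a <= b ->
  (forall i j, ccontinuous (fun t => F t i j)) ->
  (forall x, 0 < x < b -> F x = 0) -> F a = 0.
Proof.
move=> b0 ab cF F0; apply/matrixP => i j; rewrite mxE; have [c1 c2] := cF i j.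
apply: complexP.
  by apply: (continuous_zero_closure b0 ab (c1 a)) => x /F0 ->; rewrite mxE.
by apply: (continuous_zero_closure b0 ab (c2 a)) => x /F0 ->; rewrite mxE.
Qed.

Lemma ccontinuous_clamp n p (F F' : R -> 'M[C]_(n, p)) b : 0 <= b ->
  (forall x, 0 <= x <= b -> is_mderive x F (F' x)) ->
  forall i j, ccontinuous (fun t => F (clamp b t) i j).
Proof.
move=> b0 dF i j.
have H t := is_cderive_ccontinuous_at (dF (clamp b t) (clamp_in t b0) i j).
by split=> t; have [H1 H2] := H t;
  [exact: (continuous_comp (@continuous_clamp _ b t) H1)|
   exact: (continuous_comp (@continuous_clamp _ b t) H2)].
Qed.

Lemma ccontinuous_mulmx n k p (F : R -> 'M[C]_(n, k)) (G : R -> 'M[C]_(k, p)) :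
  (forall i j, ccontinuous (fun t => F t i j)) ->
  (forall i j, ccontinuous (fun t => G t i j)) ->
  forall i j, ccontinuous (fun t => (F t *m G t) i j).
Proof.
move=> cF cG i j; under [X in ccontinuous X]eq_fun do rewrite mxE.
by apply: ccontinuous_sum => l; exact: ccontinuousM.
Qed.

Lemma ccontinuous_mxD n p (F G : R -> 'M[C]_(n, p)) :
  (forall i j, ccontinuous (fun t => F t i j)) ->
  (forall i j, ccontinuous (fun t => G t i j)) ->
  forall i j, ccontinuous (fun t => (F t + G t) i j).
Proof.
by move=> cF cG i j; under [X in ccontinuous X]eq_fun do rewrite mxE; exact: ccontinuousD.
Qed.

Lemma ccontinuous_mxN n p (F : R -> 'M[C]_(n, p)) :
  (forall i j, ccontinuous (fun t => F t i j)) ->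
  forall i j, ccontinuous (fun t => (- F t) i j).
Proof.
move=> cF i j; under [X in ccontinuous X]eq_fun do rewrite mxE -mulN1r.
by apply: ccontinuousM => //; exact: ccontinuous_cst.
Qed.

Lemma is_mderive_open_eq0 n p (F : R -> 'M[C]_(n, p)) D x b : 0 < x < b ->
  (forall t, 0 < t < b -> F t = 0) -> is_mderive x F D -> D = 0.
Proof.
move=> /andP[x0 xb] F0 dF; apply: (is_mderive_unique dF) => i j; rewrite mxE.
have near0 : \forall t \near x, F t i j = 0.
  near=> t; rewrite F0 ?mxE //; apply/andP; split; near: t.
    exact: lt_nbhsr.
  exact: lt_nbhsl.
by split; apply: (near_eq_is_derive _ (is_derive_cst 0 x 1)); apply: filterS near0 => t ->.
Unshelve. all: by end_near.
Qed.

Lemma is_mderive_constant n p (F : R -> 'M[C]_(n, p)) x : 0 <= x ->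
  (forall t, 0 <= t <= x -> is_mderive t F 0) -> F x = F 0.
Proof.
move=> x0 dF; apply/matrixP => i j.
apply: (@is_cderive_eq_fun _ (fun t => F t i j) (fun=> F 0 i j) (fun=> 0)) => // t tx.
  by have := dF t tx i j; rewrite mxE.
exact: is_cderive_cst.
Qed.

Lemma is_mderive_submx n1 n2 p1 p2 x (F : R -> 'M[C]_(n1 + n2, p1 + p2)) D :
  is_mderive x F D ->
  [/\ is_mderive x (fun t => ulsubmx (F t)) (ulsubmx D),
      is_mderive x (fun t => ursubmx (F t)) (ursubmx D),
      is_mderive x (fun t => dlsubmx (F t)) (dlsubmx D) &
      is_mderive x (fun t => drsubmx (F t)) (drsubmx D)].
Proof.
by move=> dF; split=> i j; rewrite !mxE; under [X in is_cderive _ X]eq_fun do rewrite !mxE;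
  exact: dF.
Qed.

End Auxiliary.

(** * Vanishing of the upper right block and its consequences *)

Section Uniqueness.
Variables (R : realType) (m : nat).
Local Notation C := R[i].
Local Notation Im := (@complex.Im R).
Variables (q r : R -> 'M[C]_m) (h1 h0 H1 H0 : 'M[C]_m).
Variables (q' r' : R -> 'M[C]_m) (h1' h0' H1' H0' : 'M[C]_m).
Hypothesis cq : forall i j, ccontinuous (fun x => q x i j).
Hypothesis cr : forall i j, ccontinuous (fun x => r x i j).
Hypothesis cq' : forall i j, ccontinuous (fun x => q' x i j).
Hypothesis cr' : forall i j, ccontinuous (fun x => r' x i j).
Hypotheses (dhp : \det (1%:M + h1) != 0) (dhm : \det (1%:M - h1) != 0).
Hypotheses (dHp : \det (1%:M + H1) != 0) (dHm : \det (1%:M - H1) != 0).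
Hypotheses (dhp' : \det (1%:M + h1') != 0) (dhm' : \det (1%:M - h1') != 0).
Hypotheses (dHp' : \det (1%:M + H1') != 0) (dHm' : \det (1%:M - H1') != 0).
Hypotheses (r0 : r 0 = 0) (r0' : r' 0 = 0).
Hypothesis weyl : forall z (f g f' g' : R -> 'M[C]_m),
  qsolution q r z f g -> qsolution q' r' z f' g' ->
  bform h1 h0 z (f 0) (g 0) = 1%:M -> bform h1' h0' z (f' 0) (g' 0) = 1%:M ->
  bform H1 H0 z (f pi) (g pi) = 0 -> bform H1' H0' z (f' pi) (g' pi) = 0 ->
  f 0 = f' 0.

(* The transfer matrix maps every solution of the second system to the solution of the
   first one with the same initial value and the same boundary datum at 0. *)
Let transfer : exists P : R -> C -> 'M[C]_(m + m),
  [/\ forall z, P 0 z = block_mx 1%:M 0 (- (('i%C * z) *: (h1 - h1') + (h0 - h0'))) 1%:M,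
      forall x z, 0 <= x <= pi ->
        is_mderive x (fun t => P t z) (qcoef q r x z *m P x z - P x z *m qcoef q' r' x z) &
      forall x, 0 <= x <= pi -> forall i j, poly_approx (fun z => P x z i j)].
Proof.
apply: linear_ode_solution; [exact: pi_ge0|exact: qcoef_family|exact: qcoef_family|].
have pz := poly_family_id R.
have pc c : poly_family (fun (_ : R) (_ : C) => c).
  exact/poly_family_cst/ccontinuous_cst.
move=> i j; case: (split_ordP i) => i' ->; case: (split_ordP j) => j' ->;
  under [X in poly_family X]eq_fun2 do
    rewrite ?block_mxEul ?block_mxEur ?block_mxEdl ?block_mxEdr; try exact: pc.
under [X in poly_family X]eq_fun2 do rewrite !mxE.
by apply: poly_familyN; apply: poly_familyD => //; apply: poly_familyM => //; exact: poly_familyM.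
Qed.

(** For large [|Im z|] the Weyl solutions, multiplied on the right by the common datum, are the
    decaying parts required by [half_plane_comparison]; the lower half-plane follows by the sign
    symmetry. In the strip the second solution is carried back to 0, the data are exchanged there at
    the cost [K7], and the first one is carried forward. *)
Let comparison (x : R) : 0 < x < pi ->
  exists T K, forall z, T <= normc z -> forall p (u v u' v' : R -> 'M[C]_(m, p)),
  qsolution q r z u v -> qsolution q' r' z u' v' -> u 0 = u' 0 ->
  bform h1 h0 z (u 0) (v 0) = bform h1' h0' z (u' 0) (v' 0) ->
  energy z (u x) (v x) <= K * energy z (u' x) (v' x).
Proof.
move=> xb.
have cqN : forall i j, ccontinuous (fun x => (- q x) i j) by exact: ccontinuous_mxN.
have cqN' : forall i j, ccontinuous (fun x => (- q' x) i j) by exact: ccontinuous_mxN.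
have dHmN : \det (1%:M - - H1) != 0 by rewrite opprK.
have dHmN' : \det (1%:M - - H1') != 0 by rewrite opprK.
have [T1 w1] := weyl_exists h0 H0 cq cr dhp dHm.
have [T2 w2] := weyl_exists h0' H0' cq' cr' dhp' dHm'.
have [T3 w3] := @weyl_exists _ _ _ _ (- h1) h0 (- H1) H0 cqN cr dhm dHmN.
have [T4 w4] := @weyl_exists _ _ _ _ (- h1') h0' (- H1') H0' cqN' cr' dhm' dHmN'.
have [T5 [K5 up]] := half_plane_comparison h0 H0 h0' H0' cq cr cq' cr' dhp dHm dhp' dHm' xb.
have [T6 [K6 down]] := @half_plane_comparison _ _ _ _ (- h1) h0 (- H1) H0 _ _ (- h1') h0' (- H1') H0'
  cqN cr cqN' cr' dhm dHmN dhm' dHmN' x xb.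
pose T := Num.max 1 (Num.max (Num.max T1 T2) (Num.max (Num.max T3 T4) (Num.max T5 T6))).
have [c tr] := energy_transport cq cr; have [c' tr'] := energy_transport cq' cr'.
set D1 := sqnorm (h1 - h1'); set D0 := sqnorm (h0 - h0').
pose K7 := 2 + 4 * D1 + 4 * D0.
have D10 : 0 <= D1 := sqnorm_ge0 _; have D00 : 0 <= D0 := sqnorm_ge0 _.
pose M := expR ((2 * T + 2 * `|c|) * pi); pose M' := expR ((2 * T + 2 * `|c'|) * pi).
have M0 : 0 < M := expR_gt0 _; have M0' : 0 < M' := expR_gt0 _.
have K70 : 0 < K7 by rewrite /K7; lra.
(* One term for each region: upper half-plane, lower half-plane, strip. *)
exists 1, (`|K5| + `|K6| + M * (K7 * M')) => z z1 p u v u' v' uv uv' u0 b0.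
have e0 a1 a2 : 0 <= energy z (a1 : 'M[C]_(m, p)) a2.
  by rewrite addr_ge0 // sqnorm_ge0.
have M7 : 0 <= M * (K7 * M') by rewrite ltW // !mulr_gt0.
have [zT|zT] := leP T (Im z).
  move: zT; rewrite /T !ge_max => /and3P[_ /andP[/w1[f [g [fg fU fV]]] /w2[f' [g' [fg' fU' fV']]]]].
  move=> /andP[_ /andP[zT5 _]].
  have ff := weyl fg fg' fU fU' fV fV'.
  have := up z zT5 p u v u' v' _ _ _ _ uv uv'
    (qsolution_mulmx (bform h1 h0 z (u 0) (v 0)) fg)
    (qsolution_mulmx (bform h1 h0 z (u 0) (v 0)) fg').
  rewrite !bformM fV fV' fU fU' !mul0mx !mul1mx b0 ff => /(_ erefl erefl erefl erefl erefl u0 erefl).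
  move=> h; apply: le_trans h _; apply: ler_wpM2r; first exact: e0.
  by have := ler_norm K5; have := normr_ge0 K6; lra.
have [zT'|zT'] := leP T (- Im z).
  have Nz : Im (- z) = - Im z by case: (z).
  rewrite -Nz in zT'.
  move: zT'; rewrite /T !ge_max => /and3P[_ _ /andP[]].
  move=> /andP[/w3[f [g [fg fU fV]]] /w4[f' [g' [fg' fU' fV']]]] /andP[_ zT6].
  rewrite bformN in fU; rewrite bformN in fV; rewrite bformN in fU'; rewrite bformN in fV'.
  have ff := weyl ((qsolutionN _ _ _ _ _).2 fg) ((qsolutionN _ _ _ _ _).2 fg') fU fU' fV fV'.
  have := down (- z) zT6 p u v u' v' _ _ _ _ ((qsolutionN _ _ _ _ _).1 uv) ((qsolutionN _ _ _ _ _).1 uv')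
    (qsolution_mulmx (bform h1 h0 z (u 0) (v 0)) fg)
    (qsolution_mulmx (bform h1 h0 z (u 0) (v 0)) fg').
  rewrite !bformN !bformM fV fV' fU fU' !mul0mx !mul1mx b0 ff => /(_ erefl erefl erefl erefl erefl u0 erefl).
  rewrite -/(energy _ _ _) -/(energy _ _ _) !energyN.
  move=> h; apply: le_trans h _; apply: ler_wpM2r; first exact: e0.
  by have := ler_norm K6; have := normr_ge0 K5; lra.
have xb' : 0 <= x <= pi by case/andP: xb => /ltW -> /ltW.
have [t1 _] := tr z z1 p u v uv x xb'; have [_ t2] := tr' z z1 p u' v' uv' x xb'.
have zn : `|Im z| <= T by rewrite ler_norml (ltW zT) andbT lerNl (ltW zT').
have ex a : expR ((2 * `|Im z| + 2 * a) * x) <= expR ((2 * T + 2 * `|a|) * pi).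
  exact: expR_strip_le.
have mid : energy z (u 0) (v 0) <= K7 * energy z (u' 0) (v' 0).
  by rewrite u0 in b0 *; exact: energy_same_bform.
have s1 : energy z (u x) (v x) <= M * energy z (u 0) (v 0).
  by apply: le_trans t1 _; apply: ler_wpM2r; [exact: e0|exact: ex].
have s2 : energy z (u' 0) (v' 0) <= M' * energy z (u' x) (v' x).
  by apply: le_trans t2 _; apply: ler_wpM2r; [exact: e0|exact: ex].
apply: le_trans s1 _; apply: (@le_trans _ _ (M * (K7 * (M' * energy z (u' x) (v' x))))).
  by rewrite ler_pM2l //; apply: le_trans mid _; rewrite ler_pM2l.
rewrite !mulrA; apply: ler_wpM2r; first exact: e0.
by rewrite lerDr addr_ge0 ?normr_ge0.
Qed.

(** Take the solution of the second system equal to [(0, 1)] at [x], which exists because its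
    fundamental matrix is invertible. Its energy there does not depend on [z], while its image under
    [P] is the second block column, whose energy contains [|z|^2] times the squared norm of the
    upper right block. Hence that block is O(1/z). *)
Let upper_right_eq0 P :
  (forall z, P 0 z = block_mx 1%:M 0 (- (('i%C * z) *: (h1 - h1') + (h0 - h0'))) 1%:M) ->
  (forall x z, 0 <= x <= pi ->
    is_mderive x (fun t => P t z) (qcoef q r x z *m P x z - P x z *m qcoef q' r' x z)) ->
  (forall x, 0 <= x <= pi -> forall i j, poly_approx (fun z => P x z i j)) ->
  forall x z, 0 < x < pi -> ursubmx (P x z) = 0.
Proof.
move=> P0 dP aP x z xb; have xb' : 0 <= x <= pi by case/andP: xb => /ltW -> /ltW.
apply/matrixP => i j; rewrite [RHS]mxE; move: z.
have [T [K cmp]] := comparison xb; have [c tr'] := energy_transport cq' cr'.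
apply: (@poly_approx_eq0 _ (fun z => ursubmx (P x z) i j) (Num.max 1 T)
  (`|K| * sqnorm (1%:M : 'M[C]_m) + 1)) => [k e e0|z].
  have [s sP] := aP x xb' (lshift m i) (rshift m j) k e e0; exists s => z zk.
  by rewrite !mxE; exact: sP.
rewrite ge_max => /andP[z1 zT].
have [u [v [uv u0 v0]]] := qsolution_exists z (row_mx 1%:M 0 : 'M[C]_(m, m + m))
  (row_mx 0 1%:M) cq' cr'.
have Yu : col_mx (u x) (v x) \in unitmx.
  apply: unitmx_ker0 => d; rewrite mul_col_mx => E.
  have [ud vd] : u x *m d = 0 /\ v x *m d = 0 by apply: eq_col_mx; rewrite col_mx0.
  have [_] := tr' z z1 _ _ _ (qsolution_mulmx d uv) x xb'.
  rewrite /= ud vd {2}/energy energy_sum !sqnorm0 !mulr0 addr0 mulr0 => /(energy_eq0 z1)[].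
  by rewrite u0 v0 -(vsubmxK d) !mul_row_col !mul1mx !mul0mx addr0 add0r => -> ->; rewrite col_mx0.
set d := invmx (col_mx (u x) (v x)) *m col_mx 0 1%:M.
have := qsolution_mulmx d uv; set u1 := fun t => u t *m d; set v1 := fun t => v t *m d => uv1.
have [u1x v1x] : u1 x = 0 /\ v1 x = 1%:M.
  by apply: eq_col_mx; rewrite -mul_col_mx mulKVmx.
pose W t := P t z *m col_mx (u1 t) (v1 t).
have dW : qsolution q r z (fun t => usubmx (W t)) (fun t => dsubmx (W t)).
  apply: (qsolutionP _ _ _ _ _).2 => t tb; rewrite vsubmxK.
  under [X in is_mderive _ X]eq_fun do rewrite vsubmxK.
  have := is_mderiveM (dP t z tb) ((qsolutionP _ _ _ _ _).1 uv1 t tb).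
  by rewrite mulmxBl -!mulmxA subrK.
have W0 : W 0 = col_mx (u1 0) (- (('i%C * z) *: (h1 - h1') + (h0 - h0')) *m u1 0 + v1 0).
  by rewrite /W P0 mul_block_col !mul1mx mul0mx addr0.
have b0 : bform h1 h0 z (usubmx (W 0)) (dsubmx (W 0)) = bform h1' h0' z (u1 0) (v1 0).
  rewrite W0 col_mxKu col_mxKd /bform scalerBr !mulmxDl !mulNmx !mulmxDl !mulNmx.
  by apply/matrixP => i' j'; rewrite !mxE; ring.
have Wx : W x = col_mx (ursubmx (P x z)) (drsubmx (P x z)).
  by rewrite /W u1x v1x -{1}(submxK (P x z)) mul_block_col !mulmx0 !mulmx1 !add0r.
have := cmp z zT _ _ _ u1 v1 dW uv1 _ b0; rewrite W0 col_mxKu => /(_ erefl).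
rewrite Wx col_mxKu col_mxKd u1x v1x !energyE sqnorm0 !mulr0 addr0.
move: (ursubmx _) (drsubmx _) => p12 p22 le.
have n1 := sqnorm_ge0 (1%:M : 'M[C]_m); have n2 := sqnorm_ge0 p22.
have n3 : K * sqnorm (1%:M : 'M[C]_m) <= `|K| * sqnorm (1%:M : 'M[C]_m).
  by rewrite ler_wpM2r // ler_norm.
have n4 : (normc z * normc (p12 i j)) ^+ 2 <= `|K| * sqnorm (1%:M : 'M[C]_m).
  rewrite exprMn; apply: (@le_trans _ _ (normc z ^+ 2 * sqnorm p12)); last by lra.
  by rewrite ler_wpM2l ?sqr_ge0 // normc_le_sqnorm.
(* From [a ^+ 2 <= b] one gets [a <= b + 1] without a square root; this is the [+ 1] in the constant
   given to [poly_approx_eq0]. *)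
by move: n4; move: (_ * normc _) (`|K| * _) => a b ab; have := sqr_ge0 (a - 1); nra.
Qed.

(** Once [P12 = 0], the equation of that block gives [P22 = P11]. Comparing the equations of the two
    diagonal blocks then gives [P21 = r P11 - P11 r'], so [P11] is constant, equal to 1, and
    [P21 = r - r']. The last block says that the derivative of [r - r'] is [- 2 i z (q - q')] for
    every [z]: [z = 0] yields [r = r'], and [z = 1] yields [q = q']. *)
Lemma pencil_coefficients_unique :
  [/\ h1 = h1', h0 = h0', forall x, 0 < x < pi -> r x = r' x &
      forall x, 0 < x < pi -> q x = q' x].
Proof.
have [P [P0 dP aP]] := transfer; have p12 := upper_right_eq0 P0 dP aP.
pose Q z x := (z ^+ 2)%:M + (2%:R * 'i%C * z) *: q x + r x *m r x.
pose Q' z x := (z ^+ 2)%:M + (2%:R * 'i%C * z) *: q' x + r' x *m r' x.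
pose p11 z x := ulsubmx (P x z); pose p22 z x := drsubmx (P x z).
pose p21 z x := dlsubmx (P x z).
have p110 z : p11 z 0 = 1%:M by rewrite /p11 P0 block_mxKul.
have p210 z : p21 z 0 = - (('i%C * z) *: (h1 - h1') + (h0 - h0')) by rewrite /p21 P0 block_mxKdl.
have dblock x z : 0 <= x <= pi -> ursubmx (P x z) = 0 ->
  [/\ is_mderive x (p11 z) (p21 z x - r x *m p11 z x + p11 z x *m r' x),
      is_mderive x (fun t => ursubmx (P t z)) (p22 z x - p11 z x),
      is_mderive x (p21 z) (p22 z x *m Q' z x - Q z x *m p11 z x + r x *m p21 z x + p21 z x *m r' x) &
      is_mderive x (p22 z) (r x *m p22 z x - p22 z x *m r' x - p21 z x)].
  move=> xb u0; have := dP x z xb.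
  rewrite -(submxK (P x z)) u0 -/(p11 z x) -/(p21 z x) -/(p22 z x) /qcoef.
  rewrite !mulmx_block opp_block_mx add_block_mx -/(Q z x) -/(Q' z x).
  move=> /is_mderive_submx[]; rewrite block_mxKul block_mxKur block_mxKdl block_mxKdr.
  rewrite !mul0mx !mulmx0 !mul1mx !mulmx1 !add0r !addr0 !mulNmx !mulmxN.
  move=> e1 e2 e3 e4; split => //.
  - by move: e1; rewrite opprK [- _ + _]addrC.
  - move: e3; rewrite opprD !opprK.
    move: (p22 z x *m _) (Q z x *m _) (r x *m _) (p21 z x *m _) => a1 a2 a3 a4.
    by congr is_mderive; apply/matrixP => i j; rewrite !mxE; ring.
  - move: e4; move: (r x *m _) (p22 z x *m _) => a1 a2.
    by congr is_mderive; apply/matrixP => i j; rewrite !mxE; ring.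
have ccl (x : R) : 0 < x < pi -> 0 <= x <= pi by case/andP=> /ltW -> /ltW.
have p22E x z : 0 < x < pi -> p22 z x = p11 z x.
  move=> xb; have [_ d12 _ _] := dblock x z (ccl x xb) (p12 x z xb).
  apply/eqP; rewrite -subr_eq0; apply/eqP.
  by apply: (is_mderive_open_eq0 xb _ d12) => t tb; exact: p12.
have p21E x z : 0 < x < pi -> p21 z x - r x *m p11 z x + p11 z x *m r' x = 0.
  move=> xb; have [d11 _ _ d22] := dblock x z (ccl x xb) (p12 x z xb).
  have := is_mderive_open_eq0 xb _ (is_mderiveB d11 d22).
  rewrite p22E // => H; have {}H : p21 z x - r x *m p11 z x + p11 z x *m r' x -
      (r x *m p11 z x - p11 z x *m r' x - p21 z x) = 0.
    by apply: H => t tb; rewrite p22E // subrr.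
  move: H; move: (r x *m _) (p11 z x *m _) (p21 z x) => a1 a2 a3.
  have -> : a3 - a1 + a2 - (a1 - a2 - a3) = 2%:R *: (a3 - a1 + a2) :> 'M[C]_m.
    by apply/matrixP => i j; rewrite !mxE; ring.
  by move/eqP; rewrite scaler_eq0 pnatr_eq0 => /eqP.
have pi0 : 0 < pi :> R by exact: pi_gt0.
have pi00 : 0 <= pi :> R by exact: ltW.
have z0 : 0 <= (0 : R) <= pi by rewrite lexx.
have u0 z : ursubmx (P 0 z) = 0 by rewrite P0 block_mxKur.
have p12c x z : 0 <= x < pi -> ursubmx (P x z) = 0.
  by move=> /andP[]; rewrite le_eqVlt => /predU1P[<-|x0 xpi]; [rewrite u0|apply: p12; rewrite x0].
(* The relation [P21 = r P11 - P11 r'] extends to 0 by continuity, where [r] and [r'] vanish. As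
   [P21] at 0 is the difference of the boundary coefficients, this identifies [h0] and [h1]. *)
have p210E z : p21 z 0 = 0.
  pose cl := clamp (pi : R).
  have c0 : cl 0 = 0 by exact: clampE.
  have dul x : 0 <= x <= pi -> is_mderive x (p11 z) _ := fun xb => let: And4 a _ _ _ :=
    is_mderive_submx (dP x z xb) in a.
  have ddl x : 0 <= x <= pi -> is_mderive x (p21 z) _ := fun xb => let: And4 _ _ a _ :=
    is_mderive_submx (dP x z xb) in a.
  have c11 := ccontinuous_clamp pi00 dul; have c21 := ccontinuous_clamp pi00 ddl.
  have crc i j : ccontinuous (fun t => r (cl t) i j).
    exact: (ccontinuous_comp (@continuous_clamp _ _) (cr i j)).
  have crc' i j : ccontinuous (fun t => r' (cl t) i j).
    exact: (ccontinuous_comp (@continuous_clamp _ _) (cr' i j)).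
  have := @mx_zero_closure _ _ _ (fun t => p21 z (cl t) - r (cl t) *m p11 z (cl t) +
    p11 z (cl t) *m r' (cl t)) 0 pi pi0 z0.
  rewrite c0 r0 r0' mul0mx mulmx0 subr0 addr0; apply=> [i j|x xb].
    apply: ccontinuous_mxD; last exact: ccontinuous_mulmx.
    apply: ccontinuous_mxD; first exact: c21.
    by apply: ccontinuous_mxN; exact: ccontinuous_mulmx.
  by rewrite /cl clampE ?ccl // p21E.
have hh z : ('i%C * z) *: (h1 - h1') + (h0 - h0') = 0.
  by apply/eqP; rewrite -oppr_eq0 -p210 p210E.
have h0E : h0 = h0'.
  by apply/eqP; rewrite -subr_eq0; have := hh 0; rewrite mulr0 scale0r add0r => ->.
have h1E : h1 = h1'.
  apply/eqP; rewrite -subr_eq0; have := hh 1; rewrite h0E subrr addr0 mulr1 => /eqP.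
  rewrite scaler_eq0 => /orP[/eqP i0|//].
  by have := sqr_i R; rewrite i0 expr0n /= => /eqP; rewrite eq_sym oppr_eq0 oner_eq0.
have p11E x z : 0 <= x < pi -> p11 z x = 1%:M.
  move=> /andP[x0 xpi]; rewrite -(p110 z); apply: is_mderive_constant => // t /andP[t0 tx].
  have tpi : 0 <= t < pi by rewrite t0 (le_lt_trans tx).
  have tb : 0 <= t <= pi by rewrite t0 ltW // (le_lt_trans tx).
  have [d11 _ _ _] := dblock t z tb (p12c t z tpi).
  move: d11; congr is_mderive; move: t0; rewrite le_eqVlt => /predU1P[<-|t0].
    by rewrite p210E r0 r0' mul0mx mulmx0 subr0 addr0.
  by apply: p21E; rewrite t0 (le_lt_trans tx).
have p21r x z : 0 < x < pi -> p21 z x = r x - r' x.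
  move=> xb; have := p21E x z xb; rewrite p11E; last by case/andP: xb => /ltW ->.
  by rewrite mulmx1 mul1mx => /eqP; rewrite -addrA addr_eq0 opprD opprK => /eqP.
have d21 x z : 0 < x < pi -> is_mderive x (p21 z) (- ((2%:R * 'i%C * z) *: (q x - q' x))).
  move=> xb; have [_ _ + _] := dblock x z (ccl x xb) (p12 x z xb).
  rewrite p22E // p11E; last by case/andP: xb => /ltW ->.
  rewrite p21r // mul1mx mulmx1 /Q /Q' scalerBr mulmxBr mulmxBl.
  move: (_ *: q x) (_ *: q' x) (r x *m r x) (r' x *m r' x) (r x *m r' x) => a1 a2 a3 a4 a5.
  by congr is_mderive; apply/matrixP => i j; rewrite !mxE; ring.
have rE x : 0 < x < pi -> r x = r' x.
  move=> xb; apply/eqP; rewrite -subr_eq0 -(p21r x 0 xb) -(p210E 0); apply/eqP.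
  case/andP: xb => x0 xpi.
  apply: is_mderive_constant; first exact: ltW.
  (* [d21] is available only inside the interval; at 0 the derivative is read off from [dblock], all
     of whose terms vanish for [z = 0]. *)
  move=> t /andP[]; rewrite le_eqVlt => /predU1P[<- _|t0 tx].
    have [_ _ + _] := dblock 0 0 z0 (u0 0).
    have -> : Q 0 0 = 0 by rewrite /Q expr0n r0 mul0mx mulr0 scale0r !addr0 raddf0.
    have -> : Q' 0 0 = 0 by rewrite /Q' expr0n r0' mul0mx mulr0 scale0r !addr0 raddf0.
    by rewrite p210E mulmx0 !mul0mx mulmx0 subrr !addr0.
  have tb : 0 < t < pi by rewrite t0 (le_lt_trans tx).
  by have := d21 t 0 tb; rewrite mulr0 scale0r oppr0.
split=> // x xb; apply/eqP; rewrite -subr_eq0; apply/eqP.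
have := is_mderive_open_eq0 xb _ (d21 x 1 xb) => H.
have /eqP : - ((2%:R * 'i%C * 1) *: (q x - q' x)) = 0.
  by apply: H => t tb; rewrite p21r // rE // subrr.
rewrite oppr_eq0 scaler_eq0 mulr1 mulf_eq0 pnatr_eq0 /= => /orP[/eqP i0|/eqP //].
by have := sqr_i R; rewrite i0 expr0n /= => /eqP; rewrite eq_sym oppr_eq0 oner_eq0.
Qed.

(** The two Weyl solutions now solve the same equation with the same initial data, so they agree at
    [pi]. Moreover [f pi] is invertible: if it kills [d], then [V = 0] makes [g pi] kill [d] as
    well, the solution vanishes, and its datum [d] at 0 is zero. Cancelling [f pi] leaves an affine
    relation in [z], and two points of the imaginary axis separate its coefficients. *)
Lemma right_boundary_unique : H1 = H1' /\ H0 = H0'.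
Proof.
have [h1E h0E rE qE] := pencil_coefficients_unique.
have pi0 : 0 < pi :> R by exact: pi_gt0.
have closure_eq (F G : R -> 'M[C]_m) : (forall i j, ccontinuous (fun x => F x i j)) ->
    (forall i j, ccontinuous (fun x => G x i j)) ->
    (forall x, 0 < x < pi -> F x = G x) -> forall x, 0 <= x <= pi -> F x = G x.
  move=> cF cG FG x xb; apply/eqP; rewrite -subr_eq0; apply/eqP.
  apply: (mx_zero_closure (F := fun x => F x - G x) pi0 xb) => [|t tb].
    by apply: ccontinuous_mxD => //; exact: ccontinuous_mxN.
  by rewrite FG // subrr.
have {}rE := closure_eq _ _ cr cr' rE; have {}qE := closure_eq _ _ cq cq' qE.
have [T1 w1] := weyl_exists h0 H0 cq cr dhp dHm.
have [T2 w2] := weyl_exists h0' H0' cq' cr' dhp' dHm'.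
have [c tr] := energy_transport cq cr.
have pib : 0 <= (pi : R) <= pi by rewrite lexx ltW.
pose T := Num.max 1 (Num.max T1 T2).
have HH z : T <= Im z -> ('i%C * z) *: (H1 - H1') + (H0 - H0') = 0.
  rewrite !ge_max => /and3P[zT /w1[f [g [fg fU fV]]] /w2[f' [g' [fg' fU' fV']]]].
  have z1 : 1 <= normc z by apply: le_trans zT (Im_le_normc z).
  have f0 := weyl fg fg' fU fU' fV fV'.
  have g0 : g 0 = g' 0.
    by move: fU; rewrite -fU' /bform -f0 -h1E -h0E => /addIr.
  have fgq : qsolution q r z f' g' by move=> x xb; rewrite rE // qE //; exact: fg'.
  have [e1 _] := tr z z1 _ _ _ (qsolutionB fg fgq) pi pib.
  have [fE gE] : f pi - f' pi = 0 /\ g pi - g' pi = 0.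
    apply: (energy_eq0 z1); apply: le_trans e1 _.
    by rewrite f0 g0 !subrr energyE !sqnorm0 !mulr0 addr0 mulr0.
  have fu : f pi \in unitmx.
    apply: unitmx_ker0 => d fd.
    have gd : g pi *m d = 0.
      by have := congr1 (mulmx^~ d) fV; rewrite /= mul0mx -bformM /bform fd mulmx0 addr0.
    have [_ e2] := tr z z1 _ _ _ (qsolution_mulmx d fg) pi pib.
    have [fd0 gd0] : f 0 *m d = 0 /\ g 0 *m d = 0.
      apply: (energy_eq0 z1); apply: le_trans e2 _.
      by rewrite fd gd energyE !sqnorm0 !mulr0 addr0 mulr0.
    by rewrite -(mul1mx d) -fU -bformM /bform fd0 gd0 mulmx0 addr0.
  move/eqP: fE; rewrite subr_eq0 => /eqP fE; move/eqP: gE; rewrite subr_eq0 => /eqP gE.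
  have : (('i%C * z) *: (H1 - H1') + (H0 - H0')) *m f pi = 0.
    transitivity (bform H1 H0 z (f pi) (g pi) - bform H1' H0' z (f' pi) (g' pi)).
      rewrite /bform -fE -gE opprD addrACA subrr add0r -mulmxBl; congr (_ *m _).
      by rewrite scalerBr; apply/matrixP => i j; rewrite !mxE; ring.
    by rewrite fV fV' subrr.
  by move/(congr1 (mulmx^~ (invmx (f pi)))); rewrite /= mulmxK // mul0mx.
pose z1 : C := Complex 0 T; pose z2 : C := Complex 0 (T + 1).
have k1 := HH z1 (lexx T); have k2 : ('i%C * z2) *: (H1 - H1') + (H0 - H0') = 0.
  by apply: HH; rewrite /= lerDl.
have zz : 'i%C * z2 - 'i%C * z1 = -1.
  by apply: complexP; rewrite ?cReB ?cImB ?cReM ?cImM /=; ring.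
have H1E : H1 - H1' = 0.
  have : ('i%C * z2 - 'i%C * z1) *: (H1 - H1') = 0.
    rewrite scalerBl; apply/eqP; rewrite subr_eq0; apply/eqP.
    by apply: (addIr (H0 - H0')); rewrite k1 k2.
  by rewrite zz scaleN1r => /eqP; rewrite oppr_eq0 => /eqP.
move: k1; rewrite H1E scaler0 add0r => /eqP; rewrite subr_eq0 => /eqP ->.
by move/eqP: H1E; rewrite subr_eq0 => /eqP ->.
Qed.

End Uniqueness.

(** * Absolute continuity *)

Section AbsoluteContinuity.
Variables (R : realType) (b : R).
Implicit Types (f g : R -> R).
Local Notation mu := (@lebesgue_measure R).
Hypothesis b0 : 0 <= b.

Let mitv (i : interval R) : @measurable _ (measurableTypeR R) [set` i].
Proof. exact: measurable_itv. Qed.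

Definition absc f f' : Prop :=
  mu.-integrable `[0, b] (EFin \o f') /\
  forall x, 0 <= x <= b -> f x = f 0 + Rintegral mu `[0, x] f'.

Lemma integrable_sub (a : itv_bound R) y f : (BLeft 0 <= a)%O -> y <= b ->
  mu.-integrable `[0, b] (EFin \o f) -> mu.-integrable [set` Interval a (BRight y)] (EFin \o f).
Proof.
move=> a0 yb; apply: integrableS => //; exact: subset_itv.
Qed.

Lemma integrable_clamp f : continuous (fun t => f (clamp b t)) ->
  mu.-integrable `[0, b] (EFin \o f).
Proof.
move=> cf; apply: (@eq_integrable _ _ _ mu `[0, b]%classic (mitv _) (EFin \o (fun t => f (clamp b t)))).
  by move=> x; rewrite inE /= in_itv /= => xb; rewrite clampE.
apply: continuous_compact_integrable; first exact: segment_compact.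
exact: continuous_subspaceT.
Qed.

Lemma within_continuous_clamp f :
  {within `[0, b], continuous f} -> continuous (fun t => f (clamp b t)).
Proof.
move=> /subspace_continuousP cf x.
have cb : `[0, b]%classic (clamp b x) by rewrite /= in_itv /= clamp_in.
apply: cvg_comp (cf _ cb) => P; rewrite /within /= => nP.
have H : nbhs x (fun t => `[0, b]%classic (clamp b t) -> P (clamp b t)).
  exact: (@continuous_clamp _ b x _ nP).
by apply: filterS H => t; apply; rewrite /= in_itv /= clamp_in.
Qed.

Lemma Rintegral0 f : Rintegral mu `[0, 0] f = 0.
Proof. by rewrite set_itv1 Rintegral_set1. Qed.

Lemma integral_continuous_clamp f : mu.-integrable `[0, b] (EFin \o f) ->
  continuous (fun t => Rintegral mu `[0, clamp b t] f).
Proof.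
move=> intf.
apply: (@within_continuous_clamp (fun t => Rintegral mu `[0, t] f)).
exact: parameterized_integral_continuous.
Qed.

Lemma absc_continuous_clamp f f' : absc f f' -> continuous (fun t => f (clamp b t)).
Proof.
move=> [intf fE].
have -> : (fun t => f (clamp b t)) = (fun t => f 0 + Rintegral mu `[0, clamp b t] f').
  by apply/funext => t; rewrite fE // clamp_in.
by move=> x; apply: cvgD; [exact: cvg_cst|exact: integral_continuous_clamp].
Qed.

Lemma absc_increment f f' x y : absc f f' -> 0 <= x -> x <= y -> y <= b ->
  f y - f x = Rintegral mu `]x, y] f'.
Proof.
move=> [intf fE] x0 xy yb.
rewrite (fE y) ?(le_trans x0 xy) // (fE x) ?x0 ?(le_trans xy) //.
rewrite -(@Rintegral_itvB _ f' (BLeft 0) (BRight y) x) ?bnd_simp //; last first.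
  by apply: integrable_sub => //; rewrite bnd_simp.
by ring.
Qed.

Lemma integrable_addf (A : set (measurableTypeR R)) f g : measurable A ->
  mu.-integrable A (EFin \o f) -> mu.-integrable A (EFin \o g) ->
  mu.-integrable A (EFin \o (fun t => f t + g t)).
Proof. by move=> mA i1 i2; have := integrableD mA i1 i2. Qed.

Lemma integrable_oppf (A : set (measurableTypeR R)) f : measurable A ->
  mu.-integrable A (EFin \o f) -> mu.-integrable A (EFin \o (fun t => - f t)).
Proof. by move=> mA i1; have := integrableN i1. Qed.

Lemma abscD f f' g g' : absc f f' -> absc g g' ->
  absc (fun t => f t + g t) (fun t => f' t + g' t).
Proof.
move=> [if' fE] [ig' gE]; split; first exact: (integrable_addf (mitv _) if' ig').
move=> x xb; have /andP[x0 xb'] := xb.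
rewrite RintegralD //; [|by apply: integrable_sub => //; rewrite bnd_simp..].
by rewrite fE // gE // addrACA.
Qed.

Lemma abscN f f' : absc f f' -> absc (fun t => - f t) (fun t => - f' t).
Proof.
move=> [if' fE]; split; first exact: (integrable_oppf (mitv _) if').
move=> x xb; have /andP[x0 xb'] := xb.
have -> : Rintegral mu `[0, x] (fun t => - f' t) = - Rintegral mu `[0, x] f'.
  rewrite -mulN1r -RintegralZl //; last by apply: integrable_sub => //; rewrite bnd_simp.
  by apply: eq_Rintegral => t _; rewrite mulN1r.
by rewrite -opprD fE.
Qed.

Lemma absc_C1 g g' : (forall x, 0 <= x <= b -> is_derive x 1 g (g' x)) ->
  continuous (fun t => g' (clamp b t)) -> absc g g'.
Proof.
move=> dg cg; split; first exact: integrable_clamp.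
move=> x /andP[]; rewrite le_eqVlt => /predU1P[<- _|x0 xb]; first by rewrite Rintegral0 addr0.
have sub t : 0 <= t <= x -> 0 <= t <= b by move=> /andP[-> /le_trans]; apply.
have -> : Rintegral mu `[0, x] g' = Rintegral mu `[0, x] (fun t => g' (clamp b t)).
  by apply: eq_Rintegral => t; rewrite inE /= in_itv /= => /sub tb; rewrite clampE.
have cont t : 0 <= t <= b -> {for t, continuous g}.
  by move=> /dg; exact: is_derive_continuous.
have := @continuous_FTC2 _ (fun t => g' (clamp b t)) g 0 x x0.
rewrite /Rintegral => ->; first by rewrite -EFinB /=; ring.
- exact: continuous_subspaceT.
- split.
  + move=> t; rewrite in_itv /= => /andP[/ltW t0 /ltW tx].
    by have [] : is_derive t 1 g (g' t) by apply/dg/sub; rewrite t0.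
  + by apply: cvg_at_right_filter; apply: cont; rewrite lexx.
  + by apply: cvg_at_left_filter; apply: cont; rewrite xb ltW.
- move=> t; rewrite in_itv /= => /andP[/ltW t0 /ltW tx].
  have tb : 0 <= t <= b by apply: sub; rewrite t0.
  by have h := dg t tb; rewrite derive1E derive_val clampE.
Qed.

(** Over [n] equal pieces the increments of [F] telescope while each length is [x / n], so the total
    variation bound [c * (x / n) * (F x - F 0)] tends to 0. *)
Lemma telescoping_zero (D F : R -> R) (c : R) : 0 <= c ->
  (forall x y, 0 <= x -> x <= y -> y <= b -> `|D y - D x| <= c * (y - x) * (F y - F x)) ->
  forall x, 0 <= x <= b -> D x = D 0.
Proof.
move=> c0 DF x /andP[x0 xb].
have step n : (0 < n)%N -> `|D x - D 0| <= c * (x / n%:R) * (F x - F 0).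
  move=> n0; have n0' : 0 < n%:R :> R by rewrite ltr0n.
  have xn0 : 0 <= x / n%:R by rewrite divr_ge0 // ltW.
  suff H k : (k <= n)%N -> `|D (k%:R * (x / n%:R)) - D 0| <=
      c * (x / n%:R) * (F (k%:R * (x / n%:R)) - F 0).
    by have := H n (leqnn n); rewrite mulrC divfK // gt_eqF.
  elim: k => [|k IH] kn; first by rewrite !mul0r !subrr normr0 mulr0.
  have := DF (k%:R * (x / n%:R)) (k.+1%:R * (x / n%:R)).
  have e : k.+1%:R * (x / n%:R) = k%:R * (x / n%:R) + x / n%:R by rewrite -natr1 mulrDl mul1r.
  have le : k.+1%:R * (x / n%:R) <= b.
    by apply: le_trans xb; rewrite mulrA ler_pdivrMr // mulrC ler_wpM2l // ler_nat.
  rewrite e lerDl addrAC subrr add0r -e => /(_ _ xn0 le) h.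
  have {}h := h (mulr_ge0 (ler0n _ _) xn0).
  have := IH (ltnW kn); have := ler_normD (D (k.+1%:R * (x / n%:R)) - D (k%:R * (x / n%:R)))
    (D (k%:R * (x / n%:R)) - D 0); rewrite addrA subrK; lra.
apply/eqP; rewrite -subr_eq0 -normr_le0; apply/ler_addgt0Pr => e e0; rewrite add0r.
pose A := c * x * (F x - F 0); pose n := (Num.truncn (`|A| / e)).+1.
have nP : `|A| / e < n%:R by rewrite truncnS_gt.
apply: le_trans (step n isT) _.
have -> : c * (x / n%:R) * (F x - F 0) = A / n%:R by rewrite /A; ring.
rewrite ler_pdivrMr ?ltr0n //; apply: le_trans (ler_norm _) _.
by rewrite mulrC -ler_pdivrMr // ltW.
Qed.

(** The defect [D] of the product formula has increments bounded by [2 * L] times the length times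
    the variation of [f], with [L] a bound of [g']; [telescoping_zero] then makes it constant.
    Neither differentiation almost everywhere nor a double integral is involved. *)
Lemma abscM f f' g g' : absc f f' -> (forall x, 0 <= x <= b -> is_derive x 1 g (g' x)) ->
  continuous (fun t => g' (clamp b t)) ->
  absc (fun t => f t * g t) (fun t => f' t * g t + f t * g' t).
Proof.
move=> af dg cg'; have ag := absc_C1 dg cg'; have [if' fE] := af; have [ig' gE] := ag.
have cf := absc_continuous_clamp af; have cg := absc_continuous_clamp ag.
have bounded_clamp (h : R -> R) : continuous (fun t => h (clamp b t)) ->
    exists2 M, 0 <= M & forall t, 0 <= t <= b -> `|h t| <= M.
  move=> ch; have [|M MP] := @ccontinuous_bounded R (fun t => Complex (h (clamp b t)) 0) b.
    by split=> // x; exact: cvg_cst.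
  exists `|M| => // t tb; apply: le_trans (ler_norm M); have := MP t tb.
  by rewrite clampE // normc_real.
have [L L0 LP] := bounded_clamp _ cg'.
have [Mg _ MgP] := bounded_clamp _ cg.
have ifg : mu.-integrable `[0, b] (EFin \o (fun t => f' t * g t)).
  apply: (@eq_integrable _ _ _ mu `[0, b]%classic (mitv _)
    (EFin \o (fun t => f' t * g (clamp b t)))).
    by move=> t; rewrite inE /= in_itv /= => tb; rewrite clampE.
  apply: (@integrableMl _ _ _ mu `[0, b]%classic (mitv _)
    (EFin \o f') (fun t => g (clamp b t)) if').
    by apply: measurable_funTS; exact: continuous_measurable_fun.
  exists Mg; split; first exact: num_real.
  by move=> y /ltW My t _; apply: le_trans (MgP _ (clamp_in _ b0)) My.
have ifg' : mu.-integrable `[0, b] (EFin \o (fun t => f t * g' t)).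
  apply: integrable_clamp => x; apply: cvgM; [exact: cf|exact: cg'].
have ih : mu.-integrable `[0, b] (EFin \o (fun t => f' t * g t + f t * g' t)).
  exact: (integrable_addf (mitv _) ifg ifg').
split=> // x xb.
have iaf : mu.-integrable `[0, b] (EFin \o (fun t => `|f' t|)) by exact: integrable_norm.
pose h t := f' t * g t + f t * g' t.
pose D x := f x * g x - Rintegral mu `[0, x] h.
pose F x := Rintegral mu `[0, x] (fun t => `|f' t|).
have aF : absc F (fun t => `|f' t|) by split=> // y _; rewrite /F Rintegral0 add0r.
have ah : absc (fun y => Rintegral mu `[0, y] h) h.
  by split=> // y _; rewrite Rintegral0 add0r.
have Fle s t : 0 <= s -> s <= t -> t <= b -> `|f t - f s| <= F t - F s.
  move=> s0 st tb; rewrite (absc_increment af) // (absc_increment aF) //.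
  by apply: le_normr_Rintegral => //; apply: integrable_sub => //; rewrite bnd_simp.
have gle s t : 0 <= s -> s <= t -> t <= b -> `|g t - g s| <= L * (t - s).
  move=> s0 st tb; rewrite mulrBr ler_norml.
  have sub y : s <= y <= t -> 0 <= y <= b.
    by move=> /andP[sy yt]; rewrite (le_trans s0 sy) (le_trans yt).
  have dL y : is_derive (y : R) 1 (fun y : R => L * y) L.
    by have := is_deriveMl L (is_derive_id y 1); rewrite mulr1.
  have n1 : g t - g s <= L * t - L * s.
    apply: (@is_derive_le _ g g' (fun y => L * y) (fun=> L)) => // y /sub yb; first exact: dg.
    exact: le_trans (ler_norm _) (LP y yb).
  have n2 : - g t - - g s <= L * t - L * s.
    apply: (@is_derive_le _ (fun y => - g y) (fun y => - g' y) (fun y => L * y) (fun=> L)) => // y /sub yb.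
      by have := dg y yb => ?; exact: is_deriveN.
    by apply: le_trans (ler_norm _) _; rewrite normrN; exact: LP.
  by apply/andP; split; lra.
suff H : D x = D 0.
  by move: H; rewrite /D Rintegral0 subr0 => /eqP; rewrite subr_eq => /eqP.
apply: (@telescoping_zero D F (2 * L)) => //; first exact: mulr_ge0.
move=> s t s0 st tb.
have sub (k : R -> R) : mu.-integrable `[0, b] (EFin \o k) -> mu.-integrable `]s, t] (EFin \o k).
  by move=> ik; apply: integrable_sub => //; rewrite bnd_simp.
have icst c : mu.-integrable `]s, t] (EFin \o (fun=> c)).
  by apply: sub; apply: integrable_clamp => y; exact: cvg_cst.
(* The increment of [f * g] is [g t] times that of [f] plus [f s] times that of [g]; subtracting the
   integrand of the product formula leaves only these differences of values. *)
pose E y := f' y * (g t - g y) + (f s - f y) * g' y.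
have DE : D t - D s = Rintegral mu `]s, t] E.
  have -> : Rintegral mu `]s, t] E =
      Rintegral mu `]s, t] (fun y => (g t * f' y + f s * g' y) - h y).
    by apply: eq_Rintegral => y _; rewrite /E /h; ring.
  have i1 : mu.-integrable `]s, t] (EFin \o (fun y => g t * f' y)).
    by have := integrableZl (mitv _) (g t) (sub _ if').
  have i2 : mu.-integrable `]s, t] (EFin \o (fun y => f s * g' y)).
    by have := integrableZl (mitv _) (f s) (sub _ ig').
  rewrite RintegralB //; [|exact: integrable_addf|exact: sub].
  rewrite RintegralD // !RintegralZl //; [|exact: sub..].
  rewrite -(absc_increment af s0 st tb) -(absc_increment ag s0 st tb).
  by rewrite -(absc_increment ah s0 st tb) /D; ring.
rewrite DE.
have iE : mu.-integrable `]s, t] (EFin \o E).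
  apply: sub; apply: integrable_addf => //.
  - have := integrable_addf (mitv _)
      (integrableZl (mitv _) (g t) if') (integrable_oppf (mitv _) ifg).
    by apply: eq_integrable => // y _ /=; congr EFin; ring.
  - have := integrable_addf (mitv _)
      (integrableZl (mitv _) (f s) ig') (integrable_oppf (mitv _) ifg').
    by apply: eq_integrable => // y _ /=; congr EFin; ring.
apply: le_trans (le_normr_Rintegral _ iE) _ => //.
have iB : mu.-integrable `]s, t] (EFin \o (fun y => L * (t - s) * `|f' y|)).
  by have := integrableZl (mitv _) (L * (t - s)) (sub _ iaf).
apply: (@le_trans _ _ (Rintegral mu `]s, t] (fun y => L * (t - s) * `|f' y| + (F t - F s) * L))).
  apply: le_Rintegral => //.
  - exact: integrable_norm.
  - exact: integrable_addf.
  move=> y; rewrite /= in_itv /= => /andP[/ltW sy yt].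
  have y0 := le_trans s0 sy; have yb := le_trans yt tb.
  apply: le_trans (ler_normD _ _) _; rewrite !normrM; apply: lerD.
    rewrite mulrC ler_wpM2r //; apply: le_trans (gle y t y0 yt tb) _.
    by rewrite ler_wpM2l // lerB.
  rewrite ler_pM //; last by apply: LP; rewrite y0.
  rewrite distrC; apply: le_trans (Fle s y s0 sy yb) _; rewrite lerB //.
  by have := Fle y t y0 yt tb; have := normr_ge0 (f t - f y); lra.
rewrite RintegralD // RintegralZl //; last exact: sub.
rewrite -(absc_increment aF s0 st tb) Rintegral_cst // (_ : fine _ = t - s).
  by rewrite le_eqVlt; apply/orP; left; apply/eqP; ring.
transitivity (fine (if (s%:E < t%:E)%E then (t%:E - s%:E)%E else 0%E)).
  by congr fine; exact: (lebesgue_measure_itv `]s, t]).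
rewrite lte_fin; case: ifPn => // ts; rewrite /=.
by apply/eqP; rewrite eq_sym subr_eq0 eq_le st andbT leNgt.
Qed.

End AbsoluteContinuity.

(** * Absolute continuity of complex and matrix functions *)

Section MatrixAbsoluteContinuity.
Variables (R : realType).
Local Notation C := R[i].
Local Notation Re := (@complex.Re R).
Local Notation Im := (@complex.Im R).
Local Notation mu := (@lebesgue_measure R).

Let pi00 : 0 <= pi :> R. Proof. exact: pi_ge0. Qed.

Definition cabsc (f f' : R -> C) : Prop :=
  absc pi (fun t => Re (f t)) (fun t => Re (f' t)) /\
  absc pi (fun t => Im (f t)) (fun t => Im (f' t)).

Definition mabsc n p (F F' : R -> 'M[C]_(n, p)) : Prop :=
  forall i j, cabsc (fun t => F t i j) (fun t => F' t i j).

Lemma AC_with_derivativeP n p (F F' : R -> 'M[C]_(n, p)) :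
  AC_with_derivative F F' <-> mabsc F F'.
Proof.
split=> [[iF FE] i j|H].
  have [i1 i2] := iF i j; split; split=> // x xb; have {}xb : x \in `[0, pi] by rewrite in_itv.
    by rewrite (FE x xb i j) cReD.
  by rewrite (FE x xb i j) cImD.
split=> [i j|x xb i j]; first by have [[? _] [? _]] := H i j.
have {}xb : 0 <= x <= pi by rewrite in_itv in xb.
have [[_ h1] [_ h2]] := H i j; apply: complexP.
  by rewrite cReD h1.
by rewrite cImD h2.
Qed.

Lemma cabscD (f f' g g' : R -> C) : cabsc f f' -> cabsc g g' ->
  cabsc (fun t => f t + g t) (fun t => f' t + g' t).
Proof.
move=> [f1 f2] [g1 g2]; split.
  under [X in absc _ X]eq_fun do rewrite cReD.
  by under [X in absc _ _ X]eq_fun do rewrite cReD; exact: abscD.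
under [X in absc _ X]eq_fun do rewrite cImD.
by under [X in absc _ _ X]eq_fun do rewrite cImD; exact: abscD.
Qed.

Lemma cabscN (f f' : R -> C) : cabsc f f' -> cabsc (fun t => - f t) (fun t => - f' t).
Proof.
move=> [f1 f2]; split.
  under [X in absc _ X]eq_fun do rewrite cReN.
  by under [X in absc _ _ X]eq_fun do rewrite cReN; exact: abscN.
under [X in absc _ X]eq_fun do rewrite cImN.
by under [X in absc _ _ X]eq_fun do rewrite cImN; exact: abscN.
Qed.

Lemma cabsc_C1 (g g' : R -> C) : (forall x, 0 <= x <= pi -> is_cderive x g (g' x)) ->
  ccontinuous (fun t => g' (clamp pi t)) -> cabsc g g'.
Proof.
move=> dg [c1 c2]; split; apply: absc_C1 => //.
  by move=> x /dg[].
by move=> x /dg[].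
Qed.

Lemma cabscM (f f' g g' : R -> C) : cabsc f f' ->
  (forall x, 0 <= x <= pi -> is_cderive x g (g' x)) ->
  ccontinuous (fun t => g' (clamp pi t)) ->
  cabsc (fun t => f t * g t) (fun t => f' t * g t + f t * g' t).
Proof.
move=> [f1 f2] dg [c1 c2].
have d1 x : 0 <= x <= pi -> is_derive x 1 (fun t => Re (g t)) (Re (g' x)) by move=> /dg[].
have d2 x : 0 <= x <= pi -> is_derive x 1 (fun t => Im (g t)) (Im (g' x)) by move=> /dg[].
split.
  have := abscD (abscM pi00 f1 d1 c1) (abscN (abscM pi00 f2 d2 c2)).
  congr absc; apply/funext => t; rewrite ?cReD !cReM //; ring.
have := abscD (abscM pi00 f1 d2 c2) (abscM pi00 f2 d1 c1).
congr absc; apply/funext => t; rewrite ?cImD !cImM //; ring.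
Qed.

Lemma cabsc_sum (I : Type) (s : seq I) (F F' : I -> R -> C) :
  (forall i, cabsc (F i) (F' i)) ->
  cabsc (fun t => \sum_(i <- s) F i t) (fun t => \sum_(i <- s) F' i t).
Proof.
move=> aF; elim: s => [|i s IH].
  under [X in cabsc X]eq_fun do rewrite big_nil.
  under [X in cabsc _ X]eq_fun do rewrite big_nil.
  apply: cabsc_C1 => [x _|]; [exact: is_cderive_cst|exact: ccontinuous_cst].
under [X in cabsc X]eq_fun do rewrite big_cons.
by under [X in cabsc _ X]eq_fun do rewrite big_cons; exact: cabscD.
Qed.

Lemma mabscB n p (F F' G G' : R -> 'M[C]_(n, p)) : mabsc F F' -> mabsc G G' ->
  mabsc (fun t => F t - G t) (fun t => F' t - G' t).
Proof.
move=> aF aG i j; under [X in cabsc X]eq_fun do rewrite !mxE.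
by under [X in cabsc _ X]eq_fun do rewrite !mxE; apply: cabscD => //; exact: cabscN.
Qed.

Lemma mabsc_C1 n p (G G' : R -> 'M[C]_(n, p)) :
  (forall x, 0 <= x <= pi -> is_mderive x G (G' x)) ->
  (forall i j, ccontinuous (fun t => G' (clamp pi t) i j)) -> mabsc G G'.
Proof. by move=> dG cG i j; apply: cabsc_C1 => // x xb; exact: dG. Qed.

Lemma mabscM n k p (F F' : R -> 'M[C]_(n, k)) (G G' : R -> 'M[C]_(k, p)) : mabsc F F' ->
  (forall x, 0 <= x <= pi -> is_mderive x G (G' x)) ->
  (forall i j, ccontinuous (fun t => G' (clamp pi t) i j)) ->
  mabsc (fun t => F t *m G t) (fun t => F' t *m G t + F t *m G' t).
Proof.
move=> aF dG cG i j; under [X in cabsc X]eq_fun do rewrite mxE.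
under [X in cabsc _ X]eq_fun do rewrite !mxE -big_split /=.
apply: cabsc_sum => l; apply: (@cabscM _ _ (fun t => G t l j) (fun t => G' t l j)) => // x xb.
exact: dG.
Qed.

Lemma mabsc_ccontinuous n p (F F' : R -> 'M[C]_(n, p)) : mabsc F F' ->
  forall i j, ccontinuous (fun t => F (clamp pi t) i j).
Proof.
move=> aF i j; have [a1 a2] := aF i j.
by split; [exact: (absc_continuous_clamp pi00 a1)|exact: (absc_continuous_clamp pi00 a2)].
Qed.

(** Lebesgue differentiation, applied to the extension of [f] by zero: almost everywhere [f] is the
    derivative of its primitive, which vanishes near every interior point. *)
Lemma zero_integral_ae (f : R -> R) (b : R) : mu.-integrable `[0, b] (EFin \o f) ->
  (forall x, 0 < x < b -> Rintegral mu `[0, x] f = 0) ->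
  {ae mu, forall x, 0 < x < b -> f x = 0}.
Proof.
move=> intf f0.
have mA : @measurable _ (measurableTypeR R) `[0, b]%classic by exact: measurable_itv.
have intT : mu.-integrable setT (EFin \o f \_ `[0, b]).
  by rewrite -restrict_EFin; apply/integrable_restrict => //=; rewrite setTI.
have inty y : mu.-integrable [set` Interval (BLeft 0) (BRight y)] (EFin \o f \_ `[0, b]).
  exact: integrableS intT.
have := FTC1 inty (integrable_locally mA intf).
apply: filterS; first exact: (ae_filter_ringOfSetsType mu).
move=> x H xb; have /andP[x0 xb'] := xb.
have [|dF FE] := H; first by rewrite /= lte_fin.
have <- : (f \_ `[0, b]) x = f x.
  by rewrite patchE mem_set //= in_itv /= !ltW.
rewrite -FE.
have near0 : \forall t \near x, Rintegral mu [set` Interval (BLeft 0) (BRight t)] (f \_ `[0, b]) = 0.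
  near=> t.
  have tb : 0 < t < b.
    by apply/andP; split; near: t; [exact: lt_nbhsr|exact: lt_nbhsl].
  transitivity (Rintegral mu `[0, t] f); last exact: f0.
  apply: eq_Rintegral => s; rewrite inE /= in_itv /= => /andP[s0 st].
  case/andP: tb => _ /ltW tb.
  by rewrite /patch ifT // inE /= in_itv /= s0 (le_trans st).
have : is_derive x 1 (fun t => Rintegral mu [set` Interval (BLeft 0) (BRight t)] (f \_ `[0, b])) 0.
  apply: (near_eq_is_derive _ (is_derive_cst 0 x 1)).
  by apply: filterS near0 => t ->.
by move=> h; rewrite derive1E derive_val.
Unshelve. all: by end_near.
Qed.

End MatrixAbsoluteContinuity.

(** * From the pencil to the first-order system *)

Section PencilSystem.
Variables (R : realType) (m : nat).
Local Notation C := R[i].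
Local Notation mu := (@lebesgue_measure R).
Implicit Types (L : pencil R m).

Let pi00 : 0 <= pi :> R. Proof. exact: pi_ge0. Qed.

Definition pencil_q L (x : R) : 'M[C]_m := Q1 L (clamp pi x).

(** The primitive of [Q0] from 0, frozen outside [[0, pi]], so that it is continuous on the whole
    line as the coefficients of the first-order system must be. *)
Definition pencil_r L (x : R) : 'M[C]_m :=
  \matrix_(i, j) cintegral `[0, clamp pi x] (fun t => Q0 L t i j).

Lemma pencil_r0 L : pencil_r L 0 = 0.
Proof.
apply/matrixP => i j; rewrite !mxE clampE ?lexx //.
by rewrite /cintegral !Rintegral0.
Qed.

Lemma mabsc_pencil_r L : mx_integrable (Q0 L) -> mabsc (pencil_r L) (Q0 L).
Proof.
move=> iQ i j; have [i1 i2] := iQ i j.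
split; split=> // x xb; rewrite !mxE !clampE ?lexx //=;
  by rewrite /cintegral !Rintegral0 add0r.
Qed.

Lemma pencil_r_ccontinuous L : mx_integrable (Q0 L) ->
  forall i j, ccontinuous (fun x => pencil_r L x i j).
Proof.
move=> iQ i j; have := mabsc_ccontinuous (mabsc_pencil_r iQ) i j.
congr ccontinuous; apply/funext => x; rewrite !mxE clampK //.
Qed.

Lemma pencil_q_ccontinuous L : mx_W11 (Q1 L) ->
  forall i j, ccontinuous (fun x => pencil_q L x i j).
Proof. by move=> [Q' /AC_with_derivativeP aQ]; exact: mabsc_ccontinuous aQ. Qed.

(** Differentiating [v - r u] by the product rule for an absolutely continuous factor reintroduces
    [Q0 u]. With the second derivative written out in this way, the equation is an algebraic
    identity at every interior point. *)
Lemma qsolution_solution p L z (u v : R -> 'M[C]_(m, p)) : admissible L ->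
  qsolution (pencil_q L) (pencil_r L) z u v ->
  solution L z u (fun x => v x - pencil_r L x *m u x).
Proof.
move=> [wQ1 iQ0 _ _] uv; set r := pencil_r L; set q := pencil_q L.
have cr := pencil_r_ccontinuous iQ0; have cq := pencil_q_ccontinuous wQ1.
have clampC n k (F : R -> 'M[C]_(n, k)) : (forall i j, ccontinuous (fun x => F x i j)) ->
    forall i j, ccontinuous (fun x => F (clamp pi x) i j).
  by move=> cF i j; exact: (ccontinuous_comp (@continuous_clamp _ _) (cF i j)).
have du x (xb : 0 <= x <= pi) := (uv x xb).1; have dv x (xb : 0 <= x <= pi) := (uv x xb).2.
have cu := ccontinuous_clamp pi00 du; have cv := ccontinuous_clamp pi00 dv.
have cru := ccontinuous_mulmx (clampC _ _ _ cr) cu.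
have mscale n k c (F : R -> 'M[C]_(n, k)) : (forall i j, ccontinuous (fun x => F x i j)) ->
    forall i j, ccontinuous (fun x => (c *: F x) i j).
  move=> cF i j; under [X in ccontinuous X]eq_fun do rewrite mxE.
  by apply: ccontinuousM => //; exact: ccontinuous_cst.
have cu' : forall i j, ccontinuous (fun t => (v (clamp pi t) - r (clamp pi t) *m u (clamp pi t)) i j).
  by apply: ccontinuous_mxD => //; exact: ccontinuous_mxN.
exists (fun x => (r x *m v x - (z ^+ 2 *: u x + (2%:R * 'i%C * z) *: (q x *m u x) +
    r x *m (r x *m u x))) - (Q0 L x *m u x + r x *m (v x - r x *m u x))); split.
- by apply/AC_with_derivativeP; exact: mabsc_C1.
- apply/AC_with_derivativeP; apply: mabscB.
    apply: mabsc_C1 => //; apply: ccontinuous_mxD.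
      exact: (ccontinuous_mulmx (clampC _ _ _ cr) cv).
    apply: ccontinuous_mxN; apply: ccontinuous_mxD; last first.
      exact: (ccontinuous_mulmx (clampC _ _ _ cr) cru).
    apply: ccontinuous_mxD; first exact: mscale.
    by apply: mscale; exact: (ccontinuous_mulmx (clampC _ _ _ cq) cu).
  by apply: mabscM => //; exact: mabsc_pencil_r.
- apply: aeW => x; rewrite in_itv /= => /andP[/ltW x0 /ltW xpi].
  have qx : q x = Q1 L x by rewrite /q /pencil_q clampE // x0.
  rewrite /ell -qx !mulmxDl mul_scalar_mx -scalemxAl mulmxBr.
  move: (r x *m v x) (r x *m (r x *m u x)) (q x *m u x) (Q0 L x *m u x) => a1 a2 a3 a4.
  by apply/matrixP => i j; rewrite !mxE; ring.
Qed.

(** Carries Weyl solutions of the first-order system to the pencil, so that equality of the Weyl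
    matrices becomes the hypothesis [weyl] of the uniqueness argument; the shift of [H0] compensates
    [Y' = v - r u] at [pi]. *)
Lemma qsolution_weyl L z (f g : R -> 'M[C]_m) : admissible L ->
  qsolution (pencil_q L) (pencil_r L) z f g ->
  bform (h1 L) (h0 L) z (f 0) (g 0) = 1%:M ->
  bform (H1 L) (H0 L - pencil_r L pi) z (f pi) (g pi) = 0 ->
  is_weyl_matrix L z (f 0).
Proof.
move=> aL fg U V; exists f, (fun x => g x - pencil_r L x *m f x); split=> //; split.
- exact: qsolution_solution.
- by rewrite /bcU pencil_r0 mul0mx subr0.
- rewrite -[RHS]V /bcV /bform addrA mulmxDl [RHS]addrC mulmxBl; apply/matrixP => i j.
  rewrite mulmxDl; move: (_ *m f pi) (H0 L *m f pi) (pencil_r L pi *m f pi) => a1 a2 a3.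
  by rewrite !mxE; ring.
Qed.

End PencilSystem.

Theorem theorem1 (R : realType) (m : nat) (hm : (0 < m)%N)
  (L Lt : pencil R m) (hL : admissible L) (hLt : admissible Lt)
  (hM : same_weyl_matrix L Lt) :
  ({ae lebesgue_measure,
      forall x : R, x \in `]0, pi[ -> Q0 L x = Q0 Lt x} /\
   {ae lebesgue_measure,
      forall x : R, x \in `]0, pi[ -> Q1 L x = Q1 Lt x}) /\
  (h0 L = h0 Lt /\ h1 L = h1 Lt) /\
  (H0 L = H0 Lt /\ H1 L = H1 Lt).
Proof.
have [wQ iQ [dhp dhm] [dHp dHm]] := hL; have [wQ' iQ' [dhp' dhm'] [dHp' dHm']] := hLt.
have cq := pencil_q_ccontinuous wQ; have cq' := pencil_q_ccontinuous wQ'.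
have cr := pencil_r_ccontinuous iQ; have cr' := pencil_r_ccontinuous iQ'.
have weyl z (f g f' g' : R -> 'M[R[i]]_m) :
    qsolution (pencil_q L) (pencil_r L) z f g -> qsolution (pencil_q Lt) (pencil_r Lt) z f' g' ->
    bform (h1 L) (h0 L) z (f 0) (g 0) = 1%:M -> bform (h1 Lt) (h0 Lt) z (f' 0) (g' 0) = 1%:M ->
    bform (H1 L) (H0 L - pencil_r L pi) z (f pi) (g pi) = 0 ->
    bform (H1 Lt) (H0 Lt - pencil_r Lt pi) z (f' pi) (g' pi) = 0 -> f 0 = f' 0.
  move=> fg fg' U U' V V'; apply: (hM z); [exact: (qsolution_weyl hL fg U V)|].
  exact: (qsolution_weyl hLt fg' U' V').
have [h1E h0E rE qE] := pencil_coefficients_unique cq cr cq' cr' dhp dhm dHp dHm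
  dhp' dhm' dHp' dHm' (pencil_r0 L) (pencil_r0 Lt) weyl.
have [H1E H0E] := right_boundary_unique cq cr cq' cr' dhp dhm dHp dHm
  dhp' dhm' dHp' dHm' (pencil_r0 L) (pencil_r0 Lt) weyl.
have pi0 : 0 < pi :> R by exact: pi_gt0.
(* The uniqueness argument identifies [H0 - r pi], so equality of the primitives up to the end point
   is needed to recover [H0]. *)
have rpi : pencil_r L pi = pencil_r Lt pi.
  apply/eqP; rewrite -subr_eq0; apply/eqP.
  have pib : 0 <= (pi : R) <= pi by rewrite lexx ltW.
  apply: (@mx_zero_closure _ _ _ (fun x => pencil_r L x - pencil_r Lt x) pi pi pi0 pib).
    exact: (ccontinuous_mxD cr (ccontinuous_mxN cr')).
  by move=> x /rE ->; rewrite subrr.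
split; last by split=> //; split=> //; move: H0E; rewrite rpi => /addIr.
split; last first.
  apply: aeW => x; rewrite in_itv /= => xb; have := qE x xb.
  by rewrite /pencil_q clampE //; case/andP: xb => /ltW -> /ltW.
have ae_eq (f f' : R -> R) : lebesgue_measure.-integrable `[0, pi] (EFin \o f) ->
    lebesgue_measure.-integrable `[0, pi] (EFin \o f') ->
    (forall x, 0 < x < pi -> Rintegral lebesgue_measure `[0, x] f =
      Rintegral lebesgue_measure `[0, x] f') ->
    {ae lebesgue_measure, forall x : R, 0 < x < pi -> f x = f' x}.
  move=> i1 i2 ff'.
  have i12 : lebesgue_measure.-integrable `[0, pi] (EFin \o (fun t => f t - f' t)).
    by apply: integrable_addf => //; exact: integrable_oppf.
  have z12 x : 0 < x < pi -> Rintegral lebesgue_measure `[0, x] (fun t => f t - f' t) = 0.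
    move=> /[dup] /ff' E /andP[_ /ltW xpi].
    have sub (g : R -> R) : lebesgue_measure.-integrable `[0, pi] (EFin \o g) ->
        lebesgue_measure.-integrable `[0, x] (EFin \o g).
      by apply: integrable_sub => //; rewrite bnd_simp.
    rewrite RintegralB ?E ?subrr //; exact: sub.
  have := zero_integral_ae i12 z12; apply: filterS.
    exact: (ae_filter_ringOfSetsType lebesgue_measure).
  by move=> x h /h /eqP; rewrite subr_eq0 => /eqP.
have entry (k : 'I_m * 'I_m) : {ae lebesgue_measure, forall x : R, 0 < x < pi ->
    Q0 L x k.1 k.2 = Q0 Lt x k.1 k.2}.
  have [i1 i2] := iQ k.1 k.2; have [i1' i2'] := iQ' k.1 k.2.
  have rk x : 0 < x < pi -> cintegral `[0, x] (fun t => Q0 L t k.1 k.2) =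
      cintegral `[0, x] (fun t => Q0 Lt t k.1 k.2).
    move=> xb; have /matrixP/(_ k.1 k.2) := rE x xb; rewrite !mxE clampE //.
    by case/andP: xb => /ltW -> /ltW.
  have e1 := ae_eq _ _ i1 i1' (fun x xb => congr1 (@complex.Re R) (rk x xb)).
  have e2 := ae_eq _ _ i2 i2' (fun x xb => congr1 (@complex.Im R) (rk x xb)).
  apply: (filterS2 _ _ e1 e2); first exact: (ae_filter_ringOfSetsType lebesgue_measure).
  by move=> x h1 h2 xb; apply: complexP; [exact: h1|exact: h2].
(* Finitely many exceptional null sets, one per entry, are merged into one. *)
have all_entries : {ae lebesgue_measure, forall x : R, forall k : 'I_m * 'I_m, 0 < x < pi ->
    Q0 L x k.1 k.2 = Q0 Lt x k.1 k.2}.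
  by apply: filter_forall => k; exact: entry.
move: all_entries; apply: filterS; first exact: (ae_filter_ringOfSetsType lebesgue_measure).
move=> x H; rewrite in_itv /= => xb; apply/matrixP => i j; exact: (H (i, j) xb).
Qed.
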